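(* Let $t\in\mathbb{C}$ be generic, let $\mathcal{B}\mathrm{r}_t$ be the Brauer category with parameter $t$ and generating object $\bullet$, and let $b_n$ be the number of indecomposable direct summands of $\bullet^{\otimes n}$, counted with multiplicities. Then the exponential generating function of $b_n$ is $$\sum_{n\geq0}b_n\frac{x^n}{n!}=\exp(x^2+x),$$ and as $n\to\infty$ $$b_n\sim 2^{\frac n2-\frac12}\exp\Big(\sqrt{\tfrac n2}-\tfrac n2-\tfrac18\Big)n^{\frac n2}.$$
   Context: $f(n)\sim g(n)$ means $f(n)/g(n)\to1$ as $n\to\infty$. The Brauer category $\mathcal{B}\mathrm{r}_t$ is the $\mathbb{C}$-linear strict symmetric monoidal category with objects $\bullet^{\otimes n}$, $n\in\mathbb{Z}_{\geq0}$, where $\mathrm{Hom}(\bullet^{\otimes m},\bullet^{\otimes n})$ has as basis the perfect matchings of the disjoint union of $m$ bottom points and $n$ top points. Composition is vertical stacking of diagrams, with each closed loop removed and replaced by the factor $t$; the tensor product is horizontal juxtaposition. Generic $t$ means that the category is semisimple, i.e. all endomorphism algebras of the objects $\bullet^{\otimes n}$ are semisimple. Direct summands are taken in the additive Karoubi envelope. *)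

(* Defs.v *)
From HB Require Import structures.
From mathcomp Require Import all_classical all_reals all_analysis.
From mathcomp Require Import all_boot all_order all_algebra.
From mathcomp Require Import complex.
Import GRing.Theory Num.Theory.
Import numFieldNormedType.Exports.

Set Implicit Arguments.
Unset Strict Implicit.
Unset Printing Implicit Defensive.

Local Open Scope ring_scope.

(* ** Brauer diagrams *)

Definition perfect_matching (T : finType) (P : {set {set T}}) : bool :=
  partition P [set: T] && [forall B in P, #|B| == 2%N].

(* 'I_m is the set of bottom points and 'I_n the set of top points. *)
Definition diagram (m n : nat) : finType :=
  {P : {set {set 'I_m + 'I_n}} | perfect_matching P}.

Definition id_pairs (n : nat) : {set {set 'I_n + 'I_n}} :=
  [set [set inl i; inr i] | i : 'I_n].

Lemma id_pairs_matching (n : nat) : perfect_matching (id_pairs n).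
Proof.
apply/andP; split; last first.
  by apply/forall_inP => B /imsetP[i _ ->]; rewrite cards2.
apply/and3P; split.
- apply/eqP/setP => x; rewrite in_setT; apply/bigcupP.
  by case: x => i; exists [set inl i; inr i];
    rewrite ?in_set2 ?eqxx ?orbT //; apply: imset_f.
- apply/trivIsetP => _ _ /imsetP[i _ ->] /imsetP[j _ ->] neq.
  have nij : i != j by apply: contraNneq neq => ->.
  apply/pred0P => x /=; rewrite !in_set2.
  have ninl (k l : 'I_n) : (inl k == inl l :> 'I_n + 'I_n) = (k == l) by [].
  have ninr (k l : 'I_n) : (inr k == inr l :> 'I_n + 'I_n) = (k == l) by [].
  apply/negbTE/negP => /andP[/orP[]/eqP-> /orP[]] //; rewrite ?ninl ?ninr;
    exact/negP.
- by apply/imsetP => -[i _ /setP/(_ (inl i))]; rewrite in_set0 in_set2 eqxx.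
Qed.

Definition id_diagram (n : nat) : diagram n n :=
  Sub (id_pairs n) (id_pairs_matching n).

(* When E : diagram n p is stacked on D : diagram m n, the vertices are the
   bottom points of D, the n middle points, and the top points of E. *)
Definition stack_vertex (m n p : nat) : finType := ('I_m + 'I_n + 'I_p)%type.

Definition lower (m n p : nat) (x : 'I_m + 'I_n) : stack_vertex m n p := inl x.

Definition upper (m n p : nat) (y : 'I_n + 'I_p) : stack_vertex m n p :=
  match y with inl j => inl (inr j) | inr k => inr k end.

Definition outer (m n p : nat) (z : 'I_m + 'I_p) : stack_vertex m n p :=
  match z with inl i => inl (inl i) | inr k => inr k end.

Definition stack_adj (m n p : nat) (E : diagram n p) (D : diagram m n) :
    rel (stack_vertex m n p) :=
  fun u v =>
    [exists B in val D,
       (u \in @lower m n p @: B) && (v \in @lower m n p @: B)]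
    || [exists B in val E,
       (u \in @upper m n p @: B) && (v \in @upper m n p @: B)].

Definition stack_components (m n p : nat) (E : diagram n p) (D : diagram m n) :
    {set {set stack_vertex m n p}} :=
  equivalence_partition (connect (stack_adj E D)) [set: stack_vertex m n p].

(* The components of the stacked graph that meet the outer points are the
   strands of the composite diagram; the others are its closed loops. *)
Definition stack_pairs (m n p : nat) (E : diagram n p) (D : diagram m n) :
    {set {set 'I_m + 'I_p}} :=
  [set @outer m n p @^-1: (X : {set stack_vertex m n p})
    | X in stack_components E D] :\ set0.

Definition stack_loops (m n p : nat) (E : diagram n p) (D : diagram m n) : nat :=
  #|[set X in stack_components E D
      | @outer m n p @^-1: (X : {set stack_vertex m n p}) == set0]|.

(* ** The Brauer category

   The object n : nat stands for the n-th tensor power of the generator. *)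

(* Linear combinations of diagrams, as coefficient functions. *)
Definition brauer_hom (K : fieldType) (m n : nat) : vectType K :=
  {ffun diagram m n -> K^o}.

Definition brauer_id (K : fieldType) (n : nat) : brauer_hom K n n :=
  [ffun F : diagram n n => (F == id_diagram n)%:R].

(* Bilinear extension of stacking: a pair (E, D) contributes t ^+ (number of
   loops) to the coefficient of the diagram F whose pairs are stack_pairs E D. *)
Definition brauer_comp (K : fieldType) (t : K) (m n p : nat)
    (g : brauer_hom K n p) (f : brauer_hom K m n) : brauer_hom K m p :=
  [ffun F : diagram m p =>
     \sum_(E : diagram n p) \sum_(D : diagram m n | val F == stack_pairs E D)
        t ^+ stack_loops E D * g E * f D].

(* In the stack of two identity diagrams, the component of a vertex is the set
   of the three vertices in the same column. *)
Definition column (n : nat) (u : stack_vertex n n n) : 'I_n :=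
  match u with inl (inl i) => i | inl (inr i) => i | inr i => i end.

Lemma stack_adj_id (n : nat) (u v : stack_vertex n n n) :
  stack_adj (id_diagram n) (id_diagram n) u v -> column u = column v.
Proof.
case/orP => /exists_inP[B /imsetP[i _ ->] /andP[/imsetP[x Bx ->]]].
  move=> /imsetP[y By ->].
  by case/set2P: Bx => ->; case/set2P: By => ->.
move=> /imsetP[y By ->].
by case/set2P: Bx => ->; case/set2P: By => ->.
Qed.

Lemma stack_connect_id (n : nat) (u v : stack_vertex n n n) :
  connect (stack_adj (id_diagram n) (id_diagram n)) u v
  = (column u == column v).
Proof.
apply/idP/eqP => [/connectP[s]|].
  elim: s u => [|w s IH] u /= => [_ -> //|/andP[/stack_adj_id -> /IH]].
  by apply.
have lo (i : 'I_n) (x y : 'I_n + 'I_n) : x \in [set inl i; inr i] ->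
    y \in [set inl i; inr i] ->
    stack_adj (id_diagram n) (id_diagram n) (@lower n n n x) (@lower n n n y).
  move=> xi yi; apply/orP; left; apply/exists_inP.
  by exists [set inl i; inr i]; rewrite ?imset_f //; apply: imset_f.
have up (i : 'I_n) (x y : 'I_n + 'I_n) : x \in [set inl i; inr i] ->
    y \in [set inl i; inr i] ->
    stack_adj (id_diagram n) (id_diagram n) (@upper n n n x) (@upper n n n y).
  move=> xi yi; apply/orP; right; apply/exists_inP.
  by exists [set inl i; inr i]; rewrite ?imset_f //; apply: imset_f.
have to_mid w : connect (stack_adj (id_diagram n) (id_diagram n))
    w (inl (inr (column w))).
  case: w => [[i|i]|i] /=; first 1 last.
  - exact: connect0.
  - by apply/connect1/(up i (inr i) (inl i)); rewrite ?set21 ?set22.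
  - by apply/connect1/(lo i (inl i) (inr i)); rewrite ?set21 ?set22.
have of_mid w : connect (stack_adj (id_diagram n) (id_diagram n))
    (inl (inr (column w))) w.
  case: w => [[i|i]|i] /=; first 1 last.
  - exact: connect0.
  - by apply/connect1/(up i (inl i) (inr i)); rewrite ?set21 ?set22.
  - by apply/connect1/(lo i (inr i) (inl i)); rewrite ?set21 ?set22.
by move=> uv; apply: connect_trans (to_mid u) _; rewrite uv.
Qed.

Lemma outer_component_id (n : nat) (u : stack_vertex n n n) :
  @outer n n n @^-1:
    [set v in [set: stack_vertex n n n]
       | connect (stack_adj (id_diagram n) (id_diagram n)) u v]
  = [set inl (column u); inr (column u)].
Proof.
apply/setP => z; rewrite !inE stack_connect_id /=.
by case: z => i /=; rewrite eq_sym ?orbF.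
Qed.

Lemma stack_pairs_id (n : nat) :
  stack_pairs (id_diagram n) (id_diagram n) = id_pairs n.
Proof.
apply/setP => P; rewrite in_setD1; apply/andP/imsetP.
  case=> _ /imsetP[_ /imsetP[u _ ->] ->].
  by exists (column u) => //; rewrite outer_component_id.
case=> i _ ->; split.
  by apply/set0Pn; exists (inl i); rewrite set21.
apply/imsetP; eexists; first by apply: imset_f (in_setT (inr i)).
by rewrite outer_component_id.
Qed.

Lemma stack_loops_id (n : nat) :
  stack_loops (id_diagram n) (id_diagram n) = 0%N.
Proof.
apply/eqP; rewrite cards_eq0; apply/eqP/setP => X; rewrite !inE.
apply/negbTE/negP => /andP[/imsetP[u _ ->]]; rewrite outer_component_id.
by move=> /eqP/setP/(_ (inl (column u))); rewrite set21 in_set0.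
Qed.

Lemma brauer_comp_id (K : fieldType) (t : K) (n : nat) :
  brauer_comp t (brauer_id K n) (brauer_id K n) = brauer_id K n.
Proof.
apply/ffunP => F; rewrite ffunE (bigD1 (id_diagram n)) //=.
rewrite [X in _ + X]big1 ?addr0; last first.
  move=> E /negPf neE; rewrite big1 // => D _.
  by rewrite ffunE neE mulr0 mul0r.
rewrite big_mkcond (bigD1 (id_diagram n)) //= big1 ?addr0; last first.
  by move=> D /negPf neD; case: ifP => // _; rewrite [X in _ * X]ffunE neD mulr0.
rewrite stack_pairs_id stack_loops_id !ffunE eqxx !mulr1 expr0.
by rewrite -[id_pairs n]/(val (id_diagram n)) val_eqE; case: eqP.
Qed.

Definition left_ideal (K : fieldType) (t : K) (n : nat)
    (I : {vspace brauer_hom K n n}) : Prop :=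
  forall a x : brauer_hom K n n, x \in I -> brauer_comp t a x \in I.

(* The regular module of the endomorphism algebra of n is semisimple: every
   submodule is a direct summand. *)
Definition semisimple_End (K : fieldType) (t : K) (n : nat) : Prop :=
  forall I : {vspace brauer_hom K n n}, left_ideal t I ->
  exists J : {vspace brauer_hom K n n},
    [/\ left_ideal t J, (I + J)%VS = fullv & (I :&: J)%VS = 0%VS].

Definition generic (K : fieldType) (t : K) : Prop :=
  forall n : nat, semisimple_End t n.

(* ** The additive envelope: finite families of objects (formal direct sums)
   and matrices of morphisms *)

Record add_obj := AddObj { add_len : nat; add_comp : 'I_add_len -> nat }.

Definition add_hom (K : fieldType) (X Y : add_obj) : Type :=
  forall (j : 'I_(add_len Y)) (i : 'I_(add_len X)),
    brauer_hom K (add_comp i) (add_comp j).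

Definition add_mor0 (K : fieldType) (X Y : add_obj) : add_hom K X Y :=
  fun j i => 0.

Arguments add_mor0 K X Y : clear implicits.

Definition add_mor_sum (K : fieldType) (X Y : add_obj) (k : nat)
    (f : 'I_k -> add_hom K X Y) : add_hom K X Y :=
  fun j i => \sum_(l < k) f l j i.

Definition add_mor_comp (K : fieldType) (t : K) (X Y Z : add_obj)
    (g : add_hom K Y Z) (f : add_hom K X Y) : add_hom K X Z :=
  fun j i => \sum_(l < add_len Y) brauer_comp t (g j l) (f l i).

(* ** The Karoubi envelope of the additive envelope *)

Record kar_obj (K : fieldType) (t : K) := KarObj {
  kar_carrier : add_obj;
  kar_idem : add_hom K kar_carrier kar_carrier;
  kar_idemP : add_mor_comp t kar_idem kar_idem = kar_idem }.

Arguments kar_idem {K t} k.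

(* The morphisms X -> Y of the Karoubi envelope are the morphisms between the
   carriers that absorb the idempotents; the identity of X is kar_idem X. *)
Definition is_kar_mor (K : fieldType) (t : K) (X Y : kar_obj t)
    (f : add_hom K (kar_carrier X) (kar_carrier Y)) : Prop :=
  add_mor_comp t (kar_idem Y) (add_mor_comp t f (kar_idem X)) = f.

Definition kar_zero (K : fieldType) (t : K) (X : kar_obj t) : Prop :=
  kar_idem X = add_mor0 K (kar_carrier X) (kar_carrier X).

(* X is a biproduct of the family Y. *)
Definition is_direct_sum (K : fieldType) (t : K) (X : kar_obj t) (k : nat)
    (Y : 'I_k -> kar_obj t) : Prop :=
  exists (inj : forall i, add_hom K (kar_carrier (Y i)) (kar_carrier X))
         (proj : forall i, add_hom K (kar_carrier X) (kar_carrier (Y i))),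
    [/\ forall i, is_kar_mor (inj i) /\ is_kar_mor (proj i),
        forall i, add_mor_comp t (proj i) (inj i) = kar_idem (Y i),
        forall i j, i != j ->
          add_mor_comp t (proj i) (inj j)
          = add_mor0 K (kar_carrier (Y j)) (kar_carrier (Y i))
      & add_mor_sum (fun i => add_mor_comp t (inj i) (proj i)) = kar_idem X].

Definition indecomposable (K : fieldType) (t : K) (X : kar_obj t) : Prop :=
  ~ kar_zero X /\
  forall Y : 'I_2 -> kar_obj t, is_direct_sum X Y -> exists i, kar_zero (Y i).

(* n, seen as a one-term formal sum. *)
Definition bullet_obj (n : nat) : add_obj := AddObj (fun _ : 'I_1 => n).

Definition bullet_id (K : fieldType) (n : nat) :
    add_hom K (bullet_obj n) (bullet_obj n) :=
  fun _ _ => brauer_id K n.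

Arguments bullet_id K n : clear implicits.

Lemma bullet_id_idem (K : fieldType) (t : K) (n : nat) :
  add_mor_comp t (bullet_id K n) (bullet_id K n) = bullet_id K n.
Proof.
apply: functional_extensionality_dep => j.
apply: functional_extensionality_dep => i.
by rewrite /add_mor_comp /= big_ord_recl big_ord0 addr0 brauer_comp_id.
Qed.

(* The n-th tensor power of the generator. *)
Definition bullet_power (K : fieldType) (t : K) (n : nat) : kar_obj t :=
  KarObj (bullet_id_idem t n).

(* The object n splits into k indecomposable direct summands. *)
Definition has_num_summands (K : fieldType) (t : K) (n k : nat) : Prop :=
  exists Y : 'I_k -> kar_obj t,
    is_direct_sum (bullet_power t n) Y /\ forall i, indecomposable (Y i).

(* ** Asymptotic equivalence *)

Definition asymp_equiv (R : realType) (f g : nat -> R) : Prop :=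
  ((fun n => f n / g n) @ \oo --> (1 : R))%classic.

(* Main.v *)
(* Turning diagrams upside down is a linear anti-involution of End(n).  If End(n)
   has a complete family of b orthogonal primitive idempotents, each fixed by the
   flip, then in the Peirce decomposition e_i A e_j the flip swaps the blocks (i, j)
   and (j, i) and fixes the lines e_i A e_i, so its trace is b; in the basis of
   diagrams this trace is the number of flip-invariant diagrams.  Such a family
   exists because enough primitive idempotents are flip-invariant: cups and caps
   reduce this to the quotient K[S_n], where it follows by induction on n from the
   fact that every element of S_n is conjugate to its inverse under S_(n-1).
   Removing the strand of one point from a flip-invariant diagram, together with
   its mirror image, gives b_(n+2) = b_(n+1) + 2 (n + 1) b_n.

   For the asymptotics, with n = 2m + p and l = sqrt m, the number m! l^p b_n / n!
   equals the sum over J = p mod 2 of (l^J / J!) m^_(J/2) / m^(J/2).  The Poisson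
   weight l^J / J! concentrates at J = l, where the last ratio tends to exp(-1/8),
   and each parity carries half of the mass, so the sum is ~ exp(l - 1/8) / 2.  The
   unknown constant in Stirling's formula cancels in n! / m!. *)
Require Import Defs.
From mathcomp Require Import all_classical all_reals all_analysis.
From mathcomp Require Import all_boot all_order all_algebra.
From mathcomp Require Import all_fingroup.
From mathcomp Require Import complex.
From mathcomp Require Import ring lra zify.
Import Order.TTheory GRing.Theory Num.Theory.
Import numFieldNormedType.Exports.

Set Implicit Arguments.
Unset Strict Implicit.
Unset Printing Implicit Defensive.

Local Open Scope ring_scope.

(** * Primitive idempotents *)

(** Genericity enters through semiprimeness: for [x != 0] some [x ** a ** x] is nonzero. From it,
    left ideals of minimal dimension and one eigenvector produce primitive idempotents whose corners
    are lines. Flip-invariance is the obstacle: on a block where an anti-involution is of symplectic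
    type, no primitive idempotent is fixed. So one has to show that every nonzero element is met by
    a fixed primitive idempotent (hypothesis [enough_fixed]) before a complete fixed family can be
    split off. Composites are defined by connected components of a graph, which makes associativity
    awkward. A diagram is therefore encoded by the two-colourings of its endpoints that are constant
    on pairs. Stacking becomes a matrix product in which each loop contributes a factor 2, and both
    the diagram and the number of loops can be read off the result, so identities of diagrams become
    identities of matrices. Origin of 1/8: [m^_j / m^j] is about [exp(- j^2 / (2 m))], and [J = 2 j]
    near [sqrt m] gives [j^2 / (2 m) = 1/8]. *)

Section LinearFunctions.
Variables (K : fieldType) (V W : lmodType K) (T : V -> W).
Hypothesis Tlin : linear T.
Lemma lin0 : T 0 = 0.
Proof. by have := Tlin (-1) 0 0; rewrite scaleN1r oppr0 addr0 scaleN1r addNr. Qed.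
Lemma linZ a x : T (a *: x) = a *: T x.
Proof. by rewrite -[a *: x]addr0 Tlin lin0 addr0. Qed.
Lemma linD x y : T (x + y) = T x + T y.
Proof. by rewrite -[x]scale1r Tlin !scale1r. Qed.
Lemma linB x y : T (x - y) = T x - T y.
Proof. by rewrite linD -scaleN1r linZ scaleN1r. Qed.
Lemma lin_sum I (r : seq I) (P : pred I) F :
  T (\sum_(i <- r | P i) F i) = \sum_(i <- r | P i) T (F i).
Proof. by apply: (big_morph T linD lin0). Qed.
End LinearFunctions.

(** A subspace inside [P] is enlarged greedily: each new vector raises the dimension, which is
    bounded by that of the whole space. This gives ideals described by a [Prop] a dimension. *)
Lemma vspace_of_closed (K : fieldType) (A : vectType K) (P : A -> Prop) :
  P 0 -> (forall a x y, P x -> P y -> P (a *: x + y)) ->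
  exists U : {vspace A}, forall x, x \in U <-> P x.
Proof.
move=> P0 Plin.
have H k : exists U : {vspace A}, (forall x, x \in U -> P x) /\
   ((k <= \dim U)%N \/ forall x, P x -> x \in U).
  elim: k => [|k [U [UP Uk]]].
    by exists 0%VS; split; [move=> x; rewrite memv0 => /eqP->|left].
  have [PU|/existsNP[x /not_implyP[Px xU]]] := pselect (forall x, P x -> x \in U).
    by exists U; split => //; right.
  exists (U + <[x]>)%VS; split.
    move=> _ /memv_addP[u uU [_ /vlineP[a ->] ->]].
    by rewrite addrC; apply: Plin => //; exact: UP.
  left; case: Uk => [Uk|/(_ x Px)//].
  apply: leq_ltn_trans Uk _.
  rewrite ltn_neqAle dimvS ?addvSl// andbT.
  apply/negP => /eqP dimE; apply: xU.
  have /eqP -> : U == (U + <[x]>)%VS by rewrite eqEdim addvSl dimE leqnn.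
  by rewrite memvE addvSr.
have [U [UP Uk]] := H (\dim {:A}).+1.
exists U => x; split; first exact: UP.
case: Uk => [|h]; last exact: h.
by rewrite ltnNge dimvS// subvf.
Qed.

Lemma eigenvector_in (K : numClosedFieldType) (A : vectType K)
    (U : {vspace A}) (T : A -> A) :
  linear T -> (forall x, x \in U -> T x \in U) -> U != 0%VS ->
  exists a x, [/\ x \in U, x != 0 & T x = a *: x].
Proof.
move=> Tlin TU U0.
set d := \dim U.
have d0 : (0 < d)%N by rewrite lt0n dimv_eq0.
pose b := vbasis U.
have bU i : b`_i \in U.
  have [ib|ib] := ltnP i d; first by apply/vbasis_mem/mem_nth; rewrite size_tuple.
  by rewrite nth_default ?mem0v// size_tuple.
pose M := \matrix_(i < d, j < d) coord b j (T b`_i).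
have [a /eigenvalueP[v vM v0]] := eigenvalue_closed M d0.
have inj (w : 'rV[K]_d) : \sum_i w 0 i *: b`_i = 0 -> w = 0.
  move=> h; apply/rowP => i; rewrite mxE.
  have := coord_sum_free (fun i => w 0 i) i (basis_free (vbasisP U)).
  by rewrite h linear0.
exists a, (\sum_i v 0 i *: b`_i); split.
- by apply: rpred_sum => i _; exact/rpredZ/bU.
- by apply: contra_neq v0 => /inj.
have -> : a *: \sum_i v 0 i *: b`_i = \sum_i (a *: v) 0 i *: b`_i.
  by rewrite scaler_sumr; apply: eq_bigr => i _; rewrite mxE scalerA.
rewrite -vM (lin_sum Tlin); under eq_bigr do rewrite (linZ Tlin).
under [RHS]eq_bigr do rewrite mxE scaler_suml.
rewrite exchange_big/=; apply: eq_bigr => i _.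
rewrite {1}(coord_vbasis (TU _ (bU i))) scaler_sumr.
by apply: eq_bigr => j _; rewrite mxE scalerA.
Qed.

Section PrimitiveIdempotents.
Variables (K : numClosedFieldType) (A : vectType K) (mul : A -> A -> A).
Local Notation "x ** y" := (mul x y) (at level 40, left associativity).

(** The product is an explicit operation so that the same lemmas serve for composition of diagrams
    and for convolution on a group. *)
Definition bilinear_assoc :=
  [/\ forall x y z, x ** (y ** z) = x ** y ** z,
      forall a x y z, (a *: x + y) ** z = a *: (x ** z) + y ** z &
      forall a x y z, z ** (a *: x + y) = a *: (z ** x) + z ** y].

Hypothesis mulP : bilinear_assoc.
Let mulA x y z : x ** (y ** z) = x ** y ** z. Proof. by have [] := mulP. Qed.
Lemma mul_lin_l z : linear (mul^~ z). Proof. by have [_ h _] := mulP => a x y; exact: h. Qed.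
Lemma mul_lin_r z : linear (mul z). Proof. by have [_ _ h] := mulP => a x y; exact: h. Qed.
Lemma amul0r z : 0 ** z = 0. Proof. exact: (lin0 (mul_lin_l z)). Qed.
Lemma amulr0 z : z ** 0 = 0. Proof. exact: (lin0 (mul_lin_r z)). Qed.
Lemma amulDl x y z : (x + y) ** z = x ** z + y ** z. Proof. exact: (linD (mul_lin_l z)). Qed.
Lemma amulDr x y z : z ** (x + y) = z ** x + z ** y. Proof. exact: (linD (mul_lin_r z)). Qed.
Lemma amulBl x y z : (x - y) ** z = x ** z - y ** z. Proof. exact: (linB (mul_lin_l z)). Qed.
Lemma amulBr x y z : z ** (x - y) = z ** x - z ** y. Proof. exact: (linB (mul_lin_r z)). Qed.
Lemma amulZl a x z : (a *: x) ** z = a *: (x ** z). Proof. exact: (linZ (mul_lin_l z)). Qed.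
Lemma amulZr a x z : z ** (a *: x) = a *: (z ** x). Proof. exact: (linZ (mul_lin_r z)). Qed.
Lemma amul_suml I (r : seq I) (P : pred I) F z :
  (\sum_(i <- r | P i) F i) ** z = \sum_(i <- r | P i) F i ** z.
Proof. exact: (lin_sum (mul_lin_l z)). Qed.
Lemma amul_sumr I (r : seq I) (P : pred I) F z :
  z ** (\sum_(i <- r | P i) F i) = \sum_(i <- r | P i) z ** F i.
Proof. exact: (lin_sum (mul_lin_r z)). Qed.

(** Primitivity in the split form: the corner of [f] is a line. The predicate [C] stands for a
    subalgebra: a group algebra of a subgroup, a corner, or everything. *)
Definition primitive_in (C : A -> Prop) f :=
  [/\ f != 0, f ** f = f & forall a, C a -> exists l, f ** a ** f = l *: f].

(* The idempotent comes from a minimal left ideal C y contained in C x. *)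
Lemma primitive_in_left_ideal (C : A -> Prop) (x : A) :
  C 0 -> (forall a x y, C x -> C y -> C (a *: x + y)) ->
  (forall x y, C x -> C y -> C (x ** y)) ->
  (forall x, C x -> x != 0 -> exists2 a, C a & x ** a ** x != 0) ->
  C x -> x != 0 ->
  exists f, [/\ C f, primitive_in C f & exists2 c, C c & f = c ** x].
Proof.
move=> C0 Clin CM Csp Cx x0.
have idealP y : exists U : {vspace A}, forall z, z \in U <-> exists2 c, C c & z = c ** y.
  apply: vspace_of_closed => [|a _ _ [c Cc ->] [d Cd ->]].
    by exists 0; rewrite ?amul0r.
  by exists (a *: c + d); [exact: Clin|rewrite amulDl amulZl].
pose good d := `[< exists y (U : {vspace A}), [/\ C y, y != 0,
   (exists2 c, C c & y = c ** x),
   forall z, z \in U <-> exists2 c, C c & z = c ** y & \dim U = d] >].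
have exg : exists d, good d.
  have [a Ca xax] := Csp _ Cx x0.
  have ax0 : a ** x != 0 by apply: contra_neq xax; rewrite -mulA => ->; rewrite amulr0.
  have [U UP] := idealP (a ** x).
  exists (\dim U); apply/asboolP; exists (a ** x), U; split => //; first exact: CM.
  by exists a.
have [_ /asboolP[y [L [Cy y0 [cy Ccy yE] LP <-]]] Lmin] := ex_minnP exg.
have LC z : z \in L -> C z by move=> /LP[c Cc ->]; exact: CM.
have LM c z : C c -> z \in L -> c ** z \in L.
  by move=> Cc /LP[d Cd ->]; apply/LP; exists (c ** d); [exact: CM|rewrite mulA].
(* Minimality of [L]: the left ideal of [z] lies in [L] and cannot have smaller dimension. *)
have Lgen z w : z \in L -> z != 0 -> w \in L -> exists2 c, C c & w = c ** z.
  move=> zL z0 wL; have [U UP] := idealP z.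
  have UL : (U <= L)%VS by apply/subvP => u /UP[c Cc ->]; exact: LM.
  suff /eqP UE : U == L by apply/UP; rewrite UE.
  rewrite eqEdim UL/=; apply: Lmin; apply/asboolP; exists z, U; split => //.
    exact: LC.
  have /LP[c Cc ->] := zL; exists (c ** cy); first exact: CM.
  by rewrite -mulA -yE.
have [a Ca yay] := Csp _ Cy y0.
set u := a ** y.
have u0 : u != 0 by apply: contra_neq yay => uE; rewrite -mulA -/u uE amulr0.
have yu0 : y ** u != 0 by rewrite mulA.
have uL : u \in L by apply/LP; exists a.
have yuL : y ** u \in L by exact: LM.
have [c Cc uE] := Lgen _ _ yuL yu0 uL.
have [f fdef] : exists f, f = c ** y by exists (c ** y).
have fL : f \in L by apply/LP; exists c.
have fu : f ** u = u by rewrite fdef -mulA.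
have f0 : f != 0 by apply: contra_neq u0 => fE; rewrite -fu fE amul0r.
(* If [f ** f - f] were nonzero it would generate [f]; but its product with [u] is zero because
   [f ** u = u], so [f ** u] would vanish. *)
have ff : f ** f = f.
  apply/eqP; rewrite -subr_eq0; apply/negP => /negP z0.
  have zL : f ** f - f \in L by apply: rpredB => //; apply: LM => //; exact: LC.
  have [d Cd fE] := Lgen _ _ zL z0 fL.
  have : f ** u = 0 by rewrite fE -mulA amulBl -mulA fu fu subrr amulr0.
  by rewrite fu; exact/eqP.
have lf l : l \in L -> l ** f = l.
  by move=> lL; have [d Cd ->] := Lgen _ _ fL f0 lL; rewrite -mulA ff.
exists f; split; first exact: LC.
- split=> // b Cb; set al := f ** b ** f.
  have alL : al \in L by rewrite /al LM//; apply: CM => //; exact: LC.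
  (* Schur's lemma by hand: right multiplication by [al] has an eigenvector [v] in [L]. As [v]
     generates [f] and [v ** (al - l *: f) = 0], also [f ** (al - l *: f) = 0]. *)
  have [||l [v [vL v0 vE]]] := @eigenvector_in K A L (mul^~ al) (mul_lin_l al).
  + by move=> z zL; rewrite /= LM//; exact: LC.
  + by apply: contra_neq f0 => L0; apply/eqP; rewrite -memv0 -L0.
  exists l; apply/eqP; rewrite -subr_eq0; apply/eqP.
  have [d Cd fE] := Lgen _ _ vL v0 fL.
  have vz : v ** (al - l *: f) = 0 by rewrite amulBr amulZr lf// vE subrr.
  have <- : f ** (al - l *: f) = al - l *: f.
    by rewrite amulBr amulZr /al !mulA !ff.
  by rewrite {1}fE -mulA vz amulr0.
- by exists (c ** cy); [exact: CM|rewrite -mulA -yE fdef].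
Qed.

End PrimitiveIdempotents.

(** * Semiprime algebras: traces and the number of primitive idempotents *)

Section FiniteDimensionalAlgebra.
Variables (K : numClosedFieldType) (D : finType).
Local Notation A := ({ffun D -> K^o} : vectType K).
Variables (mul : A -> A -> A) (one : A).
Local Notation "x ** y" := (mul x y) (at level 40, left associativity).
Hypothesis mulP : bilinear_assoc mul.
Hypothesis mul1 : forall x, one ** x = x.
Hypothesis mulr1 : forall x, x ** one = x.
Hypothesis semiprime : forall x : A, x != 0 -> exists a, x ** a ** x != 0.
Let mulA x y z : x ** (y ** z) = x ** y ** z. Proof. by have [] := mulP. Qed.
Let mul0r := amul0r mulP.
Let mulr0 := amulr0 mulP.
Let mulZl := amulZl mulP.
Let mulZr := amulZr mulP.
Let mulBl := amulBl mulP.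
Let mulBr := amulBr mulP.
Let mulDl := amulDl mulP.
Let mulDr := amulDr mulP.
Let mul_suml := amul_suml mulP.
Let mul_sumr := amul_sumr mulP.

Definition primitive (f : A) := primitive_in mul (fun _ => True) f.

Definition complete_primitive_family (b : nat) (e : 'I_b -> A) :=
  [/\ forall i, primitive (e i), forall i j, i != j -> e i ** e j = 0
    & \sum_i e i = one].

Definition basis_fun (d : D) : A := [ffun d' => (d' == d)%:R].

Lemma basis_fun_sum (x : A) : x = \sum_d x d *: basis_fun d.
Proof.
apply/ffunP => d; rewrite sum_ffunE (bigD1 d)//= big1 => [|d' nd].
  by rewrite !ffunE eqxx addr0 /GRing.scale/= GRing.mulr1.
by rewrite !ffunE eq_sym (negPf nd) /GRing.scale/= GRing.mulr0.
Qed.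

Definition trace (T : A -> A) : K := \sum_d T (basis_fun d) d.

Lemma trace_sum (I : finType) (T : I -> A -> A) :
  trace (fun x => \sum_i T i x) = \sum_i trace (T i).
Proof. by rewrite exchange_big; apply: eq_bigr => d _; rewrite sum_ffunE. Qed.

Lemma eq_trace (T U : A -> A) : T =1 U -> trace T = trace U.
Proof. by move=> TU; apply: eq_bigr => d _; rewrite TU. Qed.

Lemma trace_comp (T U : A -> A) : linear T -> linear U ->
  trace (T \o U) = trace (U \o T).
Proof.
move=> Tl Ul.
have E (T1 U1 : A -> A) : linear T1 ->
    trace (T1 \o U1) = \sum_d \sum_d' U1 (basis_fun d) d' * T1 (basis_fun d') d.
  move=> T1l; apply: eq_bigr => d _ /=.
  rewrite {1}[U1 _]basis_fun_sum (lin_sum T1l) sum_ffunE.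
  by apply: eq_bigr => d' _; rewrite (linZ T1l) ffunE.
rewrite !E// exchange_big; apply: eq_bigr => d _; apply: eq_bigr => d' _.
by rewrite mulrC.
Qed.

(** Writing [T x = phi x *: u], the trace is the sum of [phi d * u d] over the basis, that is
    [phi u]. *)
Lemma trace_rank1 (T : A -> A) (u : A) : linear T -> u != 0 ->
  (forall x, exists l, T x = l *: u) -> T u = u -> trace T = 1.
Proof.
move=> Tl u0 /choice[phi phiP] Tu.
have Tu' : T u = trace T *: u.
  rewrite {1}(basis_fun_sum u) (lin_sum Tl) scaler_suml.
  by apply: eq_bigr => d _; rewrite (linZ Tl) phiP scalerA ffunE mulrC.
have : (trace T - 1) *: u = 0 by rewrite scalerBl scale1r -Tu' Tu subrr.
by move/eqP; rewrite scaler_eq0 (negPf u0) orbF subr_eq0 => /eqP.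
Qed.

(** For idempotents this is Murray-von Neumann equivalence, that is isomorphism of the left ideals
    [A e] and [A f]. Only [u] is required to lie in [e A f]. *)
Definition linked (e f : A) := exists u v,
  [/\ u ** v = e, v ** u = f, u ** f = u & e ** u = u].

Lemma linked_refl e : primitive e -> linked e e.
Proof. by case=> _ ee _; exists e, e. Qed.

(** Nothing places [v] in [f A e], so it is replaced by the normalized element [v ** (u ** v)]. *)
Lemma linkedC e f : linked e f -> linked f e.
Proof.
move=> [u [v [uv vu uf eu]]].
have uvu z : u ** (v ** (u ** z)) = u ** z by rewrite !mulA uv eu.
have uvu1 : u ** (v ** u) = u by rewrite mulA uv.
exists (v ** (u ** v)), u; split.
- by rewrite -!mulA uvu1.
- by rewrite uvu.
- by rewrite -uv -!mulA uvu.
- by rewrite -vu -!mulA uvu.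
Qed.

(** With [u] the given element of [e A f], semiprimeness yields [a] with [u ** a ** u] nonzero. Both
    corners being lines, [u ** a ** e] is [l] times [e] and [f ** a ** u] is [m] times [f]. Both
    compute [u ** a ** u], so [l = m] is invertible and rescales [f ** a ** e] to the required
    partner. *)
Lemma linked_of_neq0 e f x : primitive e -> primitive f ->
  e ** x ** f != 0 -> linked e f.
Proof.
move=> [e0 ee eAe] [f0 ff fAf].
have : e ** x ** f ** f = e ** x ** f by rewrite -mulA ff.
have : e ** (e ** x ** f) = e ** x ** f by rewrite !mulA ee.
move: (e ** x ** f) => u eu uf u0.
have [a ua] := semiprime u0.
have [l lE] := eAe (u ** a) I; have [m mE] := fAf (a ** u) I.
have fa : f ** a ** u = m *: f by rewrite -mE -!mulA uf.
have ea : u ** a ** e = l *: e by rewrite -lE mulA eu.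
have lu : l *: u = u ** a ** u by rewrite -{3}eu mulA ea mulZl eu.
have mu : m *: u = u ** a ** u by rewrite -{2}uf -!mulA (mulA f) fa mulZr uf.
have l0 : l != 0 by apply: contra_neq ua => l0; rewrite -lu l0 scale0r.
have lm : l = m.
  apply/eqP; rewrite -subr_eq0.
  have : (l - m) *: u == 0 by rewrite scalerBl lu mu subrr.
  by rewrite scaler_eq0 (negPf u0) orbF.
exists u, (l^-1 *: (f ** a ** e)); split=> //.
- by rewrite mulZr !mulA uf ea scalerA mulVf// scale1r.
- by rewrite mulZl -mulA eu fa -lm scalerA mulVf// scale1r.
Qed.

Lemma linear_mul2 e f : linear (fun x => e ** x ** f).
Proof. by move=> a x y; rewrite mulDr mulDl mulZr mulZl. Qed.

Lemma linear_mulr f : linear (fun x => x ** f).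
Proof. by move=> a x y; rewrite mulDl mulZl. Qed.

(** The map is the projection onto [e A f], which is the line of [u] if the idempotents are linked
    and zero otherwise. *)
Lemma trace_linked e f : primitive e -> primitive f ->
  trace (fun x => e ** x ** f) = `[< linked e f >]%:R.
Proof.
move=> pe pf; have [[u [v [uv vu uf eu]]]|nl] := asboolP (linked e f).
  have [e0 ee eAe] := pe.
  apply: (@trace_rank1 _ u); first exact: linear_mul2.
  - by apply: contra_neq e0 => u0; rewrite -uv u0 mul0r.
  - move=> x; have [l lE] := eAe (x ** v) I; exists l.
    have -> : e ** x ** f = e ** (x ** v) ** e ** u by rewrite -vu -!mulA eu.
    by rewrite lE mulZl eu.
  - by rewrite eu uf.
rewrite /trace big1// => d _.
have [->|/(linked_of_neq0 pe pf)//] := eqVneq (e ** basis_fun d ** f) 0.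
by rewrite ffunE.
Qed.

(** Right multiplications by [u ** v] and [v ** u] are the two orders of composition of those by [u]
    and [v]. *)
Lemma trace_mulr_linked e f : linked e f ->
  trace (fun x => x ** e) = trace (fun x => x ** f).
Proof.
move=> [u [v [<- <- _ _]]].
rewrite (@eq_trace _ (mul^~ v \o mul^~ u)) => [|x]; last by rewrite /= mulA.
rewrite trace_comp; [|exact: linear_mulr|exact: linear_mulr].
by apply: eq_trace => x; rewrite /= mulA.
Qed.

(** Inserting the sum of the [e i] on the left shows that the trace counts the members equivalent to
    [f]: a multiplicity that does not depend on the family. *)
Lemma trace_mulr (b : nat) (e : 'I_b -> A) f :
  complete_primitive_family e -> primitive f ->
  trace (fun x => x ** f) = \sum_i `[< linked (e i) f >]%:R.
Proof.
move=> [pe _ e1] pf.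
under eq_bigr do rewrite -trace_linked//.
rewrite -trace_sum; apply: eq_trace => x.
by rewrite -mul_suml -mul_suml e1 mul1.
Qed.

(* Both sizes are the sum over pairs of linked e i, e' j of the inverse of the
   common multiplicity of e i and e' j. *)
Lemma complete_primitive_family_size (b b' : nat) (e : 'I_b -> A) (e' : 'I_b' -> A) :
  complete_primitive_family e -> complete_primitive_family e' -> b = b'.
Proof.
move=> ce ce'.
pose r f := trace (fun x => x ** f).
have half n n' (g : 'I_n -> A) (g' : 'I_n' -> A) :
    complete_primitive_family g -> complete_primitive_family g' ->
    n'%:R = \sum_i \sum_j `[< linked (g i) (g' j) >]%:R / r (g' j).
  move=> cg cg'; rewrite exchange_big/=.
  rewrite -[n'%:R](_ : \sum_(j < n') 1 = _); last first.
    by rewrite sumr_const card_ord.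
  apply: eq_bigr => j _; have pj : primitive (g' j) by case: cg'.
  rewrite -mulr_suml -(trace_mulr cg pj) divff// (trace_mulr cg' pj).
  (* The multiplicity is invertible: it is a positive integer, as [g' j] is linked to itself, and
     the characteristic is zero. *)
  rewrite (bigD1 j)//= asboolT; last exact: linked_refl.
  by rewrite lt0r_neq0// ltr_pwDl// sumr_ge0.
apply/eqP; rewrite -(eqr_nat K) (half _ _ _ _ ce' ce) (half _ _ _ _ ce ce').
rewrite exchange_big/=; apply/eqP.
apply: eq_bigr => i _; apply: eq_bigr => j _.
have -> : `[< linked (e' j) (e i) >] = `[< linked (e i) (e' j) >].
  by apply/asboolP/asboolP; exact: linkedC.
have [h|_] := asboolP (linked (e i) (e' j)); last by rewrite !GRing.mul0r.
by rewrite /r (trace_mulr_linked h).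
Qed.

(** * Anti-involutions and fixed idempotents *)

Variable sig : A -> A.
Hypothesis sig_lin : linear sig.
Hypothesis sigK : involutive sig.
Hypothesis sigM : forall x y, sig (x ** y) = sig y ** sig x.

Lemma trace_involution (b : nat) (e : 'I_b -> A) :
  complete_primitive_family e -> (forall i, sig (e i) = e i) ->
  trace sig = b%:R.
Proof.
move=> [pe orth e1] sige.
have -> : trace sig = \sum_i \sum_j trace (fun x => e i ** sig x ** e j).
  under eq_bigr do rewrite -trace_sum.
  rewrite -trace_sum; apply: eq_trace => x.
  under eq_bigr do rewrite -mul_sumr.
  by rewrite -mul_suml -mul_suml e1 mul1 mulr1.
rewrite -[RHS](_ : \sum_(i < b) 1 = _); last by rewrite sumr_const card_ord.
apply: eq_bigr => i _; rewrite (bigD1 i)//= big1 ?addr0.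
  have [e0 ee eAe] := pe i.
  apply: (@trace_rank1 _ (e i)) => //.
  - by move=> a x y; rewrite sig_lin (linear_mul2 (e i) (e i)).
  - by move=> x; apply: eAe.
  - by rewrite sige !ee.
move=> j ji.
have [_ eei _] := pe i; have [_ eej _] := pe j.
(* The off-diagonal map is composed with the projection onto its block. In the other order the
   composite is [e i ** sig (e i ** x ** e j) ** e j], which contains the factor
   [e i ** e j = 0]. *)
rewrite (@eq_trace _ ((fun x => e i ** x ** e j) \o (fun x => e i ** sig x ** e j))).
  rewrite trace_comp; first last.
  - by move=> a x y; rewrite sig_lin (linear_mul2 (e i) (e j)).
  - exact: linear_mul2.
  rewrite /trace big1// => d _ /=.
  by rewrite !sigM !sige !mulA orth 1?eq_sym// !mul0r ffunE.
by move=> x /=; rewrite !mulA eei -!mulA eej.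
Qed.

Hypothesis enough_fixed : forall x : A, x != 0 ->
  exists f a, [/\ primitive f, sig f = f & x ** a ** f != 0].

(* On the x with g ** x = x and x ** f = x, the product sig x ** y is a symmetric
   bilinear form with values in K f; it is nonzero by semiprimeness, so some x is
   anisotropic, and x ** sig x is then a multiple of the required idempotent. *)
Lemma fixed_primitive_below g : g ** g = g -> sig g = g -> g != 0 ->
  exists f, [/\ primitive f, sig f = f, g ** f = f & f ** g = f].
Proof.
move=> gg sg g0; have [f [a [pf sf gaf]]] := enough_fixed g0.
have [f0 ff fAf] := pf.
pose inH x := g ** x = x /\ x ** f = x.
have [x [[gx xf] sxx]] : exists x, inH x /\ sig x ** x != 0.
  apply: contrapT => /forallNP no.
  have sxx x : inH x -> sig x ** x = 0.
    by move=> hx; apply/eqP/negP => /negP h; apply: (no x).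
  have inHD x y : inH x -> inH y -> inH (x + y).
    by move=> [hx xh] [hy yh]; split; rewrite ?mulDr ?mulDl ?hx ?hy ?xh ?yh.
  (* Polarization: if all diagonal values vanish, symmetry of the form makes twice the value at [x],
     [y] zero, and 2 is invertible. *)
  have sxy x y : inH x -> inH y -> sig x ** y = 0.
    move=> hx hy.
    have [l lE] : exists l, sig x ** y = l *: f.
      have [l lE] := fAf (sig x ** y) I; exists l; rewrite -lE.
      by case: hx hy => [_ hx] [_ hy]; rewrite -{1}hx -{1}hy sigM sf !mulA.
    have h := sxx _ (inHD _ _ hx hy).
    have syx : sig y ** x = sig x ** y by rewrite -[x in LHS]sigK -sigM lE (linZ sig_lin) sf.
    move: h; rewrite (linD sig_lin) mulDl !mulDr !sxx// add0r addr0 syx -mulr2n.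
    by move/eqP; rewrite -scaler_nat scaler_eq0 pnatr_eq0/= => /eqP.
  pose x := g ** a ** f.
  have hx : inH x by split; rewrite /x ?mulA ?gg// -mulA ff.
  have [c] : exists c, x ** c ** x != 0 := semiprime gaf.
  clearbody x; case/eqP.
  have -> : x ** c ** x = x ** (f ** c ** g ** x).
    by have [hg hf] := hx; rewrite !mulA hf -!mulA hg.
  suff -> : f ** c ** g ** x = 0 by rewrite mulr0.
  (* The left factor is the image under [sig] of [sig (f ** c ** g)], an element of the same space,
     so the vanishing form applies. *)
  rewrite -[f ** c ** g]sigK; apply: sxy => //.
  by split; rewrite !sigM sg sf -?mulA ?ff// mulA gg.
have [l lE] : exists l, sig x ** x = l *: f.
  have [l lE] := fAf (sig x ** x) I; exists l; rewrite -lE.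
  by rewrite -[in LHS]xf sigM sf !mulA.
have l0 : l != 0 by apply: contra_neq sxx => l0; rewrite lE l0 scale0r.
have fsx : f ** sig x = sig x by rewrite -sf -sigM xf.
have sxg : sig x ** g = sig x by rewrite -sg -sigM gx.
exists (l^-1 *: (x ** sig x)); split.
- split.
  + apply: contra_neq f0 => h.
    have : sig x ** (l^-1 *: (x ** sig x)) ** x = l *: f.
      rewrite mulZr mulZl !mulA lE mulZl mulZl fsx lE !scalerA mulVf// GRing.mul1r//.
    by rewrite h mulr0 mul0r => /esym/eqP; rewrite scaler_eq0 (negPf l0) => /eqP.
  + rewrite mulZl mulZr scalerA !mulA -(mulA x) lE mulZr mulZl xf scalerA.
    by rewrite -GRing.mulrA mulVf// GRing.mulr1.
  + move=> b _; have [m mE] := fAf (sig x ** b ** x) I.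
    exists (l^-1 * m).
    rewrite mulZl mulZr mulZl scalerA.
    have -> : x ** sig x ** b ** (x ** sig x) =
        x ** (f ** (sig x ** b ** x) ** f) ** sig x.
      by rewrite -!mulA fsx !mulA xf.
    by rewrite mE mulZr mulZl xf !scalerA; congr (_ *: _); rewrite [RHS]mulrAC.
- by rewrite (linZ sig_lin) sigM sigK.
- by rewrite mulZr mulA gx.
- by rewrite mulZl -mulA sxg.
Qed.

(** A fixed primitive idempotent [f] below [g] is split off and the induction continues with
    [g - f], again a fixed idempotent; it ends because [g A] shrinks. *)
Lemma fixed_complete_family :
  exists (b : nat) (e : 'I_b -> A), complete_primitive_family e /\ forall i, sig (e i) = e i.
Proof.
have H k g : g ** g = g -> sig g = g ->
    (exists U : {vspace A}, (forall x, x \in U <-> exists y, x = g ** y) /\ (\dim U < k)%N) ->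
    exists (b : nat) (e : 'I_b -> A), [/\ forall i, primitive (e i) /\ sig (e i) = e i,
      forall i, g ** e i = e i /\ e i ** g = e i,
      forall i j, i != j -> e i ** e j = 0 & \sum_i e i = g].
  elim: k g => [|k IH] g gg sg [U [UP dU]]; first by [].
  have [g0|g0] := eqVneq g 0.
    by exists 0%N, (fun _ => 0); split=> [[]|[]|[]|] //; rewrite big_ord0 g0.
  have [f [pf sf gf fg]] := fixed_primitive_below gg sg g0.
  have [f0 ff _] := pf.
  pose h := g - f.
  have hf : h ** f = 0 by rewrite mulBl gf ff subrr.
  have fh : f ** h = 0 by rewrite mulBr fg ff subrr.
  have hh : h ** h = h by rewrite {1}/h mulBl fh subr0 mulBr gg gf.
  have gh : g ** h = h by rewrite mulBr gg gf.
  have hg : h ** g = h by rewrite mulBl gg fg.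
  have sh : sig h = h by rewrite (linB sig_lin) sg sf.
  have [|b [e [ep eh orth eS]]] := IH h hh sh.
    have [V VP] : exists V : {vspace A}, forall x, x \in V <-> exists y, x = h ** y.
      apply: vspace_of_closed => [|c _ _ [x ->] [y ->]]; first by exists 0; rewrite mulr0.
      by exists (c *: x + y); rewrite mulDr mulZr.
    exists V; split => //; apply: leq_trans (_ : (\dim V < \dim U)%N) _ => //.
    have VU : (V <= U)%VS.
      by apply/subvP => x /VP[y ->]; apply/UP; exists (h ** y); rewrite mulA gh.
    (* [f] lies in [g A] but not in [h A], since [f ** h = 0] and [f ** f = f]. *)
    rewrite ltn_neqAle dimvS// andbT; apply/negP => /eqP dE.
    have /eqP VE : V == U by rewrite eqEdim VU dE leqnn.
    have /VP[y fE] : f \in V by rewrite VE; apply/UP; exists f.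
    by move: f0; rewrite -ff {2}fE mulA fh mul0r eqxx.
  have fe i : f ** e i = 0 by have [<- _] := eh i; rewrite mulA fh mul0r.
  have ef i : e i ** f = 0 by have [_ <-] := eh i; rewrite -mulA hf mulr0.
  exists b.+1, (fun i => if unlift ord0 i is Some j then e j else f); split.
  - by move=> i; case: unliftP.
  - move=> i; case: unliftP => [j|] _ //; have [hj jh] := eh j.
    by split; [rewrite -hj mulA gh|rewrite -jh -mulA hg].
  - move=> i j; case: unliftP => [i'|] ->; case: unliftP => [j'|] -> //.
    by rewrite (inj_eq lift_inj); exact: orth.
  - rewrite big_ord_recl unlift_none; under eq_bigr do rewrite liftK.
    by rewrite eS /h addrC subrK.
have [U UP] : exists U : {vspace A}, forall x, x \in U <-> exists y, x = one ** y.
  apply: vspace_of_closed => [|c _ _ [x ->] [y ->]]; first by exists 0; rewrite mulr0.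
  by exists (c *: x + y); rewrite mulDr mulZr.
have s1 : sig one = one by rewrite -[sig one]mulr1 -{2}[one]sigK -sigM mulr1 sigK.
have [||b [e [ep _ orth eS]]] := H (\dim U).+1 one _ s1; [exact: mul1|by exists U|].
by exists b, e; split=> [|i]; [split=> // i|]; have [] := ep i.
Qed.

End FiniteDimensionalAlgebra.

(** * Group algebras of symmetric groups *)

(* On each cycle of l, h is the reflection through a base point, which is a on
   the cycle of a. *)
Lemma perm_conj_inv_fix (T : finType) (l : {perm T}) (a : T) :
  exists h : {perm T}, [/\ (l ^ h)%g = (l^-1)%g, h a = a & forall x, l x = x -> h x = x].
Proof.
pose b x := if a \in porbit l x then a else odflt x [pick y in porbit l x].
have bx x : b x \in porbit l x.
  rewrite /b; case: ifP => // _; case: pickP => //= _; exact: porbit_id.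
have bl x y : porbit l x = porbit l y -> b x = b y.
  move=> xy; rewrite /b xy; case: ifP => // _; case: pickP => //= h.
  by have := h y; rewrite porbit_id.
have /choice[i iP] x : exists i, x = (l ^+ i)%g (b x).
  by apply/porbitP; rewrite porbit_sym.
pose h x := ((l^-1) ^+ i x)%g (b x).
have expC (u v : {perm T}) j k y : commute u v ->
    (u ^+ j)%g ((v ^+ k)%g y) = (v ^+ k)%g ((u ^+ j)%g y).
  move=> uv; rewrite -!permM; congr (fun_of_perm _ y).
  by apply: commuteX2; exact: commute_sym.
(* Agreement of two powers at a point passes to the inverse permutation; so [h] does not depend on
   the exponents chosen in [i]. *)
have flip (u : {perm T}) j k y : (u ^+ j)%g y = (u ^+ k)%g y ->
    ((u^-1) ^+ j)%g y = ((u^-1) ^+ k)%g y.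
  move=> E; apply: (@perm_inj _ (u ^+ j)%g); apply: (@perm_inj _ (u ^+ k)%g).
  rewrite !expgVn permKV expC//.
  by rewrite permKV E.
have bh x : porbit l (h x) = porbit l x.
  apply/eqP; rewrite eq_porbit_mem -(eqP (_ : porbit l (b x) == porbit l x)).
    by rewrite -porbitV; exact: mem_porbit.
  by rewrite eq_porbit_mem.
have hinj : injective h.
  move=> x y xy; have pxy : porbit l x = porbit l y by rewrite -bh xy bh.
  move: xy; rewrite /h (bl _ _ pxy) => /flip; rewrite invgK.
  by rewrite -{1}(bl _ _ pxy) -!iP.
have hl x : h (l x) = (l^-1)%g (h x).
  have plx : porbit l (l x) = porbit l x.
    by apply/eqP; rewrite eq_porbit_mem; have := mem_porbit l 1 x; rewrite expg1.
  rewrite /h -permM -expgSr (bl _ _ plx); apply: flip.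
  by rewrite expgSr permM -iP -(bl _ _ plx) -iP.
have hfix x : porbit l (h x) = [set x] -> h x = x.
  by move=> E; apply/set1P; rewrite -E porbit_id.
exists (perm hinj); split.
- rewrite conjgE; apply/permP => y; rewrite -[y](permKV (perm hinj)).
  move: ((perm hinj)^-1%g y) => z; rewrite !permM permK.
  by rewrite [LHS]permE hl [perm hinj z]permE.
- rewrite permE /h; have ba : b a = a by rewrite /b porbit_id.
  rewrite ba.
  have := @flip l (i a) 0%N a; rewrite !expg0 !perm1; apply.
  by have E := iP a; rewrite ba in E; rewrite -E.
- move=> x lx; rewrite permE; apply: hfix; rewrite bh.
  apply/setP => y; rewrite inE; apply/idP/eqP => [/porbitP[k ->]|->]; last exact: porbit_id.
  by elim: k => [|k IH]; rewrite ?expg0 ?perm1// expgSr permM IH.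
Qed.

Section GroupAlgebra.
Variables (K : numClosedFieldType) (gT : finGroupType).
Local Notation A := ({ffun gT -> K^o} : vectType K).

Definition gmul (u v : A) : A := [ffun k => \sum_g u g * v (g^-1 * k)%g].
Definition ginv (u : A) : A := [ffun g => u (g^-1)%g].
Definition gone : A := basis_fun K (1%g : gT).
Local Notation "x ** y" := (gmul x y) (at level 40, left associativity).
Local Notation delta g := (basis_fun K (g : gT)).

Lemma gmulP : bilinear_assoc gmul.
Proof.
split.
- move=> x y z; apply/ffunP => k; rewrite !ffunE.
  under eq_bigr do rewrite ffunE mulr_sumr.
  under [RHS]eq_bigr do rewrite ffunE mulr_suml.
  rewrite [RHS]exchange_big/=; apply: eq_bigr => g _.
  rewrite (reindex_inj (mulgI (g^-1)%g))/=; apply: eq_bigr => h _.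
  by rewrite mulrA invMg invgK !mulgA mulgK.
- move=> a x y z; apply/ffunP => k; rewrite !ffunE scaler_sumr -big_split/=.
  by apply: eq_bigr => g _; rewrite !ffunE mulrDl scalerAl.
- move=> a x y z; apply/ffunP => k; rewrite !ffunE scaler_sumr -big_split/=.
  by apply: eq_bigr => g _; rewrite !ffunE mulrDr scalerAr.
Qed.

Let mulA x y z : x ** (y ** z) = x ** y ** z. Proof. by have [] := gmulP. Qed.

Lemma gmul_deltal g u : delta g ** u = [ffun k => u (g^-1 * k)%g].
Proof.
apply/ffunP => k; rewrite !ffunE (bigD1 g)//= big1 => [|h hg]; rewrite ffunE.
  by rewrite eqxx mul1r addr0.
by rewrite (negPf hg) mul0r.
Qed.

Lemma gmul_deltar g u : u ** delta g = [ffun k => u (k * g^-1)%g].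
Proof.
apply/ffunP => k; rewrite !ffunE (bigD1 (k * g^-1)%g)//= big1 => [|h hg].
  by rewrite ffunE invMg invgK -mulgA mulVg mulg1 eqxx mulr1 addr0.
rewrite ffunE; case: eqP => [E|]; last by rewrite mulr0.
by case/eqP: hg; rewrite -E invMg invgK mulKVg.
Qed.

Lemma gmul_delta g h : delta g ** delta h = delta (g * h)%g.
Proof.
rewrite gmul_deltal; apply/ffunP => k; rewrite !ffunE.
by rewrite (canF_eq (mulKVg g)).
Qed.

Lemma gmul1 u : gone ** u = u.
Proof. by rewrite gmul_deltal; apply/ffunP => k; rewrite ffunE invg1 mul1g. Qed.

Lemma gmulr1 u : u ** gone = u.
Proof. by rewrite gmul_deltar; apply/ffunP => k; rewrite ffunE invg1 mulg1. Qed.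

Lemma ginvM u v : ginv (u ** v) = ginv v ** ginv u.
Proof.
apply/ffunP => k; rewrite !ffunE (reindex_inj (mulgI (k^-1)%g))/=.
apply: eq_bigr => g _; rewrite !ffunE invMg invgK mulrC.
by rewrite (invMg (g^-1)%g k) invgK -mulgA mulgV mulg1.
Qed.

Lemma gmul_trace u v : (u ** v) 1%g = (v ** u) 1%g.
Proof.
rewrite !ffunE (reindex_inj invg_inj); apply: eq_bigr => g _.
by rewrite !mulg1 invgK mulrC.
Qed.

(** The group algebra of [H] is kept inside that of [gT], so that the induction over subgroups never
    changes the ambient type. *)
Definition supported (H : {group gT}) (u : A) := forall g, u g != 0 -> g \in H.

Lemma supported0 (H : {group gT}) : supported H 0.
Proof. by move=> g; rewrite ffunE eqxx. Qed.

Lemma supported_lin (H : {group gT}) a u v :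
  supported H u -> supported H v -> supported H (a *: u + v).
Proof.
move=> Hu Hv g; apply: contraNT => gH; rewrite !ffunE.
have /eqP -> : u g == 0 by apply: contraNT gH => /Hu.
have /eqP -> : v g == 0 by apply: contraNT gH => /Hv.
by rewrite scaler0 addr0.
Qed.

Lemma supportedM (H : {group gT}) u v :
  supported H u -> supported H v -> supported H (u ** v).
Proof.
move=> Hu Hv k; apply: contraNT => kH; rewrite ffunE big1// => g _.
have [gH|gH] := boolP (g \in H).
  have /eqP -> : v (g^-1 * k)%g == 0; last by rewrite mulr0.
  by apply: contraNT kH => /Hv; rewrite groupMl ?groupV.
have /eqP -> : u g == 0; last by rewrite mul0r.
by apply: contraNT gH => /Hu.
Qed.

(** For the adjoint [st], the coefficient of [st u ** u] at the identity is the sum of the squared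
    moduli of [u]. Applied to [x] and then to [st x ** x], this makes [x ** st x ** x] nonzero. *)
Lemma gmul_semiprime (H : {group gT}) x : supported H x -> x != 0 ->
  exists2 a, supported H a & x ** a ** x != 0.
Proof.
pose st (u : A) : A := [ffun g => (u (g^-1)%g)^*].
have stM u v : st (u ** v) = st v ** st u.
  apply/ffunP => k; rewrite !ffunE rmorph_sum (reindex_inj (mulgI (k^-1)%g))/=.
  apply: eq_bigr => g _; rewrite rmorphM !ffunE invMg invgK mulrC.
  by rewrite (invMg (g^-1)%g k) invgK -mulgA mulgV mulg1.
have pos u : u != 0 -> st u ** u != 0.
  apply: contra_neq => /ffunP/(_ 1%g); rewrite !ffunE => /eqP.
  rewrite psumr_eq0 => [/allP h|g _]; last first.
    by rewrite !ffunE mulg1 mulrC mul_conjC_ge0.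
  apply/ffunP => g; have := h (g^-1)%g; rewrite mem_index_enum => /(_ isT).
  by rewrite ffunE !mulg1 invgK mulrC mul_conjC_eq0 ffunE => /eqP.
have stK u : st (st u) = u by apply/ffunP => g; rewrite !ffunE invgK conjCK.
move=> Hx x0; exists (st x).
  by move=> g; rewrite ffunE conjC_eq0 => /Hx; rewrite groupV.
have := pos _ (pos _ x0); rewrite stM stK.
by apply: contra_neq => h; rewrite -mulA (mulA x) h (amulr0 gmulP).
Qed.

Definition enough_fixed_primitives (H : {group gT}) := forall x, supported H x -> x != 0 ->
  exists f, [/\ supported H f, ginv f = f, primitive_in gmul (supported H) f & x ** f != 0].

(* The centralizer of K[H] in K[L] is fixed by g |-> g^-1, and it surjects onto
   the corner e K[L] e for e primitive in K[H]. *)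
Lemma enough_fixed_primitives_step (H L : {group gT}) : H \subset L ->
  (forall l, l \in L -> exists2 h, h \in H & (l ^ h)%g = (l^-1)%g) ->
  enough_fixed_primitives H -> enough_fixed_primitives L.
Proof.
move=> HL conjV IH x Lx x0.
have suppHL u : supported H u -> supported L u by move=> Hu g /Hu; exact: (subsetP HL).
have [e [He se [e0 ee eAe] xe0]] : exists e, [/\ supported H e, ginv e = e,
    primitive_in gmul (supported H) e & x ** e != 0].
  have /existsP[l xl] : [exists l, x l != 0].
    apply: contra_neqT x0 => /existsPn h; apply/ffunP => g; rewrite ffunE.
    by apply/eqP; have := h g; rewrite negbK.
  (* The part of [x] on the coset [l H], translated into [K[H]]. Right multiplication by [e]
     respects these cosets, so [y ** e != 0] forces [x ** e != 0]. *)
  pose y : A := [ffun g => if g \in H then x (l * g)%g else 0].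
  have Hy : supported H y by move=> g; rewrite ffunE; case: ifP => //; rewrite eqxx.
  have y0 : y != 0.
    by apply: contra_neq xl => /ffunP/(_ 1%g); rewrite !ffunE group1 mulg1.
  have [e [He se pe ye]] := IH y Hy y0.
  exists e; split => //; apply: contra_neq ye => xe.
  apply/ffunP => k; have [kH|kH] := boolP (k \in H); last first.
    by rewrite [RHS]ffunE; apply/eqP; apply: contraNT kH => /(supportedM Hy He).
  move/ffunP/(_ (l * k)%g): xe; rewrite !ffunE => xe; rewrite -[RHS]xe.
  rewrite [RHS](reindex_inj (mulgI l))/=; apply: eq_bigr => g _.
  rewrite invMg -mulgA mulKg ffunE; case: ifP => // gH.
  rewrite mul0r; have /eqP -> : e (g^-1 * k)%g == 0; last by rewrite mulr0.
  by apply: contraFT gH => /He; rewrite groupMr// groupV.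
(* The scalar is found by comparing coefficients at the identity, where [e ** delta h ** e] and
   [e ** e ** delta h] agree. *)
have tauP h : h \in H -> exists l, e ** delta h ** e = l *: e /\ l * e 1%g = e (h^-1)%g.
  move=> hH; have [|l lE] := eAe (delta h).
    by move=> g; rewrite ffunE; case: (g =P h) => [->|]; rewrite ?eqxx.
  exists l; split => //.
  have -> : l * e 1%g = (l *: e) 1%g by rewrite ffunE.
  by rewrite -lE gmul_trace mulA ee gmul_deltar ffunE mul1g.
have te0 : e 1%g != 0.
  apply: contra_neq e0 => te; apply/ffunP => g; rewrite ffunE.
  have [gH|gH] := boolP (g \in H); last by apply/eqP; apply: contraNT gH => /He.
  by have [|l [_]] := tauP (g^-1)%g; rewrite ?groupV// te mulr0 invgK.
pose C c := supported L c /\ e ** c ** e = c.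
have Ce c : C c -> e ** c = c /\ c ** e = c.
  by move=> [_ <-]; rewrite !mulA ee -!mulA ee.
have Csig c : C c -> ginv c = c.
  move=> Cc; have [Lc cE] := Cc; have [ec ce] := Ce _ Cc.
  (* Summing the conjugates of [c] gives an element centralizing [K[H]]. Its coefficients are
     constant on the [H]-classes of [L], each of which is closed under inversion. *)
  pose z := \sum_(h in H) delta h ** c ** delta (h^-1)%g.
  have Lz : supported L z.
    apply: (big_ind (supported L)); first exact: supported0.
      by move=> u v Lu Lv; rewrite -[u]scale1r; exact: supported_lin.
    move=> h hH; have hL := subsetP HL _ hH.
    do 2?[apply: supportedM] => // g; rewrite ffunE.
      by case: (g =P h) => [->|]; rewrite ?eqxx.
    by case: (g =P _) => [->|]; rewrite ?eqxx// groupV.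
  have zC k : k \in H -> delta k ** z = z ** delta k.
    move=> kH; rewrite (amul_sumr gmulP) (amul_suml gmulP).
    rewrite [RHS](reindex_inj (mulgI k))/=.
    apply: eq_big => [h|h hH]; first by rewrite groupMl.
    by rewrite -!mulA gmul_delta !mulA gmul_delta invMg -mulgA mulVg mulg1.
  have sz : ginv z = z.
    apply/ffunP => l; rewrite ffunE.
    have [lL|lL] := boolP (l \in L); last first.
      have /eqP -> : z l == 0 by apply: contraNT lL => /Lz.
      by apply/eqP; apply: contraNT lL => /Lz; rewrite groupV.
    have [h hH <-] := conjV l lL.
    have /ffunP/(_ (l * h)%g) := zC h hH.
    by rewrite gmul_deltal gmul_deltar !ffunE mulgK.
  have eE : e = \sum_(h in H) e h *: delta h.
    rewrite {1}(basis_fun_sum e) [RHS]big_mkcond/=; apply: eq_bigr => h _.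
    case: ifP => // hH; have /eqP -> : e h == 0 by apply: contraFT hH => /He.
    by rewrite scale0r.
  have ezC : e ** z = z ** e.
    rewrite eE (amul_suml gmulP) (amul_sumr gmulP); apply: eq_bigr => h hH.
    by rewrite (amulZl gmulP) (amulZr gmulP) zC.
  (* By [tauP] each conjugate of [c], compressed by [e], is a multiple of [c], with scalar
     [e h * e h^-1 / (e 1)^2]. As [e ** e = e], these sum to [1 / e 1]; so [c] is recovered from
     [z]. *)
  have [k k0 zeE] : exists2 k, k != 0 & z ** e = k *: c.
    exists (e 1%g)^-1; first by rewrite invr_eq0.
    rewrite -{1}ee mulA -ezC (amul_sumr gmulP) (amul_suml gmulP).
    have term h : h \in H -> e ** (delta h ** c ** delta (h^-1)%g) ** e =
        (e (h^-1)%g * e h / (e 1%g * e 1%g)) *: c.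
      move=> hH; have [l [lE le]] := tauP h hH.
      have [|m [mE me]] := tauP (h^-1)%g; first by rewrite groupV.
      rewrite -{1}ec -{1}ce -!mulA (mulA e (delta _) e) mE.
      rewrite !(amulZr gmulP) !mulA lE !(amulZl gmulP) -!mulA ce ec scalerA.
      rewrite invgK in me; congr (_ *: _); rewrite -le -me.
      by rewrite mulrACA mulfK ?mulf_neq0// mulrC.
    rewrite (eq_bigr _ term) -scaler_suml; congr (_ *: _).
    rewrite -mulr_suml; apply: (canLR (mulfK (mulf_neq0 te0 te0))).
    rewrite mulKf//.
    have -> : e 1%g = (e ** e) 1%g by rewrite ee.
    rewrite ffunE (reindex_inj invg_inj)/= [LHS]big_mkcond/=; apply: eq_bigr => h _.
    rewrite mulg1 invgK; case: ifP => // hH.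
    have /eqP -> : e h == 0 by apply: contraFT hH; rewrite groupV; exact: He.
    by rewrite mul0r.
  have cE' : c = k^-1 *: (z ** e) by rewrite zeE scalerA mulVf// scale1r.
  have glin : linear ginv by move=> a u v; apply/ffunP => g; rewrite !ffunE.
  by rewrite cE' (linZ glin) ginvM se sz ezC.
have Lxe : supported L (x ** e) by apply: supportedM => //; exact: suppHL.
have [a La xaxe] := gmul_semiprime Lxe xe0.
have w0 : e ** (a ** x) ** e != 0.
  by apply: contra_neq xaxe => w0; rewrite -!mulA (mulA a) (mulA e) w0 (amulr0 gmulP).
have Cof u : supported L u -> C (e ** u ** e).
  move=> Lu; split; last by rewrite -!mulA ee !mulA ee.
  by do 2?[apply: supportedM] => //; exact: suppHL.
have Cw : C (e ** (a ** x) ** e) by apply: Cof; exact: supportedM.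
(* Every element of the corner [C] is fixed, so any primitive idempotent of [C] is; choosing it in
   the left ideal of [e ** (a ** x) ** e] keeps [x ** f] nonzero. *)
have [||||f [Cf [f0 ff fCf] [c Cc fE]]] :=
    @primitive_in_left_ideal K _ gmul gmulP C _ _ _ _ _ Cw w0.
- by split; [exact: supported0|rewrite (amulr0 gmulP) (amul0r gmulP)].
- move=> k u v [Lu uE] [Lv vE]; split; first exact: supported_lin.
  by rewrite (amulDr gmulP) (amulDl gmulP) (amulZr gmulP) (amulZl gmulP) uE vE.
- move=> u v Cu Cv; have [Lu _] := Cu; have [Lv _] := Cv; split; first exact: supportedM.
  by have [eu _] := Ce _ Cu; have [_ ve] := Ce _ Cv; rewrite mulA eu -mulA ve.
- move=> u Cu u0; have [Lu _] := Cu; have [b Lb ubu] := gmul_semiprime Lu u0.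
  exists (e ** b ** e); first exact: Cof.
  by have [eu ue] := Ce _ Cu; rewrite !mulA ue -mulA eu.
have [ef fe] := Ce _ Cf.
exists f; split.
- by case: Cf.
- exact: Csig.
- split => // u Lu; have [l lE] := fCf _ (Cof u Lu); exists l.
  by rewrite -lE !mulA fe -[RHS]mulA ef.
- apply: contra_neq f0 => xf0.
  by rewrite -ff {1}fE -!mulA ef xf0 !(amulr0 gmulP).
Qed.

Lemma enough_fixed_primitives1 : enough_fixed_primitives 1%G.
Proof.
move=> x _ x0; exists gone; split.
- by move=> g; rewrite ffunE; case: (g =P _) => [->|]; rewrite ?eqxx// group1.
- by apply/ffunP => g; rewrite !ffunE -{1}invg1 (inj_eq invg_inj).
- split; [|by rewrite gmul1|].
    by apply/eqP => /ffunP/(_ 1%g)/eqP; rewrite !ffunE eqxx oner_eq0.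
  move=> a Ha; exists (a 1%g); rewrite gmul1 gmulr1; apply/ffunP => g; rewrite !ffunE.
  have [->|g1] := eqVneq g 1%g; first by rewrite [RHS]mulr1.
  by rewrite scaler0; apply/eqP; apply: contraNT g1 => /Ha /set1gP ->; rewrite eqxx.
- by rewrite gmulr1.
Qed.

End GroupAlgebra.

(** The induction climbs the chain of symmetric groups on the first [k] points, all realized inside
    one group. *)
Lemma enough_fixed_primitives_Sym (K : numClosedFieldType) (n : nat) :
  enough_fixed_primitives K [set: {perm 'I_n}]%G.
Proof.
pose S k := [set i : 'I_n | (i < k)%N].
have SymT : Sym_group (S n) = [set: {perm 'I_n}]%G.
  apply: val_inj; apply/setP => s; rewrite /= !inE; apply/subsetP => i _.
  by rewrite inE.
suff H k : enough_fixed_primitives K (Sym_group (S k)) by rewrite -SymT.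
elim: k => [|k IH].
  have -> : Sym_group (S 0) = 1%G :> {group {perm 'I_n}}.
    apply: val_inj; apply/setP => s; rewrite /= !inE; apply/idP/eqP => [/subsetP h|->].
      apply/permP => i; rewrite perm1; apply/eqP; apply: contraT => si.
      by have := h i; rewrite !inE => /(_ si).
    by apply/subsetP => i; rewrite !inE perm1 eqxx.
  exact: enough_fixed_primitives1.
have [kn|kn] := ltnP k n; last first.
  have -> : S k.+1 = S k; last by [].
  apply/setP => i; rewrite !inE; have := ltn_ord i; lia.
apply: enough_fixed_primitives_step IH.
  apply/subsetP => s; rewrite !inE => /subsetP h; apply/subsetP => i /h.
  by rewrite !inE => /leqW.
move=> l; rewrite inE => /subsetP lS.
(* With the new point [k] as base point, [h] fixes [k] and all fixed points of [l], hence lies in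
   the previous subgroup. *)
have [h [lh ha hfix]] := perm_conj_inv_fix l (Ordinal kn).
exists h => //; rewrite inE; apply/subsetP => i; rewrite !inE => hi.
have : i \in S k.+1 by apply: lS; rewrite inE; apply: contra hi => /eqP/hfix ->.
rewrite inE ltnS leq_eqVlt => /orP[/eqP ik|//].
by case/eqP: hi; rewrite (_ : i = Ordinal kn)//; exact: val_inj.
Qed.

(** * Composition of Brauer diagrams *)

Lemma partitionI (T : finType) (P : {set {set T}}) (Y : {set T}) :
  (forall x, x \in Y -> exists2 B, B \in P & x \in B) ->
  (forall B x, B \in P -> x \in B -> x \in Y) ->
  (forall B B' x, B \in P -> B' \in P -> x \in B -> x \in B' -> B = B') ->
  (forall B, B \in P -> exists x, x \in B) -> partition P Y.
Proof.
move=> cov sub tri ne; apply/and3P; split.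
- apply/eqP/setP => x; apply/bigcupP/idP => [[B BP xB]|/cov[B BP xB]].
    exact: sub xB.
  by exists B.
- apply/trivIsetP => B B' BP B'P; apply: contraNT => /pred0Pn[x /andP[xB xB']].
  by apply/eqP; exact: tri xB xB'.
- by apply/negP => /ne[x]; rewrite inE.
Qed.

Lemma partition_block (T : finType) (P : {set {set T}}) (Y B B' : {set T}) x :
  partition P Y -> B \in P -> B' \in P -> x \in B -> x \in B' -> B = B'.
Proof.
move=> /partition_trivIset tP BP B'P xB xB'.
by rewrite -(def_pblock tP BP xB) -(def_pblock tP B'P xB').
Qed.

Lemma partition_sub (T : finType) (P : {set {set T}}) (Y Z : {set T}) :
  partition P Y -> Z \subset Y ->
  (forall B x y, B \in P -> x \in B -> y \in B -> x \in Z -> y \in Z) ->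
  partition [set B in P | B \subset Z] Z.
Proof.
move=> pP ZY Zcl; apply: partitionI.
- move=> x xZ; have : x \in cover P by rewrite (cover_partition pP) (subsetP ZY).
  move=> /bigcupP[B BP xB]; exists B => //; rewrite inE BP.
  by apply/subsetP => y yB; exact: Zcl xB yB xZ.
- by move=> B x; rewrite inE => /andP[_ /subsetP]; exact.
- move=> B B' x; rewrite !inE => /andP[BP _] /andP[B'P _].
  exact: partition_block pP BP B'P.
- by move=> B; rewrite inE => /andP[/(partition_neq0 pP)/set0Pn].
Qed.

Section Matchings.
Variable T : finType.
Implicit Types (P Q : {set {set T}}) (c : T -> bool).

Lemma perfect_matching_partition P : perfect_matching P -> partition P [set: T].
Proof. by case/andP. Qed.

Lemma perfect_matching_card P B : perfect_matching P -> B \in P -> #|B| = 2%N.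
Proof. by case/andP => _ /forall_inP h /h/eqP. Qed.

Lemma perfect_matching_block P x : perfect_matching P -> exists2 B, B \in P & x \in B.
Proof.
move=> /perfect_matching_partition/cover_partition/setP/(_ x).
by rewrite inE => /bigcupP[B]; exists B.
Qed.

Lemma pair_block (B : {set T}) x y : #|B| = 2%N -> x \in B -> y \in B -> x != y ->
  B = [set x; y].
Proof.
move=> cB xB yB xy; apply/eqP; rewrite eq_sym eqEcard cards2 xy cB leqnn andbT.
by apply/subsetP => z /set2P[]->.
Qed.

Lemma pair_other (B : {set T}) x : #|B| = 2%N -> x \in B -> exists2 y, y \in B & y != x.
Proof.
move=> cB xB; have : (0 < #|B :\ x|)%N by move: cB; rewrite (cardsD1 x) xB => -[]; rewrite add0n => ->.
by case/card_gt0P => y; rewrite !inE => /andP[yx yB]; exists y.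
Qed.

Definition respects P c := [forall B in P, [forall x in B, [forall y in B, c x == c y]]].

Lemma respectsP P c :
  reflect (forall B x y, B \in P -> x \in B -> y \in B -> c x = c y) (respects P c).
Proof.
apply: (iffP forall_inP) => [h B x y BP xB yB|h B BP].
  by move/forall_inP: (h B BP) => /(_ x xB)/forall_inP/(_ y yB)/eqP.
by apply/forall_inP => x xB; apply/forall_inP => y yB; apply/eqP; exact: h BP xB yB.
Qed.

Lemma eq_respects P c c' : c =1 c' -> respects P c = respects P c'.
Proof. by move=> cc; apply/respectsP/respectsP => h B x y; [rewrite -!cc|rewrite !cc]; exact: h. Qed.

(** Two points are in the same block exactly when no colouring constant on blocks separates them;
    the indicator of a block is the test colouring. *)
Lemma respects_inj P Q : partition P [set: T] -> partition Q [set: T] ->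
  (forall c, respects P c = respects Q c) -> P = Q.
Proof.
have E P' : partition P' [set: T] -> P' = [set pblock P' x | x in [set: T]].
  move=> pP; have tP := partition_trivIset pP.
  apply/setP => B; apply/idP/imsetP => [BP|[x _ ->]].
    have /set0Pn[x xB] := partition_neq0 pP BP.
    by exists x; rewrite ?inE// (def_pblock tP BP xB).
  by apply: pblock_mem; rewrite (cover_partition pP) inE.
have pbP P' x y : partition P' [set: T] ->
    reflect (forall c, respects P' c -> c x = c y) (y \in pblock P' x).
  move=> pP; have tP := partition_trivIset pP.
  have inb z : z \in pblock P' z by rewrite mem_pblock (cover_partition pP) inE.
  have pbm z : pblock P' z \in P' by apply: pblock_mem; rewrite (cover_partition pP) inE.
  apply: (iffP idP) => [xy c /respectsP h|h]; first exact: (h _ _ _ (pbm x)).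
  rewrite -(h (fun z => z \in pblock P' x)) ?inb//.
  apply/respectsP => B u v BP uB vB.
  rewrite -(def_pblock tP BP uB) in vB.
  by rewrite -!eq_pblock ?(cover_partition pP) ?inE// (same_pblock tP vB).
move=> pP pQ PQ; rewrite (E _ pP) (E _ pQ); apply: eq_imset => x.
by apply/setP => y; apply/pbP/pbP => // h c; [rewrite -PQ|rewrite PQ]; exact: h.
Qed.

Lemma involution_matching (f : T -> T) : involutive f -> (forall x, f x != x) ->
  perfect_matching [set [set x; f x] | x : T].
Proof.
move=> fK f1; apply/andP; split; last first.
  by apply/forall_inP => _ /imsetP[x _ ->]; rewrite cards2 (eq_sym x) f1.
apply: partitionI => [x _|//|B B' x /imsetP[y _ ->] /imsetP[z _ ->]|B /imsetP[x _ ->]].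
- by exists [set x; f x]; rewrite ?set21//; exact: imset_f.
- by move=> /set2P[]->/set2P[] E; [rewrite E|rewrite E fK setUC|rewrite -E fK setUC|
    rewrite (can_inj fK E)].
- by exists x; rewrite set21.
Qed.

Lemma involution_respects (f : T -> T) c :
  respects [set [set x; f x] | x : T] c = [forall x, c x == c (f x)].
Proof.
apply/respectsP/forallP => [h x|h B x y /imsetP[z _ ->]].
  by apply/eqP/(h [set x; f x]); rewrite ?set21 ?set22//; exact: imset_f.
by move=> /set2P[]->/set2P[]->//; [exact/eqP|exact/esym/eqP].
Qed.

End Matchings.

Lemma imset_matching (T U : finType) (f : T -> U) (g : U -> T) (P : {set {set T}}) :
  cancel f g -> cancel g f -> perfect_matching P ->
  perfect_matching [set f @: (B : {set T}) | B in P].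
Proof.
move=> fK gK mP; have pP := perfect_matching_partition mP.
apply/andP; split; last first.
  apply/forall_inP => _ /imsetP[B BP ->].
  by rewrite card_imset ?(perfect_matching_card mP BP)//; exact: can_inj fK.
apply: partitionI => //.
- move=> x _; have [B BP xB] := perfect_matching_block (g x) mP.
  by exists (f @: B); [exact: imset_f|rewrite -[x]gK imset_f].
- move=> _ _ x /imsetP[B BP ->] /imsetP[B' B'P ->] /imsetP[y yB ->] /imsetP[z zB].
  move=> /(can_inj fK) yz; rewrite -yz in zB.
  by rewrite (partition_block pP BP B'P yB zB).
- move=> _ /imsetP[B BP ->].
  have /set0Pn[x xB] := partition_neq0 pP BP.
  by exists (f x); exact: imset_f.
Qed.

Lemma imset_respects (T U : finType) (f : T -> U) (P : {set {set T}}) (c : U -> bool) :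
  respects [set f @: (B : {set T}) | B in P] c = respects P (c \o f).
Proof.
apply/respectsP/respectsP => h B x y.
  by move=> BP xB yB /=; apply: (h (f @: B)); rewrite ?imset_f.
by move=> /imsetP[B' B'P ->] /imsetP[u uB ->] /imsetP[v vB ->]; exact: (h B').
Qed.

(* Colouring by bool turns a diagram into a 0/1 matrix, as in the representation
   on tensor powers of a 2-dimensional space, where t is specialized to 2. *)
Definition join (m n : nat) (a : {ffun 'I_m -> bool}) (b : {ffun 'I_n -> bool})
    (z : 'I_m + 'I_n) : bool :=
  match z with inl i => a i | inr j => b j end.

Definition diagram_mx (m n : nat) (D : diagram m n) a b : bool :=
  respects (val D) (join a b).

Lemma diagram_mx_inj (m n : nat) (D E : diagram m n) :
  (forall a b, diagram_mx D a b = diagram_mx E a b) -> D = E.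
Proof.
move=> DE; apply: val_inj; apply: respects_inj.
- exact: perfect_matching_partition (valP D).
- exact: perfect_matching_partition (valP E).
move=> c; have cE : c =1 join [ffun i => c (inl i)] [ffun j => c (inr j)].
  by case=> i /=; rewrite ffunE.
by rewrite !(eq_respects _ cE); exact: DE.
Qed.

(** The all-[false] colouring respects every matching, so its entry isolates the power of two; what
    remains determines the diagram. *)
Lemma diagram_mx_scale_inj (m n k k' : nat) (D E : diagram m n) :
  (forall a b, 2 ^ k * diagram_mx D a b = 2 ^ k' * diagram_mx E a b)%N ->
  k = k' /\ D = E.
Proof.
move=> DE; have tt F : @diagram_mx m n F [ffun=> false] [ffun=> false] = true.
  apply/respectsP => B x y _ _ _.
  by case: x => i; case: y => j /=; rewrite !ffunE.
have kk : k = k'.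
  have := DE [ffun=> false] [ffun=> false]; rewrite !tt !muln1.
  exact: expnI.
split => //; apply: diagram_mx_inj => a b; have := DE a b; rewrite kk => /eqP.
by rewrite eqn_pmul2l ?expn_gt0//; do 2 case: diagram_mx.
Qed.

Lemma card_set_sum (S T : finType) (Y : {set S + T}) :
  #|Y| = (#|[set i | inl i \in Y]| + #|[set j | inr j \in Y]|)%N.
Proof.
rewrite -(card_imset (mem [set i | inl i \in Y]) (@inl_inj S T)).
rewrite -(card_imset (mem [set j | inr j \in Y]) (@inr_inj S T)).
set A := imset _ _; set B := imset _ _.
have AB : A :&: B = set0.
  apply/setP => z; rewrite !inE; apply/negbTE/negP => /andP[/imsetP[i _ ->]].
  by case/imsetP.
rewrite -cardsUI AB cards0 addn0.
apply: eq_card => z; rewrite in_setU; apply/idP/orP => [zY|].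
  by case: z zY => i zY; [left|right]; apply: imset_f; rewrite inE.
by move=> [] /imsetP [i iY ->]; move: iY; rewrite inE.
Qed.

(** * Stacking two diagrams *)

Section Stack.
Variables (m n p : nat) (D : diagram m n) (E : diagram n p).
Local Notation V := (stack_vertex m n p).
Local Notation adj := (stack_adj E D).
Local Notation low := (@lower m n p).
Local Notation upp := (@upper m n p).
Local Notation out := (@outer m n p).
Implicit Types (u v w : V) (X : {set V}).

Lemma stack_adj_sym : symmetric adj.
Proof.
by move=> u v; congr (_ || _); apply/exists_inP/exists_inP => -[B BD];
  rewrite andbC; exists B.
Qed.

Let connC := sym_connect_sym stack_adj_sym.

Definition component u : {set V} := [set v in [set: V] | connect adj u v].

Lemma in_component u v : (v \in component u) = connect adj u v.
Proof. by rewrite !inE. Qed.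

Lemma component_eq u v : connect adj u v -> component u = component v.
Proof.
by move=> uv; apply/setP => w; rewrite !in_component (same_connect connC uv).
Qed.

Lemma componentsP X : reflect (exists u, X = component u) (X \in stack_components E D).
Proof. by apply: (iffP imsetP) => [[u _ ->]|[u ->]]; exists u. Qed.

Lemma component_id u : u \in component u.
Proof. by rewrite in_component connect0. Qed.

Lemma lower_adj B x y : B \in val D -> x \in B -> y \in B -> adj (low x) (low y).
Proof.
by move=> BD xB yB; apply/orP; left; apply/exists_inP; exists B; rewrite ?imset_f.
Qed.

Lemma upper_adj B x y : B \in val E -> x \in B -> y \in B -> adj (upp x) (upp y).
Proof.
by move=> BE xB yB; apply/orP; right; apply/exists_inP; exists B; rewrite ?imset_f.
Qed.

Lemma adj_invariant (T : Type) (f : V -> T) :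
  (forall B x y, B \in val D -> x \in B -> y \in B -> f (low x) = f (low y)) ->
  (forall B x y, B \in val E -> x \in B -> y \in B -> f (upp x) = f (upp y)) ->
  forall u v, connect adj u v -> f u = f v.
Proof.
move=> fD fE u v /connectP[s]; elim: s u => [|w s IH] u /= => [_ -> //|].
move=> /andP[uw ws vE]; rewrite -(IH w ws vE).
case/orP: uw => /exists_inP[B BD /andP[/imsetP[x xB ->] /imsetP[y yB ->]]].
  exact: fD BD xB yB.
exact: fE BD xB yB.
Qed.

Definition join3 (a : {ffun 'I_m -> bool}) (b : {ffun 'I_n -> bool})
    (c : {ffun 'I_p -> bool}) (u : V) : bool :=
  match u with inl (inl i) => a i | inl (inr j) => b j | inr k => c k end.

Lemma join3P a b c :
  reflect (forall u v, connect adj u v -> join3 a b c u = join3 a b c v)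
          (diagram_mx D a b && diagram_mx E b c).
Proof.
have lowE x : join3 a b c (low x) = join a b x by case: x.
have uppE x : join3 a b c (upp x) = join b c x by case: x.
apply: (iffP andP) => [[/respectsP hD /respectsP hE]|h].
  apply: adj_invariant => B x y BP xB yB.
    by rewrite !lowE; exact: hD BP xB yB.
  by rewrite !uppE; exact: hE BP xB yB.
split; apply/respectsP => B x y BP xB yB.
  by rewrite -!lowE; apply/h/connect1; exact: lower_adj BP xB yB.
by rewrite -!uppE; apply/h/connect1; exact: upper_adj BP xB yB.
Qed.

(** An edge count replaces following a strand. If a component [X] contains [d] pairs of [D] and [e]
    pairs of [E], then [nb + nm = 2 d] and [nm + nt = 2 e], so [nb + nt] is even. Connectedness
    gives [nb + nm + nt <= d + e + 1], hence [nb + nt <= 2]. *)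
Lemma card_component_outer u : (#|out @^-1: component u| == 0%N) || (#|out @^-1: component u| == 2%N).
Proof.
have := component_id u; have := in_component u; move: (component u) => X XE uX.
have closed v w : connect adj v w -> v \in X -> w \in X.
  by rewrite !XE => vw uv; exact: connect_trans vw.
pose nb := #|[set i : 'I_m | inl (inl i) \in X]|.
pose nm := #|[set j : 'I_n | inl (inr j) \in X]|.
pose nt := #|[set k : 'I_p | inr k \in X]|.
have cX : #|X| = (nb + nm + nt)%N.
  by rewrite card_set_sum card_set_sum; congr (_ + _ + _)%N; apply: eq_card => i; rewrite !inE.
have cL : #|low @^-1: X| = (nb + nm)%N.
  by rewrite card_set_sum; congr (_ + _)%N; apply: eq_card => i; rewrite !inE.
have cU : #|upp @^-1: X| = (nm + nt)%N.
  by rewrite card_set_sum; congr (_ + _)%N; apply: eq_card => i; rewrite !inE.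
have cO : #|out @^-1: X| = (nb + nt)%N.
  by rewrite card_set_sum; congr (_ + _)%N; apply: eq_card => i; rewrite !inE.
pose DX := [set B in val D | B \subset low @^-1: X].
pose EX := [set B in val E | B \subset upp @^-1: X].
have cD : #|low @^-1: X| = (#|DX| * 2)%N.
  apply: card_uniform_partition => [B|].
    by rewrite inE => /andP[/(perfect_matching_card (valP D))].
  apply: partition_sub (perfect_matching_partition (valP D)) (subsetT _) _.
  by move=> B x y BD xB yB; rewrite !inE; apply: closed; apply: connect1; exact: lower_adj BD xB yB.
have cE : #|upp @^-1: X| = (#|EX| * 2)%N.
  apply: card_uniform_partition => [B|].
    by rewrite inE => /andP[/(perfect_matching_card (valP E))].
  apply: partition_sub (perfect_matching_partition (valP E)) (subsetT _) _.
  by move=> B x y BD xB yB; rewrite !inE; apply: closed; apply: connect1; exact: upper_adj BD xB yB.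
(* A subset of the connected graph X that misses u is determined by the set of
   edges it cuts, so X has at least #|X| - 1 edges. *)
have edges : (#|X| <= #|DX| + #|EX| + 1)%N.
  pose cut (T : finType) (f : T -> V) (Q : {set {set T}}) (S : {set V}) :=
    [set B in Q | [exists x in B, [exists y in B, (f x \in S) != (f y \in S)]]].
  have cutP (T : finType) (f : T -> V) (Q : {set {set T}}) S S' B x y :
      cut T f Q S = cut T f Q S' -> B \in Q -> #|B| = 2%N -> x \in B -> y \in B ->
      (f x \in S) (+) (f x \in S') = (f y \in S) (+) (f y \in S').
    move=> /setP/(_ B) cSS BQ cB xB yB; have [->//|xy] := eqVneq x y.
    have BE := pair_block cB xB yB xy.
    have H Z : (B \in cut T f Q Z) = ((f x \in Z) != (f y \in Z)).
      rewrite inE BQ /= BE; apply/exists_inP/idP => [[v vB /exists_inP[w wB]]|h].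
        by case/set2P: vB => ->; case/set2P: wB => ->; rewrite ?eqxx// eq_sym.
      by exists x; rewrite ?set21//; apply/exists_inP; exists y; rewrite ?set22.
    move: cSS; rewrite !H.
    by case: (f x \in S); case: (f y \in S); case: (f x \in S'); case: (f y \in S').
  pose F S := (cut _ low DX S, cut _ upp EX S).
  have Finj : {in powerset (X :\ u) &, injective F}.
    move=> S S'; rewrite !powersetE => /subsetP SX /subsetP S'X [FD FE].
    pose h w := (w \in S) (+) (w \in S').
    have hc w : connect adj u w -> h u = h w.
      (* Restricting the indicator of the symmetric difference to [X] makes it a function on all
         vertices that no edge cuts, as [adj_invariant] demands. *)
      pose h' w := (w \in X) && h w.
      have H : forall v w, connect adj v w -> h' v = h' w.
        apply: adj_invariant => B x y BD xB yB; rewrite /h'.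
          have xyX : (low x \in X) = (low y \in X).
            by apply/idP/idP; apply: closed; apply: connect1; apply: lower_adj BD _ _.
          rewrite -xyX; have [xX|//] := boolP (low x \in X).
          apply: (cutP _ _ _ _ _ B _ _ FD) => //; last exact: perfect_matching_card (valP D) BD.
          rewrite inE BD; apply/subsetP => z zB; rewrite inE.
          by apply: closed xX; apply: connect1; exact: lower_adj BD xB zB.
        have xyX : (upp x \in X) = (upp y \in X).
          by apply/idP/idP; apply: closed; apply: connect1; apply: upper_adj BD _ _.
        rewrite -xyX; have [xX|//] := boolP (upp x \in X).
        apply: (cutP _ _ _ _ _ B _ _ FE) => //; last exact: perfect_matching_card (valP E) BD.
        rewrite inE BD; apply/subsetP => z zB; rewrite inE.
        by apply: closed xX; apply: connect1; exact: upper_adj BD xB zB.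
      move=> uw; have := H u w uw; rewrite /h' uX /= => ->.
      by rewrite XE uw.
    have hu : h u = false.
      have nS (Z : {set V}) : (forall w, w \in Z -> w \in X :\ u) -> u \in Z = false.
        by move=> ZX; apply/negP => /ZX; rewrite !inE eqxx.
      by rewrite /h !nS.
    apply/setP => w; have [wX|wX] := boolP (w \in X).
      move: wX; rewrite XE => /hc; rewrite hu /h.
      by case: (w \in S); case: (w \in S').
    have nS (Z : {set V}) : (forall w, w \in Z -> w \in X :\ u) -> w \in Z = false.
      by move=> ZX; apply/negP => /ZX; rewrite inE (negPf wX) andbF.
    by rewrite !nS.
  (* The [2 ^ (#|X| - 1)] subsets missing [u] are counted against the possible cut sets. *)
  have : (#|powerset (X :\ u)| <= #|setX (powerset DX) (powerset EX)|)%N.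
    rewrite -(card_in_imset Finj); apply: subset_leq_card.
    apply/subsetP => _ /imsetP[S _ ->]; rewrite in_setX !powersetE.
    by apply/andP; split; apply/subsetP => B; rewrite inE => /andP[].
  rewrite cardsX !card_powerset -expnD leq_exp2l// => h.
  by rewrite (cardsD1 u) uX addnC leq_add2r.
rewrite cO; lia.
Qed.

Lemma stack_pairsP P :
  reflect (P != set0 /\ exists u, P = out @^-1: component u) (P \in stack_pairs E D).
Proof.
rewrite in_setD1; apply: (iffP andP) => -[P0 PX]; split=> //.
  by case/imsetP: PX => _ /componentsP[u ->] ->; exists u.
by case: PX => u ->; apply/imsetP; exists (component u) => //; apply/componentsP; exists u.
Qed.

Lemma outer_component_pair z : out @^-1: component (out z) \in stack_pairs E D.
Proof.
apply/stack_pairsP; split; last by exists (out z).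
by apply/set0Pn; exists z; rewrite inE component_id.
Qed.

Lemma stack_pairs_matching : perfect_matching (stack_pairs E D).
Proof.
apply/andP; split; last first.
  apply/forall_inP => P /stack_pairsP[ne [u PE]]; rewrite PE in ne *.
  by have := card_component_outer u; rewrite cards_eq0 (negPf ne).
apply: partitionI => //.
- move=> z _; exists (out @^-1: component (out z)); last by rewrite inE component_id.
  exact: outer_component_pair.
- move=> P P' z /stack_pairsP[_ [u ->]] /stack_pairsP[_ [v ->]]; rewrite !inE => uz vz.
  by rewrite (component_eq uz) (component_eq vz).
- by move=> P /stack_pairsP[/set0Pn].
Qed.

Definition compose : diagram m p := Sub (stack_pairs E D) stack_pairs_matching.

(** A compatible colouring is constant on components: strands are dictated by [a] and [c], while
    each closed loop has two free colours. A set of loops corresponds to the colouring that is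
    [true] on these loops and [false] on the other loops. *)
Lemma card_middle_colourings a c :
  #|[set b | diagram_mx D a b && diagram_mx E b c]| =
  (2 ^ stack_loops E D * diagram_mx compose a c)%N.
Proof.
have outE b z : join3 a b c (out z) = join a c z by case: z.
have [/respectsP h|h] := boolP (diagram_mx compose a c); last first.
  rewrite muln0; apply/eqP; rewrite cards_eq0; apply/eqP/setP => b.
  rewrite [in RHS]inE inE; apply/negbTE; apply: contra h => /join3P hb.
  apply/respectsP => P x y /stack_pairsP[_ [u ->]].
  by rewrite !inE => ux uy; rewrite -!(outE b) -(hb _ _ ux) -(hb _ _ uy).
rewrite muln1 -card_powerset.
set L := [set X in stack_components E D | _].
pose mid (j : 'I_n) : V := inl (inr j).
(* The default [false] concerns only components without outer points; these are loops, on which [g]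
   does not consult [oc]. *)
pose oc X := if [pick z | out z \in X] is Some z then join a c z else false.
pose g (S : {set {set V}}) X := if X \in L then X \in S else oc X.
pose f (S : {set {set V}}) : {ffun 'I_n -> bool} := [ffun j => g S (component (mid j))].
have outL z : component (out z) \in L = false.
  apply/negP; rewrite inE => /andP[_ /eqP/setP/(_ z)].
  by rewrite in_set0 inE component_id.
have ocE z : oc (component (out z)) = join a c z.
  rewrite /oc; case: pickP => [y yz|/(_ z)]; last by rewrite component_id.
  by apply: (h _ _ _ (outer_component_pair z)); rewrite inE; [exact: yz|exact: component_id].
have fE S w : join3 a (f S) c w = g S (component w).
  case: w => [[i|j]|k].
  - by rewrite -[inl (inl i)]/(out (inl i)) outE /g outL ocE.
  - by rewrite /= ffunE.
  - by rewrite -[inr k]/(out (inr k)) outE /g outL ocE.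
have Lmid X : X \in L -> exists j, X = component (mid j).
  rewrite inE => /andP[/componentsP[u ->] /eqP X0].
  have no z : out z \in component u = false.
    by move/setP/(_ z): X0; rewrite in_set0 inE.
  case: u X0 no => [[i|j]|k] _ no.
  - by have := no (inl i); rewrite component_id.
  - by exists j.
  - by have := no (inr k); rewrite component_id.
rewrite -(@card_in_imset _ _ f); last first.
  move=> S S'; rewrite !powersetE => /subsetP SL /subsetP SL' /ffunP ff.
  apply/setP => X; have [XL|XL] := boolP (X \in L); last first.
    have nS (Z : {set {set V}}) : (forall Y, Y \in Z -> Y \in L) -> X \in Z = false.
      by move=> ZL; apply/negP => /ZL; rewrite (negPf XL).
    by rewrite !nS.
  have [j Xj] := Lmid X XL; have := ff j; rewrite !ffunE /g -Xj XL.
  by [].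
apply: eq_card => b; rewrite inE; apply/join3P/imsetP => [hb|[S _ ->] u v uv].
  exists [set X in L | [exists j, (mid j \in X) && b j]].
    by rewrite powersetE; apply/subsetP => X; rewrite inE => /andP[].
  apply/ffunP => j; rewrite ffunE /g; case: ifPn => XL.
    rewrite inE XL /=; apply/idP/existsP => [bj|[i /andP[]]].
      by exists j; rewrite component_id.
    by rewrite in_component => /hb /= ->.
  rewrite /oc; case: pickP => [z|no].
    by rewrite in_component => /hb /=; rewrite outE.
  case/negP: XL; rewrite inE; apply/andP; split.
    by apply/componentsP; exists (mid j).
  by apply/eqP/setP => z; rewrite in_set0 inE; exact: no.
by rewrite !fE (component_eq uv).
Qed.

Lemma diagram_mx_compose a c :
  (\sum_b diagram_mx D a b * diagram_mx E b c =
   2 ^ stack_loops E D * diagram_mx compose a c)%N.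
Proof.
rewrite -card_middle_colourings -sum1_card [RHS]big_mkcond/=.
by apply: eq_bigr => b _; rewrite inE; do 2 case: diagram_mx.
Qed.

(** The working tool below: a composite and its loop count are identified together from one product
    of 0/1 matrices. *)
Lemma compose_eq (k : nat) (F : diagram m p) :
  (forall a c, \sum_b diagram_mx D a b * diagram_mx E b c =
               2 ^ k * diagram_mx F a c)%N ->
  compose = F /\ stack_loops E D = k.
Proof.
move=> h; have [|-> ->//] := @diagram_mx_scale_inj m p (stack_loops E D) k compose F.
by move=> a c; rewrite -h diagram_mx_compose.
Qed.

End Stack.

Lemma ffun_forall_eq (I : finType) (c c' : {ffun I -> bool}) :
  [forall i, c i == c' i] = (c == c').
Proof.
apply/forallP/eqP => [h|-> i//]; apply/ffunP => i; exact/eqP.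
Qed.

Lemma sum_mul_pred1 (I : finType) (F : I -> nat) x : (\sum_y F y * (y == x) = F x)%N.
Proof.
rewrite (bigD1 x)//= eqxx muln1 big1 ?addn0// => y /negPf->.
by rewrite muln0.
Qed.

Lemma diagram_mx_id n a b : diagram_mx (id_diagram n) a b = (a == b).
Proof.
rewrite -ffun_forall_eq; apply/respectsP/forallP => [h i|h B x y /imsetP[i _ ->]].
  by apply/eqP/(h [set inl i; inr i] (inl i) (inr i)); rewrite ?set21 ?set22//; exact: imset_f.
by move=> /set2P[]->/set2P[]->//=; rewrite (eqP (h i)).
Qed.

Lemma compose_id_l m n (D : diagram m n) :
  compose (id_diagram m) D = D /\ stack_loops D (id_diagram m) = 0%N.
Proof.
apply: compose_eq => a c; rewrite mul1n.
under eq_bigr do rewrite diagram_mx_id mulnC eq_sym.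
exact: (sum_mul_pred1 (fun b => diagram_mx D b c : nat)).
Qed.

Lemma compose_id_r m n (D : diagram m n) :
  compose D (id_diagram n) = D /\ stack_loops (id_diagram n) D = 0%N.
Proof.
apply: compose_eq => a c; rewrite mul1n.
under eq_bigr do rewrite diagram_mx_id.
exact: (sum_mul_pred1 (fun b => diagram_mx D a b : nat)).
Qed.

(** Both sides come from the same triple product of 0/1 matrices, so the diagrams and the total loop
    counts agree at once. *)
Lemma compose_assoc m n p q (D : diagram m n) (E : diagram n p) (F : diagram p q) :
  compose D (compose E F) = compose (compose D E) F /\
  (stack_loops E D + stack_loops F (compose D E) =
   stack_loops F E + stack_loops (compose E F) D)%N.
Proof.
set X := compose D (compose E F); set Y := compose (compose D E) F.
have [|-> ->] := @diagram_mx_scale_inj m q (stack_loops F E + stack_loops (compose E F) D)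
  (stack_loops E D + stack_loops F (compose D E)) X Y; last by [].
move=> a c; rewrite !expnD -!mulnA -!diagram_mx_compose !big_distrr/=.
under eq_bigr do rewrite mulnCA -diagram_mx_compose big_distrr/=.
under [RHS]eq_bigr do rewrite mulnA -diagram_mx_compose big_distrl/=.
rewrite exchange_big/=; apply: eq_bigr => b _; apply: eq_bigr => d _.
by rewrite mulnA.
Qed.

Definition swap m n (z : 'I_m + 'I_n) : 'I_n + 'I_m :=
  match z with inl i => inr i | inr j => inl j end.

Lemma swapK m n : cancel (@swap m n) (@swap n m).
Proof. by case. Qed.

Definition flip m n (D : diagram m n) : diagram n m :=
  Sub [set @swap m n @: (B : {set _}) | B in val D]
      (imset_matching (@swapK m n) (@swapK n m) (valP D)).

Lemma diagram_mx_flip m n (D : diagram m n) a b :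
  diagram_mx (flip D) b a = diagram_mx D a b.
Proof.
rewrite /diagram_mx [val _]/= imset_respects; apply: eq_respects.
by case.
Qed.

Lemma flipK m n (D : diagram m n) : flip (flip D) = D.
Proof. by apply: diagram_mx_inj => a b; rewrite !diagram_mx_flip. Qed.

Lemma flip_compose m n p (D : diagram m n) (E : diagram n p) :
  compose (flip E) (flip D) = flip (compose D E) /\
  stack_loops (flip D) (flip E) = stack_loops E D.
Proof.
apply: compose_eq => a c; rewrite diagram_mx_flip -diagram_mx_compose.
by apply: eq_bigr => b _; rewrite !diagram_mx_flip mulnC.
Qed.

Section PermDiagrams.
Variable n : nat.
Implicit Types (g h : {perm 'I_n}) (D : diagram n n).

(** Top point [j] is joined to bottom point [g j]. As [h * g] applies [h] first, this convention
    makes [perm_diagram] multiplicative for [brauer_comp] without reversal. *)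
Definition perm_partner g (z : 'I_n + 'I_n) : 'I_n + 'I_n :=
  match z with inl i => inr ((g^-1)%g i) | inr j => inl (g j) end.

Lemma perm_partnerK g : involutive (perm_partner g).
Proof. by case=> i /=; rewrite ?permKV ?permK. Qed.

Lemma perm_partner_neq g z : perm_partner g z != z.
Proof. by case: z. Qed.

Definition perm_diagram g : diagram n n :=
  Sub _ (involution_matching (perm_partnerK g) (perm_partner_neq g)).

Lemma diagram_mx_perm g a b : diagram_mx (perm_diagram g) a b = [forall i, a (g i) == b i].
Proof.
rewrite /diagram_mx [val _]/= involution_respects.
apply/forallP/forallP => [h i|h [i|i]/=].
- by have := h (inl (g i)); rewrite /= permK.
- by rewrite -(eqP (h ((g^-1)%g i))) permKV.
- by rewrite eq_sym.
Qed.

Lemma diagram_mx_permE g a b :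
  diagram_mx (perm_diagram g) a b = ([ffun i => a (g i)] == b).
Proof.
by rewrite diagram_mx_perm -ffun_forall_eq; apply: eq_forallb => i; rewrite ffunE.
Qed.

Lemma perm_diagram_inj : injective perm_diagram.
Proof.
move=> g h gh; apply/permP => i; apply/eqP.
pose a : {ffun 'I_n -> bool} := [ffun k => k == g i].
have := diagram_mx_permE g a [ffun k => a (g k)].
rewrite eqxx gh diagram_mx_perm => /forallP/(_ i).
by rewrite !ffunE eqxx eqb_id eq_sym.
Qed.

Lemma compose_perm g h :
  compose (perm_diagram g) (perm_diagram h) = perm_diagram (h * g) /\
  stack_loops (perm_diagram h) (perm_diagram g) = 0%N.
Proof.
apply: compose_eq => a c; rewrite mul1n.
under eq_bigr do rewrite diagram_mx_permE mulnC eq_sym.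
rewrite (sum_mul_pred1 (fun b => diagram_mx (perm_diagram h) b c : nat)).
by rewrite !diagram_mx_perm; congr nat_of_bool; apply: eq_forallb => i; rewrite ffunE permM.
Qed.

Lemma flip_perm g : flip (perm_diagram g) = perm_diagram (g^-1)%g.
Proof.
apply: diagram_mx_inj => a b; rewrite diagram_mx_flip !diagram_mx_perm.
apply/forallP/forallP => h i.
  by have := h ((g^-1)%g i); rewrite permKV eq_sym.
by have := h (g i); rewrite permK eq_sym.
Qed.

Definition is_perm_diagram D := [exists g, D == perm_diagram g].

Lemma is_perm_diagramP D : reflect (exists g, D = perm_diagram g) (is_perm_diagram D).
Proof. by apply: (iffP existsP) => -[g /eqP]; exists g. Qed.

Lemma is_perm_perm g : is_perm_diagram (perm_diagram g).
Proof. by apply/is_perm_diagramP; exists g. Qed.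

Lemma is_perm_flip D : is_perm_diagram (flip D) = is_perm_diagram D.
Proof.
have H E : is_perm_diagram E -> is_perm_diagram (flip E).
  by move=> /is_perm_diagramP[g ->]; rewrite flip_perm is_perm_perm.
by apply/idP/idP => [/H|/H //]; rewrite flipK.
Qed.

(** Without a pair of top points, every top point is joined to a bottom one; this injection between
    sets of [n] elements is a permutation. *)
Lemma not_perm_cup D : ~~ is_perm_diagram D ->
  exists i j, i != j /\ [set inr i; inr j] \in val D.
Proof.
move=> nD; apply: contrapT => no.
have mD := valP D; have pD := perfect_matching_partition mD.
have /choice[g gP] j : exists i, [set inl i; inr j] \in val D.
  have [B BD jB] := perfect_matching_block (inr j) mD.
  have cB := perfect_matching_card mD BD.
  have [y yB yj] := pair_other cB jB.
  have BE := pair_block cB yB jB yj.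
  case: y yB yj BE => [i|k] yB yj BE; first by exists i; rewrite -BE.
  by case: no; exists k, j; rewrite -BE.
have ginj : injective g.
  move=> j k gjk.
  have jk := partition_block pD (gP j) (gP k) (set21 _ _).
  move: jk; rewrite gjk set21 => /(_ isT) /setP/(_ (inr j)).
  by rewrite !inE eqxx orbT => /esym/orP[//|/eqP[]].
case/negP: nD; apply/is_perm_diagramP; exists (perm ginj).
apply: diagram_mx_inj => a b; rewrite diagram_mx_perm.
apply/respectsP/forallP => [h j|h B x y BD xB yB].
  by rewrite permE; apply/eqP/(h _ (inl (g j)) (inr j) (gP j)); rewrite ?set21 ?set22.
have [j BE] : exists j, B = [set inl (g j); inr j].
  case: x xB => [i|j] xB.
    exists (invF ginj i); apply: (partition_block pD BD (gP _) xB).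
    by rewrite f_invF set21.
  by exists j; apply: (partition_block pD BD (gP _) xB); rewrite set22.
have := h j; rewrite permE => /eqP hj.
by rewrite BE in xB yB; case/set2P: xB => ->; case/set2P: yB => ->.
Qed.

(** A colouring that separates the two ends of a top pair gives a zero column. *)
Lemma not_perm_top D : ~~ is_perm_diagram D -> exists c, forall b, ~~ diagram_mx D b c.
Proof.
move=> /not_perm_cup[i [j [ij BD]]]; exists [ffun k => k == i] => b.
apply/negP => /respectsP/(_ _ (inr i) (inr j) BD).
by rewrite set21 set22 /= !ffunE eqxx eq_sym (negPf ij) => /(_ isT isT).
Qed.

Lemma not_perm_bottom D : ~~ is_perm_diagram D -> exists a, forall b, ~~ diagram_mx D a b.
Proof.
rewrite -is_perm_flip => /not_perm_top[a h]; exists a => b.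
by rewrite -diagram_mx_flip.
Qed.

(** A permutation matrix has a nonzero entry in each row and column, whereas a non-permutation
    factor brings in a zero row or column. So the non-permutation diagrams span a two-sided
    ideal. *)
Lemma is_perm_compose D E : is_perm_diagram (compose D E) ->
  is_perm_diagram D && is_perm_diagram E.
Proof.
move=> /is_perm_diagramP[g DE]; apply/andP; split; apply: contraT.
  move=> /not_perm_bottom[a h].
  have := diagram_mx_compose D E a [ffun i => a (g i)].
  rewrite DE diagram_mx_permE eqxx muln1 big1 => [/esym/eqP|b _].
    by rewrite expn_eq0.
  by rewrite (negPf (h b)).
move=> /not_perm_top[c h].
have := diagram_mx_compose D E [ffun i => c ((g^-1)%g i)] c.
rewrite DE diagram_mx_perm big1 => [|b _]; last by rewrite (negPf (h b)) muln0.
have -> : [forall i, [ffun i => c ((g^-1)%g i)] (g i) == c i].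
  by apply/forallP => i; rewrite ffunE permK.
by rewrite muln1 => /esym/eqP; rewrite expn_eq0.
Qed.

End PermDiagrams.

Section Cup.
Variables (n : nat) (i : 'I_n.+2) (j : 'I_n.+1).

(** Any two distinct elements of ['I_n.+2] are of the form [i] and [lift i j], so a cup can be
    placed anywhere; the other strands keep their order. *)
Definition cup_partner (z : 'I_n + 'I_n.+2) : 'I_n + 'I_n.+2 :=
  match z with
  | inl k => inr (lift i (lift j k))
  | inr x => if unlift i x is Some y
             then if unlift j y is Some k then inl k else inr i
             else inr (lift i j)
  end.

Lemma cup_partnerK : involutive cup_partner.
Proof.
case=> [k|x] /=; first by rewrite !liftK.
case: unliftP => [y|] -> /=; last by rewrite liftK unlift_none.
by case: unliftP => [k|] -> //=; rewrite unlift_none.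
Qed.

Lemma cup_partner_neq z : cup_partner z != z.
Proof.
case: z => [k|x] //=; case: unliftP => [y|] -> /=.
  by case: unliftP => [k|] -> //; apply/negP => /eqP/(@inr_inj 'I_n 'I_n.+2)/eqP; rewrite (negPf (neq_lift _ _)).
by apply/negP => /eqP/(@inr_inj 'I_n 'I_n.+2)/eqP; rewrite eq_sym (negPf (neq_lift _ _)).
Qed.

Definition cup_diagram : diagram n n.+2 :=
  Sub _ (involution_matching cup_partnerK cup_partner_neq).

Definition extend_colouring (a : {ffun 'I_n -> bool}) (s : bool) : {ffun 'I_n.+2 -> bool} :=
  [ffun x => if unlift i x is Some y then if unlift j y is Some k then a k else s else s].

Definition restrict_colouring (c : {ffun 'I_n.+2 -> bool}) : {ffun 'I_n -> bool} :=
  [ffun k => c (lift i (lift j k))].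

Lemma extend_colouringK a s : restrict_colouring (extend_colouring a s) = a.
Proof. by apply/ffunP => k; rewrite !ffunE !liftK. Qed.

Lemma diagram_mx_cup a b : diagram_mx cup_diagram a b = (b == extend_colouring a (b i)).
Proof.
rewrite /diagram_mx [val _]/= involution_respects.
apply/forallP/eqP => [h|bE].
  apply/ffunP => x; rewrite ffunE.
  case: unliftP => [y|] -> //; case: unliftP => [k|] ->.
    by have := h (inl k) => /= /eqP.
  by have := h (inr i); rewrite /= unlift_none => /eqP.
have bx x : b x = extend_colouring a (b i) x by rewrite -bE.
have bj : b (lift i j) = b i by rewrite bx ffunE liftK unlift_none.
have bk k : b (lift i (lift j k)) = a k by rewrite bx ffunE !liftK.
case=> [k|x] /=; first by rewrite bk.
case: unliftP => [y|] ->; last by rewrite /= bj.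
by case: unliftP => [k|] ->; rewrite /= ?bk ?bj.
Qed.

Lemma diagram_mx_cup2 a b : (diagram_mx cup_diagram a b =
  (b == extend_colouring a true) + (b == extend_colouring a false) :> nat)%N.
Proof.
rewrite diagram_mx_cup.
have E s : extend_colouring a s i = s by rewrite ffunE unlift_none.
have [-> |nt] := eqVneq b (extend_colouring a true).
  rewrite E eqxx; case: eqP => // /ffunP/(_ i); by rewrite !E.
have [-> |nf] := eqVneq b (extend_colouring a false); first by rewrite E eqxx.
by case: (b i); rewrite ?(negPf nt) ?(negPf nf).
Qed.

Lemma sum_diagram_mx_cup (F : {ffun 'I_n.+2 -> bool} -> nat) a :
  (\sum_b F b * diagram_mx cup_diagram a b =
   F (extend_colouring a true) + F (extend_colouring a false))%N.
Proof.
under eq_bigr do rewrite diagram_mx_cup2 mulnDr.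
by rewrite big_split/= !sum_mul_pred1.
Qed.

Lemma diagram_mx_cup_extend a a' s :
  diagram_mx cup_diagram a' (extend_colouring a s) = (a == a').
Proof.
rewrite diagram_mx_cup; apply/eqP/eqP => [/(congr1 restrict_colouring)|->].
  by rewrite !extend_colouringK.
by rewrite [in RHS]ffunE unlift_none.
Qed.

Lemma compose_cup_cap :
  compose cup_diagram (flip cup_diagram) = id_diagram n /\
  stack_loops (flip cup_diagram) cup_diagram = 1%N.
Proof.
apply: compose_eq => a c; rewrite diagram_mx_id.
under eq_bigr do rewrite diagram_mx_flip mulnC.
rewrite sum_diagram_mx_cup !diagram_mx_cup_extend eq_sym.
by case: eqP.
Qed.

Lemma compose_cap_cup m (D : diagram m n.+2) :
  [set inr i; inr (lift i j)] \in val D ->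
  compose (compose D (flip cup_diagram)) cup_diagram = D /\
  (stack_loops (flip cup_diagram) D + stack_loops cup_diagram (compose D (flip cup_diagram)))%N = 1%N.
Proof.
move=> BD; set X := compose _ cup_diagram.
have [|<- ->//] := @diagram_mx_scale_inj m n.+2
  (stack_loops (flip cup_diagram) D + stack_loops cup_diagram (compose D (flip cup_diagram))) 1 X D.
move=> a c; rewrite expnD -mulnA -diagram_mx_compose big_distrr/=.
under eq_bigr do rewrite mulnA -diagram_mx_compose.
(* The two cup points form a block of [D], so their common colour does not matter; summing over it
   gives the factor 2 of the loop. *)
have cD r : diagram_mx D a (extend_colouring r true) = diagram_mx D a (extend_colouring r false).
  have resp s s' : diagram_mx D a (extend_colouring r s) -> diagram_mx D a (extend_colouring r s').
    move=> /respectsP h; apply/respectsP => B x y B'D xB yB.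
    have [BE|BE] := eqVneq B [set inr i; inr (lift i j)].
      rewrite BE in xB yB.
      by case/set2P: xB => ->; case/set2P: yB => ->; rewrite /= !ffunE ?liftK ?unlift_none.
    have same z : z \in B -> join a (extend_colouring r s') z = join a (extend_colouring r s) z.
      case: z => [//|z zB] /=; rewrite !ffunE.
      have nz w : w \in [set inr i; inr (lift i j)] -> w \in B -> False.
        move=> w1 w2; case/eqP: BE.
        exact: partition_block (perfect_matching_partition (valP D)) B'D BD w2 w1.
      case: unliftP => [y0|] zE; last by case: (nz _ _ zB); rewrite zE set21.
      case: unliftP => [//|] yE; case: (nz _ _ zB).
      by rewrite zE yE set22.
    by rewrite !same//; exact: h B'D xB yB.
  by apply/idP/idP; exact: resp.
rewrite (eq_bigr (fun b => 2 * diagram_mx D a (extend_colouring b true) * diagram_mx cup_diagram b c)%N);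
  last first.
  move=> b _; congr (_ * _)%N.
  under eq_bigr do rewrite diagram_mx_flip.
  by rewrite sum_diagram_mx_cup -cD mul2n -addnn.
have [cE|cE] := eqVneq c (extend_colouring (restrict_colouring c) (c i)); last first.
  rewrite big1 => [|b _]; last first.
    rewrite diagram_mx_cup; case: eqP => [E|]; last by rewrite muln0.
    by case/eqP: cE; rewrite {2}E extend_colouringK.
  suff -> : diagram_mx D a c = false by rewrite muln0.
  apply: contra_neqF cE => /respectsP/(_ _ (inr i) (inr (lift i j)) BD).
  rewrite set21 set22 => /(_ isT isT) /= E.
  apply/ffunP => x; rewrite ffunE; case: unliftP => [y|] -> //.
  by case: unliftP => [k|] -> //; rewrite ffunE.
under eq_bigr => b _.
  rewrite [X in (_ * nat_of_bool X)%N](_ : _ = (b == restrict_colouring c)); last first.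
    by rewrite {1}cE diagram_mx_cup_extend eq_sym.
  over.
rewrite (sum_mul_pred1 (fun b => 2 * diagram_mx D a (extend_colouring b true))%N).
congr (_ * nat_of_bool _)%N; rewrite [in RHS]cE; case: (c i) => //; exact: cD.
Qed.

End Cup.

Lemma leq_sum2 (I : finType) (i j : I) (F : I -> nat) :
  j != i -> (F i + F j <= \sum_k F k)%N.
Proof. by move=> ji; rewrite (bigD1 i)//= (bigD1 j)//= addnA leq_addr. Qed.

Lemma sum_single (I : finType) (V : zmodType) (i : I) (F : I -> V) :
  (forall j, j != i -> F j = 0) -> \sum_j F j = F i.
Proof. by move=> F0; rewrite (bigD1 i)//= big1 ?addr0. Qed.

(** * Endomorphism algebras of the Brauer category *)

Lemma lin_ext (K : numClosedFieldType) (D : finType) (V : lmodType K)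
    (T U : {ffun D -> K^o} -> V) : linear T -> linear U ->
  (forall d, T (basis_fun K d) = U (basis_fun K d)) -> T =1 U.
Proof.
move=> Tl Ul h x; rewrite (basis_fun_sum x) (lin_sum Tl) (lin_sum Ul).
by apply: eq_bigr => d _; rewrite (linZ Tl) (linZ Ul) h.
Qed.

Section BrauerComposition.
Variables (K : numClosedFieldType) (t : K).
Local Notation H := (brauer_hom K).
Local Notation "g ** f" := (brauer_comp t g f) (at level 40, left associativity).
Local Notation bd D := (basis_fun K D).

Lemma brauer_compE m n p (g : H n p) (f : H m n) :
  g ** f = \sum_E \sum_D (t ^+ stack_loops E D * g E * f D) *: (bd (compose D E) : H m p).
Proof.
apply/ffunP => F; rewrite ffunE sum_ffunE; apply: eq_bigr => E _.
rewrite sum_ffunE big_mkcond/=; apply: eq_bigr => D _.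
rewrite !ffunE -[F == _]val_eqE /=; rewrite /GRing.scale/=.
by case: eqP => _; rewrite ?mulr1 ?mulr0.
Qed.

(* Unification otherwise attempts to compute set partitions. *)
Local Opaque compose flip perm_diagram cup_diagram stack_loops.

Lemma brauer_comp_linr m n p (g : H n p) : linear (fun f : H m n => g ** f).
Proof.
move=> a f f'; rewrite !brauer_compE scaler_sumr -big_split/=; apply: eq_bigr => E _.
rewrite scaler_sumr -big_split/=; apply: eq_bigr => D _.
by rewrite !ffunE scalerA -scalerDl mulrDr; congr ((_ + _) *: _); rewrite mulrCA.
Qed.

Lemma brauer_comp_linl m n p (f : H m n) : linear (fun g : H n p => g ** f).
Proof.
move=> a g g'; rewrite !brauer_compE scaler_sumr -big_split/=; apply: eq_bigr => E _.
rewrite scaler_sumr -big_split/=; apply: eq_bigr => D _.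
rewrite !ffunE scalerA -scalerDl mulrDr mulrDl; congr ((_ + _) *: _).
by rewrite /GRing.scale/= [in LHS]mulrCA !mulrA.
Qed.

Lemma brauer_comp_basis m n p (E : diagram n p) (D : diagram m n) :
  bd E ** bd D = t ^+ stack_loops E D *: (bd (compose D E) : H m p).
Proof.
have z E' D' : (E' != E) || (D' != D) ->
    (t ^+ stack_loops E' D' * bd E E' * bd D D') *: (bd (compose D' E') : H m p) = 0.
  rewrite [bd E E']ffunE [bd D D']ffunE.
  by case/orP => /negPf ->; rewrite ?mulr0 ?mul0r scale0r.
rewrite brauer_compE (sum_single (i := E)); last first.
  by move=> E' nE; apply: big1 => D' _; apply: z; rewrite nE.
rewrite (sum_single (i := D)); last by move=> D' nD; apply: z; rewrite nD orbT.
by congr (_ *: _); rewrite [bd E E]ffunE [bd D D]ffunE !eqxx !mulr1.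
Qed.

Lemma brauer_compA m n p q (h : H p q) (g : H n p) (f : H m n) :
  h ** (g ** f) = h ** g ** f.
Proof.
have lr := @brauer_comp_linr; have ll := @brauer_comp_linl.
move: f; apply: lin_ext => [a x y|a x y|D]; [by rewrite lr lr|by rewrite lr|].
move: g; apply: lin_ext => [a x y|a x y|E]; [by rewrite ll lr|by rewrite lr ll|].
move: h; apply: lin_ext => [a x y|a x y|F]; [by rewrite ll|by rewrite ll ll|].
rewrite !brauer_comp_basis (linZ (lr _ _ _ _)) (linZ (ll _ _ _ _)) !brauer_comp_basis !scalerA.
have [-> e] := compose_assoc D E F.
by rewrite -!exprD e.
Qed.

Lemma brauer_comp1l m n (f : H m n) : brauer_id K n ** f = f.
Proof.
move: f; apply: lin_ext => [a x y|//|D]; first by rewrite brauer_comp_linr.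
rewrite (_ : brauer_id K n = bd (id_diagram n))//.
by rewrite brauer_comp_basis; have [-> ->] := compose_id_r D; rewrite scale1r.
Qed.

Lemma brauer_comp1r m n (f : H m n) : f ** brauer_id K m = f.
Proof.
move: f; apply: lin_ext => [a x y|//|D]; first by rewrite brauer_comp_linl.
rewrite (_ : brauer_id K m = bd (id_diagram m))//.
by rewrite brauer_comp_basis; have [-> ->] := compose_id_l D; rewrite scale1r.
Qed.

Lemma brauer_compP n : bilinear_assoc (@brauer_comp K t n n n).
Proof.
split; first exact: brauer_compA.
  by move=> a x y z; exact: brauer_comp_linl.
by move=> a x y z; exact: brauer_comp_linr.
Qed.

Lemma brauer_comp0r m n p (f : H m n) : 0 ** f = 0 :> H m p.
Proof. exact: (lin0 (brauer_comp_linl f)). Qed.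
Lemma brauer_compr0 m n p (g : H n p) : g ** 0 = 0 :> H m p.
Proof. exact: (lin0 (@brauer_comp_linr m n p g)). Qed.
Lemma brauer_compZl m n p a (g : H n p) (f : H m n) : (a *: g) ** f = a *: (g ** f).
Proof. exact: (linZ (brauer_comp_linl f)). Qed.
Lemma brauer_compZr m n p a (g : H n p) (f : H m n) : g ** (a *: f) = a *: (g ** f).
Proof. exact: (linZ (brauer_comp_linr g)). Qed.

Lemma brauer_comp_basis3 m n p q (F : diagram p q) (E : diagram n p) (D : diagram m n) :
  bd F ** (bd E ** bd D) =
  t ^+ (stack_loops E D + stack_loops F (compose D E)) *: (bd (compose (compose D E) F) : H m q).
Proof. by rewrite brauer_comp_basis brauer_compZr brauer_comp_basis scalerA -exprD. Qed.

Definition bflip m n (f : H m n) : H n m := [ffun D => f (flip D)].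

Lemma bflip_lin m n : linear (@bflip m n).
Proof. by move=> a x y; apply/ffunP => D; rewrite !ffunE. Qed.

Lemma bflipK m n (f : H m n) : bflip (bflip f) = f.
Proof. by apply/ffunP => D; rewrite !ffunE flipK. Qed.

Lemma bflip_basis m n (D : diagram m n) : bflip (bd D) = bd (flip D).
Proof. by apply/ffunP => E; rewrite !ffunE (can2_eq (@flipK n m) (@flipK m n)). Qed.

Lemma bflip_comp m n p (g : H n p) (f : H m n) : bflip (g ** f) = bflip f ** bflip g.
Proof.
have lr := @brauer_comp_linr; have ll := @brauer_comp_linl; have lb := bflip_lin.
move: f; apply: lin_ext => [a x y|a x y|D]; [by rewrite lr lb|by rewrite lb ll|].
move: g; apply: lin_ext => [a x y|a x y|E]; [by rewrite ll lb|by rewrite lb lr|].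
rewrite !bflip_basis !brauer_comp_basis (linZ (lb _ _)) bflip_basis.
by have [-> ->] := flip_compose D E.
Qed.

(** For a finite-dimensional unital algebra this is equivalent to semisimplicity; it is the form in
    which genericity is used. *)
Definition semiprime_End n := forall x : H n n, x != 0 -> exists a, x ** a ** x != 0.

(** If [x ** a ** x] vanished for all [a], write the identity as [a ** x + j] with [j] in a
    complement of the left ideal of [x]. Then [x = x ** j] lies in both. *)
Lemma semisimple_semiprime n : semisimple_End t n -> semiprime_End n.
Proof.
move=> ss x x0; apply: contrapT => /forallNP no.
have xax a : x ** a ** x = 0 by apply/eqP/negP => /negP; exact: no.
have [I IP] : exists I : {vspace H n n}, forall y, y \in I <-> exists a, y = a ** x.
  apply: vspace_of_closed => [|c _ _ [a ->] [b ->]]; first by exists 0; rewrite brauer_comp0r.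
  by exists (c *: a + b); rewrite brauer_comp_linl.
have [|J [Jl IJ IJ0]] := ss I.
  by move=> a y /IP[b ->]; apply/IP; exists (a ** b); rewrite brauer_compA.
have /memv_addP[_ /IP[a ->] [j jJ oneE]] : brauer_id K n \in (I + J)%VS by rewrite IJ memvf.
have xE : x = x ** j.
  rewrite -{1}[x]brauer_comp1r oneE -[a ** x]scale1r brauer_comp_linr scale1r.
  by rewrite brauer_compA xax add0r.
have : x \in (I :&: J)%VS.
  rewrite memv_cap; apply/andP; split; last by rewrite xE; exact: Jl.
  by apply/IP; exists (brauer_id K n); rewrite brauer_comp1l.
by rewrite IJ0 memv0 (negPf x0).
Qed.

(* For t = 0 the diagram made of a cup and a cap generates a nilpotent ideal. *)
Lemma semiprime_End_neq0 : semiprime_End 2 -> t != 0.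
Proof.
move=> sp; apply/eqP => t0.
pose U : diagram 0 2 := cup_diagram ord0 ord0.
pose X := compose (flip U) U.
have [|a /eqP[]] := sp (bd X).
  by apply/eqP => /ffunP/(_ X)/eqP; rewrite !ffunE eqxx oner_eq0.
pose cst s n : {ffun 'I_n -> bool} := [ffun=> s].
have cstU s : diagram_mx U [ffun=> false] (cst s 2).
  rewrite diagram_mx_cup; apply/eqP/ffunP => x; rewrite !ffunE.
  by case: unliftP => [y|] //; case: unliftP => [[]|].
have cstX s s' : diagram_mx X (cst s 2) (cst s' 2).
  have := diagram_mx_compose (flip U) U (cst s 2) (cst s' 2).
  rewrite (bigD1 [ffun=> false])//= diagram_mx_flip !cstU.
  by case: diagram_mx => //; rewrite muln0.
(* Without a loop this matrix entry would be at most 1, but the two constant intermediate colourings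
   already contribute 2. *)
have loops D : (0 < stack_loops D X + stack_loops X (compose X D))%N.
  set l := (_ + _)%N.
  have : (2 <= 2 ^ l * diagram_mx (compose (compose X D) X) (cst false 2) (cst false 2))%N.
    rewrite expnD -mulnA -diagram_mx_compose big_distrr/=.
    under eq_bigr do rewrite mulnA -diagram_mx_compose.
    have cstD s : diagram_mx D (cst s 2) (cst s 2).
      apply/respectsP => B x y _ _ _.
      by case: x => i; case: y => j /=; rewrite !ffunE.
    have ge1 s : (1 <= (\sum_b diagram_mx X (cst false 2) b * diagram_mx D b (cst s 2)) *
        diagram_mx X (cst s 2) (cst false 2))%N.
      by rewrite cstX muln1 (bigD1 (cst s 2))//= cstX cstD.
    have ne : cst false 2 != cst true 2.
      by apply/negP => /eqP/(congr1 (fun f : {ffun _ -> bool} => f ord0)); rewrite !ffunE.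
    by apply: leq_trans (leq_sum2 _ ne); exact: (leq_add (ge1 true) (ge1 false)).
  by case: l => //; rewrite expn0 mul1n; case: diagram_mx.
have xx : (fun a => bd X ** a ** bd X) =1 (fun=> 0).
  apply: lin_ext => [c x y|c x y|D]; last 1 first.
  - rewrite -brauer_compA brauer_comp_basis3.
    move: (loops D); move: (stack_loops D X + _)%N => [|l] lD; first by rewrite ltnn in lD.
    by rewrite t0 exprS mul0r scale0r.
  - by rewrite brauer_comp_linr brauer_comp_linl.
  - by rewrite scaler0 addr0.
exact: xx.
Qed.

(** * Fixed primitive idempotents in the endomorphism algebras *)

Section GenericParameter.
Hypothesis sp : forall n, semiprime_End n.
Let t0 : t != 0 := semiprime_End_neq0 (sp (n := 2)).

(** The quotient map onto the group algebra of the symmetric group, with kernel the ideal of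
    non-permutation diagrams. *)
Definition perm_part n (x : H n n) : {ffun {perm 'I_n} -> K^o} :=
  [ffun g => x (perm_diagram g)].

Lemma perm_part_lin n : linear (@perm_part n).
Proof. by move=> a x y; apply/ffunP => g; rewrite !ffunE. Qed.

Lemma perm_part_perm n (g : {perm 'I_n}) : perm_part (bd (perm_diagram g)) = basis_fun K g.
Proof. by apply/ffunP => h; rewrite !ffunE (inj_eq (@perm_diagram_inj n)). Qed.

Lemma perm_part_not_perm n (D : diagram n n) : ~~ is_perm_diagram D -> perm_part (bd D) = 0.
Proof.
move=> nD; apply/ffunP => g; rewrite !ffunE; case: eqP => // gD.
by case/negP: nD; rewrite -gD is_perm_perm.
Qed.

Lemma perm_part_flip n (x : H n n) : perm_part (bflip x) = ginv (perm_part x).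
Proof. by apply/ffunP => g; rewrite !ffunE flip_perm. Qed.

Lemma perm_part0P n (y : H n n) : perm_part y = 0 ->
  y = \sum_(D | ~~ is_perm_diagram D) y D *: bd D.
Proof.
move=> y0; rewrite {1}(basis_fun_sum y) [RHS]big_mkcond/=; apply: eq_bigr => D _.
case: ifPn => //; rewrite negbK => /is_perm_diagramP[g ->].
by move/ffunP/(_ g): y0; rewrite !ffunE => ->; rewrite scale0r.
Qed.

Lemma perm_part0 n : perm_part (0 : H n n) = 0.
Proof. exact: lin0 (@perm_part_lin n). Qed.

Lemma perm_partM n (x y : H n n) : perm_part (x ** y) = gmul (perm_part x) (perm_part y).
Proof.
have lr := @brauer_comp_linr; have ll := @brauer_comp_linl; have lp := perm_part_lin.
have gl z := mul_lin_l (gmulP K {perm 'I_n}) z.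
have gr z := mul_lin_r (gmulP K {perm 'I_n}) z.
move: x; apply: lin_ext => [a x x'|a x x'|E]; [by rewrite ll lp|by rewrite lp gl|].
move: y; apply: lin_ext => [a x x'|a x x'|D]; [by rewrite lr lp|by rewrite lp gr|].
rewrite brauer_comp_basis (linZ (lp _)).
have zero (c : K) u v w : u = 0 -> v = 0 \/ w = 0 -> c *: u = gmul v w.
  by move=> -> [->|->]; rewrite ?(amul0r (gmulP K _)) ?(amulr0 (gmulP K _)) scaler0.
have [/is_perm_diagramP[h hE]|nE] := boolP (is_perm_diagram E); last first.
  apply: zero; last by left; exact: perm_part_not_perm.
  by apply: perm_part_not_perm; apply: contra nE => /is_perm_compose/andP[].
have [/is_perm_diagramP[g gE]|nD] := boolP (is_perm_diagram D); last first.
  apply: zero; last by right; exact: perm_part_not_perm.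
  by apply: perm_part_not_perm; apply: contra nD => /is_perm_compose/andP[].
rewrite hE gE; have [-> ->] := compose_perm g h.
have delta u v w : u = basis_fun K (h * g)%g -> v = basis_fun K h ->
    w = basis_fun K g -> 1 *: u = gmul v w.
  by move=> -> -> ->; rewrite scale1r gmul_delta.
by apply: delta; exact: perm_part_perm.
Qed.

Lemma perm_part_ideal n (x y : H n n) : perm_part y = 0 -> perm_part (x ** y) = 0.
Proof. by move=> y0; rewrite perm_partM y0 (amulr0 (gmulP K _)). Qed.

(** The left annihilator of that ideal; by semiprimeness the two meet trivially, so the annihilator
    embeds in the group algebra. *)
Definition kills_nonperm n (z : H n n) := forall y, perm_part y = 0 -> z ** y = 0.

Lemma kills_nonperm_eq0 n (z : H n n) : perm_part z = 0 -> kills_nonperm z -> z = 0.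
Proof.
move=> z0 zk; apply/eqP; apply: contraT => /sp[a /eqP[]].
by rewrite -brauer_compA; apply: zk; exact: perm_part_ideal.
Qed.

(* Modulo the span of the non-permutation diagrams x lies in K[S_n]; the primitive
   idempotent found there lifts uniquely to the annihilator of that span. *)
Lemma enough_fixed_primitives_kills n (x : H n n) : x != 0 -> kills_nonperm x ->
  exists f, [/\ primitive (@brauer_comp K t n n n) f, bflip f = f & x ** f != 0].
Proof.
move=> x0 xk.
have px0 : perm_part x != 0 by apply: contra_neq x0 => h; exact: kills_nonperm_eq0.
have [f' [_ sf' [f'0 ff' fAf'] xf']] := enough_fixed_primitives_Sym (fun g _ => in_setT g) px0.
pose f : H n n := \sum_g f' g *: bd (perm_diagram g).
have pf : perm_part f = f'.
  rewrite (lin_sum (@perm_part_lin n)) [RHS]basis_fun_sum; apply: eq_bigr => g _.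
  by rewrite (linZ (@perm_part_lin n)) perm_part_perm.
have xf0 : x ** f != 0.
  apply: contra_neq xf' => h.
  by rewrite -pf -perm_partM h perm_part0.
have [a xfaxf] := sp xf0.
(* [f] is merely a lift of [f']. As [x] annihilates the ideal, the sandwich does too, and it lifts a
   multiple of [f']. *)
pose w := f ** a ** x ** f.
have wk : kills_nonperm w.
  move=> y y0; rewrite /w -!brauer_compA.
  by rewrite (xk (f ** y)) ?brauer_compr0//; exact: perm_part_ideal.
have w0 : w != 0.
  apply: contra_neq xfaxf => h.
  have -> : x ** f ** a ** (x ** f) = x ** w by rewrite /w -!brauer_compA.
  by rewrite h brauer_compr0.
have [l lE] : exists l, perm_part w = l *: f'.
  have [|l lE] := fAf' (perm_part (a ** x)); first by move=> g; rewrite in_setT.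
  exists l; rewrite -lE /w !perm_partM pf.
  by have [gA _ _] := gmulP K {perm 'I_n}; rewrite !gA.
have l0 : l != 0.
  apply: contra_neq w0 => l0; apply: kills_nonperm_eq0 => //.
  by rewrite lE l0 scale0r.
pose e := l^-1 *: w.
have pe : perm_part e = f' by rewrite (linZ (@perm_part_lin n)) lE scalerA mulVf// scale1r.
have ek : kills_nonperm e by move=> y y0; rewrite brauer_compZl wk// scaler0.
have killsM u v : kills_nonperm u -> kills_nonperm (u ** v).
  by move=> uk y y0; rewrite -brauer_compA; apply: uk; exact: perm_part_ideal.
have killsL u v : kills_nonperm u -> kills_nonperm (v ** u).
  by move=> uk y y0; rewrite -brauer_compA uk// brauer_compr0.
have killsD c u v : kills_nonperm u -> kills_nonperm v -> kills_nonperm (c *: u + v).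
  by move=> uk vk y y0; rewrite brauer_comp_linl uk// vk// scaler0 addr0.
have eq_kills u v : kills_nonperm u -> kills_nonperm v -> perm_part u = perm_part v -> u = v.
  move=> uk vk uv; apply/eqP; rewrite -subr_eq0 -scaleN1r addrC; apply/eqP.
  apply: kills_nonperm_eq0; last exact: killsD.
  by rewrite perm_part_lin uv scaleN1r addNr.
(* The flip turns left annihilation into right annihilation. Here [bflip y ** e] lies both in the
   ideal and in its left annihilator, hence is zero. *)
have fk : kills_nonperm (bflip e).
  move=> y y0; rewrite -[LHS]bflipK bflip_comp bflipK.
  have py : perm_part (bflip y) = 0.
    by rewrite perm_part_flip y0; apply/ffunP => g; rewrite !ffunE.
  rewrite (_ : bflip y ** e = 0) ?(lin0 (@bflip_lin n n))//.
  apply: kills_nonperm_eq0; last exact: killsL.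
  by rewrite perm_partM py (amul0r (gmulP K _)).
have ee : e ** e = e by apply: eq_kills => //; [exact: killsM|rewrite perm_partM pe].
exists e; split.
- split=> // [|b _]; first by apply: contra_neq f'0 => e0; rewrite -pe e0 perm_part0.
  have [|m mE] := fAf' (perm_part b); first by move=> g; rewrite in_setT.
  exists m; apply: eq_kills; first by do 2?[apply: (killsM)].
    by move=> y y0; rewrite brauer_compZl ek// scaler0.
  by rewrite !perm_partM pe mE (linZ (@perm_part_lin n)) pe.
- by apply: eq_kills => //; rewrite perm_part_flip pe.
- by apply: contra_neq xf' => h; rewrite -pe -perm_partM h perm_part0.
Qed.

(** Up to the scalar [t], composing with [u] and its flip identifies [End p] with the corner of
    [End n] whose unit is [t^-1 *: (u ** bflip u)]; primitive idempotents fixed by the flip are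
    carried along. *)
Lemma enough_fixed_primitives_transfer p n (u : H p n) (x : H n n) :
  bflip u ** u = t *: brauer_id K p -> x ** u != 0 ->
  (forall z : H p p, z != 0 ->
    exists f a, [/\ primitive (@brauer_comp K t p p p) f, bflip f = f & z ** a ** f != 0]) ->
  exists f a, [/\ primitive (@brauer_comp K t n n n) f, bflip f = f & x ** a ** f != 0].
Proof.
move=> vu1 xu IH.
have [v vE] : exists v, v = bflip u by exists (bflip u).
rewrite -vE in vu1; have uv : bflip v = u by rewrite vE bflipK.
have cancel_r q (y : H p q) : y != 0 -> y ** v != 0.
  apply: contra_neq => yv; have : y ** v ** u = t *: y.
    by rewrite -brauer_compA vu1 brauer_compZr brauer_comp1r.
  by rewrite yv brauer_comp0r => /esym/eqP; rewrite scaler_eq0 (negPf t0) => /eqP.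
have [a xuva] := sp (cancel_r _ _ xu).
pose z := v ** a ** x ** u.
have z0 : z != 0.
  apply: contra_neq xuva => z0.
  have -> : x ** u ** v ** a ** (x ** u ** v) = x ** u ** z ** v by rewrite /z !brauer_compA.
  by rewrite z0 brauer_compr0 brauer_comp0r.
have [f [b [[f0 ff fAf] sf zbf]]] := IH z z0.
pose f1 := t^-1 *: (u ** f ** v).
have vuK q (y : H q p) : v ** (u ** y) = t *: y.
  by rewrite brauer_compA vu1 brauer_compZl brauer_comp1l.
exists f1, (u ** b ** v); split.
- split.
  + apply: contra_neq f0 => f10.
    have : v ** f1 ** u = t *: f.
      rewrite /f1 brauer_compZr brauer_compZl -!brauer_compA vuK.
      by rewrite vu1 brauer_compZr brauer_comp1r scalerA mulVf// scale1r.
    rewrite f10 brauer_compr0 brauer_comp0r => /esym/eqP.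
    by rewrite scaler_eq0 (negPf t0) => /eqP.
  + rewrite /f1 brauer_compZl brauer_compZr -!brauer_compA vuK !brauer_compZr.
    by rewrite (brauer_compA f f) ff !scalerA -mulrA mulVf// mulr1.
  + move=> y _; have [m mE] := fAf (v ** y ** u) I; exists (t^-1 * m).
    rewrite /f1 !(brauer_compZl, brauer_compZr) !scalerA.
    have -> : u ** f ** v ** y ** (u ** f ** v) = u ** (f ** (v ** y ** u) ** f) ** v.
      by rewrite !brauer_compA.
    rewrite mE !(brauer_compZl, brauer_compZr) scalerA.
    by congr (_ *: _); rewrite mulrAC.
- by rewrite (linZ (@bflip_lin _ _)) !bflip_comp uv -vE sf brauer_compA.
- rewrite brauer_compZr scaler_eq0 invr_eq0 (negPf t0)/=.
  apply: contra_neq zbf => h.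
  have {}h : x ** (u ** (b ** f)) = 0.
    have : x ** (u ** b ** v) ** (u ** f ** v) ** u = 0 by rewrite h brauer_comp0r.
    rewrite -!brauer_compA vu1 !brauer_compZr vuK !brauer_compZr brauer_comp1r scalerA.
    by move/eqP; rewrite scaler_eq0 mulf_eq0 (negPf t0) => /eqP.
  by rewrite /z -!brauer_compA h !brauer_compr0.
Qed.

(** Strong induction on [n]. Either [x] annihilates all non-permutation diagrams, which is the group
    algebra case, or [x ** bd D] is nonzero for some [D] with a top pair. Then [x] does not kill the
    corresponding cup, and the problem moves to [n - 2]. *)
Lemma enough_fixed_primitives_End n (x : H n n) : x != 0 ->
  exists f a, [/\ primitive (@brauer_comp K t n n n) f, bflip f = f & x ** a ** f != 0].
Proof.
have [k nk] := ubnP n; elim: k => // k IH in n nk x *; move=> x0.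
have [h|/existsNP[D /not_implyP[nD xD]]] :=
    pselect (forall D, ~~ is_perm_diagram D -> x ** bd D = 0).
  have [|f [pf sf xf]] := enough_fixed_primitives_kills x0.
    move=> y /perm_part0P ->; apply: (etrans (lin_sum (brauer_comp_linr x) _ _ _)).
    apply: big1 => D nD; apply: (etrans (brauer_compZr _ _ _)).
    by rewrite (h D nD) scaler0.
  by exists f, (brauer_id K n); rewrite brauer_comp1r.
have [i [j' [ij BD]]] := not_perm_cup nD.
have [p np] : exists p, n = p.+2.
  move: i j' ij {BD}; case: n {nk x x0 D nD xD} => [[]|[|n]] //; last by exists n.
  by move=> i j; rewrite !ord1.
subst n.
have [j jE] : exists j, j' = lift i j.
  by move: ij; case: (unliftP i j') => [j ->|->]; [exists j|rewrite eqxx].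
rewrite {}jE in ij BD.
have [uvD lD] := compose_cap_cup BD.
have [vu lu] := compose_cup_cap i j.
pose u : H p p.+2 := bd (cup_diagram i j); pose v := bflip u.
have vE : v = bd (flip (cup_diagram i j)) by exact: bflip_basis.
have vu1 : v ** u = t *: brauer_id K p by rewrite vE brauer_comp_basis vu lu.
have uvD1 : u ** (v ** bd D) = t *: bd D.
  by rewrite vE brauer_comp_basis brauer_compZr brauer_comp_basis scalerA -exprD uvD lD.
have xu : x ** u != 0.
  apply/eqP => xu; apply: xD; apply/eqP.
  have : x ** (u ** (v ** bd D)) == 0 by rewrite brauer_compA xu brauer_comp0r.
  by rewrite uvD1 brauer_compZr scaler_eq0 (negPf t0).
apply: (enough_fixed_primitives_transfer vu1 xu); apply: IH.
by rewrite -ltnS; exact: leq_trans nk.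
Qed.

End GenericParameter.

End BrauerComposition.

(** * Direct sum decompositions *)

Section Karoubi.
Variables (K : numClosedFieldType) (t : K).
Local Notation "g ** f" := (brauer_comp t g f) (at level 40, left associativity).
Local Notation "g @@ f" := (add_mor_comp t g f) (at level 40, left associativity).

Lemma add_hom_ext (X Y : add_obj) (f g : add_hom K X Y) : (forall j i, f j i = g j i) -> f = g.
Proof.
by move=> fg; apply: functional_extensionality_dep => j; apply: functional_extensionality_dep.
Qed.

Lemma add_mor_compA (X Y Z W : add_obj) (h : add_hom K Z W) (g : add_hom K Y Z)
    (f : add_hom K X Y) : h @@ (g @@ f) = h @@ g @@ f.
Proof.
apply: add_hom_ext => j i; rewrite /add_mor_comp.
under eq_bigr do rewrite (lin_sum (brauer_comp_linr t _)).
under [RHS]eq_bigr do rewrite (lin_sum (brauer_comp_linl t _)).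
rewrite exchange_big/=; apply: eq_bigr => k _; apply: eq_bigr => l _.
exact: brauer_compA.
Qed.

Lemma add_mor_comp0r (X Y Z : add_obj) (f : add_hom K X Y) :
  add_mor0 K Y Z @@ f = add_mor0 K X Z.
Proof.
by apply: add_hom_ext => j i; apply: big1 => k _; exact: brauer_comp0r.
Qed.

Lemma add_mor_compr0 (X Y Z : add_obj) (g : add_hom K Y Z) :
  g @@ add_mor0 K X Y = add_mor0 K X Z.
Proof.
by apply: add_hom_ext => j i; apply: big1 => k _; exact: brauer_compr0.
Qed.

Lemma add_mor_comp_suml (X Y Z : add_obj) (k : nat) (g : 'I_k -> add_hom K Y Z)
    (f : add_hom K X Y) : add_mor_sum g @@ f = add_mor_sum (fun l => g l @@ f).
Proof.
apply: add_hom_ext => j i; rewrite /add_mor_comp /add_mor_sum.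
under eq_bigr do rewrite (lin_sum (brauer_comp_linl t _)).
by rewrite exchange_big.
Qed.

Lemma add_mor_comp_sumr (X Y Z : add_obj) (k : nat) (g : add_hom K Y Z)
    (f : 'I_k -> add_hom K X Y) : g @@ add_mor_sum f = add_mor_sum (fun l => g @@ f l).
Proof.
apply: add_hom_ext => j i; rewrite /add_mor_comp /add_mor_sum.
under eq_bigr do rewrite (lin_sum (brauer_comp_linr t _)).
by rewrite exchange_big.
Qed.

Lemma is_kar_morP (X Y : kar_obj t) (f : add_hom K (kar_carrier X) (kar_carrier Y)) :
  is_kar_mor f <-> kar_idem Y @@ f = f /\ f @@ kar_idem X = f.
Proof.
rewrite /is_kar_mor; split => [fE|[fY fX]]; last by rewrite fX fY.
by split; rewrite -fE -?add_mor_compA ?kar_idemP// !add_mor_compA ?kar_idemP.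
Qed.

Lemma add_mor_sum2 (X Y : add_obj) (f : 'I_2 -> add_hom K X Y) j i :
  add_mor_sum f j i = f ord0 j i + f (lift ord0 ord0) j i.
Proof. by rewrite /add_mor_sum big_ord_recl big_ord1. Qed.

Variable n : nat.
Local Notation mul := (@brauer_comp K t n n n).
Local Notation one := (brauer_id K n).
Local Notation bn := (bullet_obj n).

Definition bullet_mor (x : brauer_hom K n n) : add_hom K bn bn := fun _ _ => x.

Lemma bullet_morE (f : add_hom K bn bn) : f = bullet_mor (f ord0 ord0).
Proof. by apply: add_hom_ext => j i; rewrite !ord1. Qed.

Lemma bullet_mor_inj : injective bullet_mor.
Proof. by move=> x y /(congr1 (fun f : add_hom K bn bn => f ord0 ord0)). Qed.

Lemma bullet_mor_comp x y : bullet_mor x @@ bullet_mor y = bullet_mor (x ** y).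
Proof. by apply: add_hom_ext => j i; rewrite /add_mor_comp big_ord1. Qed.

Lemma bullet_mor0 : bullet_mor 0 = add_mor0 K bn bn.
Proof. by []. Qed.

Lemma bullet_mor_sum k (x : 'I_k -> brauer_hom K n n) :
  add_mor_sum (fun l => bullet_mor (x l)) = bullet_mor (\sum_l x l).
Proof. by []. Qed.

Lemma bullet_idem (x : brauer_hom K n n) : x ** x = x -> bullet_mor x @@ bullet_mor x = bullet_mor x.
Proof. by move=> xx; rewrite bullet_mor_comp xx. Qed.

Definition bullet_summand x (xx : x ** x = x) : kar_obj t := KarObj (bullet_idem xx).

Hypothesis sp : semiprime_End t n.

(** An idempotent [f] of the corner of [e] would split [Y] along [f] and [e - f], so it is [0] or
    [e]. The corner does contain an idempotent that is primitive in the split sense, and it must be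
    [e]. *)
Lemma summand_primitive (Y : kar_obj t) (i : add_hom K (kar_carrier Y) bn)
    (p : add_hom K bn (kar_carrier Y)) (e : brauer_hom K n n) :
  indecomposable Y -> @is_kar_mor K t Y (bullet_power t n) i ->
  @is_kar_mor K t (bullet_power t n) Y p ->
  p @@ i = kar_idem Y -> i @@ p = bullet_mor e -> primitive mul e.
Proof.
move=> [Y0 Yind] /is_kar_morP[_ ii] /is_kar_morP[pp _] pi ip.
have mulP := brauer_compP t n.
have ee : e ** e = e.
  apply: bullet_mor_inj; rewrite -bullet_mor_comp -ip add_mor_compA.
  by rewrite -(add_mor_compA i) pi ii.
have e0 : e != 0.
  apply/eqP => e0; apply: Y0; rewrite /kar_zero -(kar_idemP Y) -pi.
  rewrite add_mor_compA -(add_mor_compA p) ip e0 bullet_mor0.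
  by rewrite add_mor_compr0 add_mor_comp0r.
have idem_cases f : f ** f = f -> e ** f = f -> f ** e = f -> f = 0 \/ f = e.
  move=> ff ef fe.
  pose g (k : 'I_2) := if k == ord0 then f else e - f.
  have gg k : g k ** g k = g k.
    rewrite /g; case: ifP => // _.
    by rewrite (amulBl mulP) !(amulBr mulP) ee ef fe ff subrr subr0.
  have ge k : g k ** e = g k /\ e ** g k = g k.
    by rewrite /g; case: ifP => // _; rewrite (amulBl mulP) (amulBr mulP) ee ef fe.
  have g01 k l : k != l -> g k ** g l = 0.
    rewrite /g => kl; have [k0|k0] := eqVneq k ord0; have [l0|l0] := eqVneq l ord0.
    - by rewrite k0 l0 eqxx in kl.
    - by rewrite (amulBr mulP) fe ff subrr.
    - by rewrite (amulBl mulP) ef ff subrr.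
    - by move: k l k0 l0 kl => [[|[|k]] ?] [[|[|l]] ?].
  have [|k kz] := Yind (fun k => bullet_summand (gg k)).
    exists (fun k => p @@ bullet_mor (g k)), (fun k => bullet_mor (g k) @@ i).
    have gig k l : bullet_mor (g k) @@ i @@ (p @@ bullet_mor (g l)) = bullet_mor (g k ** g l).
      rewrite -add_mor_compA (add_mor_compA i) ip add_mor_compA !bullet_mor_comp.
      by have [-> _] := ge k.
    split.
    - move=> k; split; apply/is_kar_morP; split=> /=.
      + by rewrite add_mor_compA pp.
      + by rewrite -add_mor_compA bullet_mor_comp gg.
      + by rewrite add_mor_compA bullet_mor_comp gg.
      + by rewrite -add_mor_compA ii.
    - by move=> k; rewrite gig gg.
    - by move=> k l kl; rewrite gig g01.
    - have -> : (fun k => p @@ bullet_mor (g k) @@ (bullet_mor (g k) @@ i)) =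
          (fun k => p @@ bullet_mor (g k) @@ i).
        apply: functional_extensionality_dep => k.
        by rewrite add_mor_compA -(add_mor_compA p) bullet_mor_comp gg.
      rewrite -add_mor_comp_suml -add_mor_comp_sumr bullet_mor_sum.
      rewrite big_ord_recl big_ord1 /g/= addrC subrK -ip.
      by rewrite add_mor_compA pi -add_mor_compA pi kar_idemP.
  have : g k = 0 by apply: bullet_mor_inj; exact: kz.
  rewrite /g; case: ifP => _ h; first by left.
  by right; apply/eqP; rewrite eq_sym -subr_eq0 h.
pose C x := e ** x ** e = x.
have Cof x : C (e ** x ** e) by rewrite /C -!brauer_compA ee !brauer_compA ee.
have Ce x : C x -> e ** x = x /\ x ** e = x.
  by move=> <-; rewrite -!brauer_compA ee !brauer_compA ee.
have [|||||f [Cf [f0 ff fCf] _]] :=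
    @primitive_in_left_ideal K _ mul mulP C e _ _ _ _ (_ : C e) e0.
- by rewrite /C brauer_compr0 brauer_comp0r.
- by move=> a x y Cx Cy; rewrite /C brauer_comp_linr brauer_comp_linl Cx Cy.
- move=> x y /Ce[ex _] /Ce[_ ye]; by rewrite /C brauer_compA ex -brauer_compA ye.
- move=> x Cx x0; have [a xax] := sp x0; exists (e ** a ** e) => //.
  by have [ex xe] := Ce _ Cx; rewrite !brauer_compA xe -brauer_compA ex.
- by rewrite /C !ee.
have [ef fe] := Ce _ Cf.
have [fz|fE] := idem_cases f ff ef fe; first by rewrite fz eqxx in f0.
split => // a _; have [l lE] := fCf _ (Cof a); exists l.
by rewrite fE in lE; rewrite -lE !brauer_compA ee -[RHS]brauer_compA ee.
Qed.

(** The first of two terms gives an idempotent in the line spanned by [e], hence [0] or [e];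
    accordingly the first or the second term is zero. *)
Lemma primitive_indecomposable e (ee : e ** e = e) :
  primitive mul e -> indecomposable (bullet_summand ee).
Proof.
move=> [e0 _ eAe]; split.
  by move=> ez; move: e0; rewrite (bullet_mor_inj (ez : bullet_mor e = bullet_mor 0)) eqxx.
move=> Y [i [p [ip pi pi0 sum]]].
have zero k : i k @@ p k = add_mor0 K bn bn -> kar_zero (Y k).
  move=> h; rewrite /kar_zero -(kar_idemP (Y k)) -pi.
  by rewrite add_mor_compA -(add_mor_compA (p k)) h add_mor_compr0 add_mor_comp0r.
pose f := (i ord0 @@ p ord0 : add_hom K bn bn) ord0 ord0.
have fE : i ord0 @@ p ord0 = bullet_mor f by exact: bullet_morE.
have [/is_kar_morP[/= ei ie] /is_kar_morP[/= ep pe]] := ip ord0.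
have ff : f ** f = f.
  apply: bullet_mor_inj; rewrite -bullet_mor_comp -fE.
  by rewrite add_mor_compA -(add_mor_compA (i ord0)) pi ie.
have fef : e ** f ** e = f.
  apply: bullet_mor_inj; rewrite -!bullet_mor_comp -fE.
  by rewrite add_mor_compA ei -add_mor_compA pe.
have [l lE] := eAe f I; rewrite fef in lE.
have [l0|l0] := eqVneq l 0.
  by exists ord0; apply: zero; rewrite fE lE l0 scale0r.
have l1 : l = 1.
  have : l * (l - 1) == 0.
    rewrite mulrBr mulr1 subr_eq0; apply/eqP.
    have : (l * l - l) *: e == 0.
      have h := ff; rewrite lE brauer_compZl brauer_compZr ee scalerA in h.
      by rewrite scalerBl h subrr.
    by rewrite scaler_eq0 (negPf e0) orbF subr_eq0 => /eqP.
  by rewrite mulf_eq0 (negPf l0) subr_eq0 => /eqP.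
exists (lift ord0 ord0); apply: zero; rewrite [LHS]bullet_morE -bullet_mor0; congr bullet_mor.
have := congr1 (fun f : add_hom K bn bn => f ord0 ord0) sum.
rewrite add_mor_sum2 /= -/f lE l1 scale1r => h.
by apply: (addrI e); rewrite addr0.
Qed.

Lemma has_num_summandsP k : has_num_summands t n k <->
  exists e : 'I_k -> brauer_hom K n n, complete_primitive_family mul one e.
Proof.
split=> [[Y [[i [p [ip pi pi0 sum]]] Yind]]|[e [pe orth e1]]].
  pose e l := (i l @@ p l : add_hom K bn bn) ord0 ord0.
  have eE l : i l @@ p l = bullet_mor (e l) by exact: bullet_morE.
  exists e; split.
  - by move=> l; have [il pl] := ip l; exact: summand_primitive (Yind l) il pl (pi l) (eE l).
  - move=> l m lm; apply: bullet_mor_inj; rewrite -bullet_mor_comp -!eE.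
    rewrite add_mor_compA -(add_mor_compA (i l)) pi0// add_mor_compr0.
    by rewrite add_mor_comp0r.
  - apply: bullet_mor_inj; rewrite -bullet_mor_sum.
    by rewrite (_ : (fun l => bullet_mor (e l)) = fun l => i l @@ p l)//;
      apply: functional_extensionality_dep => l; rewrite eE.
have ee l : e l ** e l = e l by case: (pe l).
exists (fun l => bullet_summand (ee l)); split; last first.
  by move=> l; exact: primitive_indecomposable.
exists (fun l => bullet_mor (e l)), (fun l => bullet_mor (e l)); split.
- by move=> l; split; apply/is_kar_morP; split; rewrite /= bullet_mor_comp ?ee ?brauer_comp1l ?brauer_comp1r.
- by move=> l; rewrite bullet_mor_comp ee.
- by move=> l m lm; rewrite bullet_mor_comp orth.
- rewrite -[RHS]/(bullet_mor one) -e1 -bullet_mor_sum; congr add_mor_sum.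
  by apply: functional_extensionality_dep => l; rewrite bullet_mor_comp ee.
Qed.

End Karoubi.

Definition num_symmetric_diagrams (n : nat) : nat := #|[set D : diagram n n | flip D == D]|.

(** Existence comes from the fixed family, its size from the trace of the flip, and uniqueness from
    the invariance of the size of complete families. *)
Lemma generic_num_summands (K : numClosedFieldType) (t : K) : generic t ->
  forall n k, has_num_summands t n k <-> k = num_symmetric_diagrams n.
Proof.
move=> gt n k; have sp m : semiprime_End t m by exact: semisimple_semiprime.
rewrite (has_num_summandsP (sp n)).
have [b [e [ce se]]] := @fixed_complete_family K _ _ _ (brauer_compP t n)
  (@brauer_comp1l K t n n) (@brauer_comp1r K t n n) (sp n) _ (@bflip_lin K n n)
  (@bflipK K n n) (@bflip_comp K t n n n) (@enough_fixed_primitives_End K t sp n).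
have bE : b = num_symmetric_diagrams n.
  have := trace_involution (brauer_compP t n) (@brauer_comp1l K t n n)
    (@brauer_comp1r K t n n) (@bflip_lin K n n) (@bflip_comp K t n n n) ce se.
  rewrite /trace => h; apply/eqP; rewrite -(eqr_nat K) -h.
  rewrite /num_symmetric_diagrams -sum1_card natr_sum [in eqbRHS]big_mkcond/=; apply/eqP.
  apply: eq_bigr => D _; rewrite bflip_basis ffunE inE eq_sym.
  by case: eqP.
rewrite -bE; split=> [[e' ce']|->]; last by exists e.
exact: (complete_primitive_family_size (brauer_compP t n) (@brauer_comp1l K t n n) (sp n) ce' ce).
Qed.

(** * Counting symmetric diagrams *)

Fixpoint brauer_count (n : nat) : nat :=
  if n is n1.+1 then
    if n1 is n2.+1 then (brauer_count n1 + 2 * n1 * brauer_count n2)%N else 1%N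
  else 1%N.

Lemma brauer_countSS n :
  brauer_count n.+2 = (brauer_count n.+1 + 2 * n.+1 * brauer_count n)%N.
Proof. by []. Qed.

Section SymmetricMatchings.
Variables (T : finType) (tau : T -> T).
Hypotheses (tauK : involutive tau) (tau_neq : forall x, tau x != x).
Implicit Types (S W : {set T}) (P Q : {set {set T}}).

(** Matchings of a subset [S] rather than of a type, so that points can be deleted in the
    recursion. *)
Definition symmetric_matching S P :=
  [&& partition P S, [forall B in P, #|B| == 2%N] & [forall B in P, tau @: (B : {set T}) \in P]].

Definition stable S := forall x, x \in S -> tau x \in S.

Lemma symmetric_matchingP S P :
  reflect [/\ partition P S, forall B, B \in P -> #|B| = 2%N
            & forall B, B \in P -> tau @: B \in P] (symmetric_matching S P).
Proof.
apply: (iffP and3P) => -[pP h2 hs]; split=> //.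
- by move=> B /(forall_inP h2)/eqP.
- by move=> B /(forall_inP hs).
- by apply/forall_inP => B /h2/eqP.
- exact/forall_inP.
Qed.

(** Removing the pairs of [Q] is inverse to adding them, and symmetry survives because [Q] is itself
    closed under [tau]. *)
Lemma card_extensions S W Q : W \subset S -> symmetric_matching W Q ->
  #|[set P | symmetric_matching S P && (Q \subset P)]| =
  #|[set P | symmetric_matching (S :\: W) P]|.
Proof.
move=> WS /symmetric_matchingP[pQ Q2 Qs].
have disj P B : symmetric_matching (S :\: W) P -> B \in P -> B \notin Q.
  move=> /symmetric_matchingP[pP _ _] BP; apply/negP => BQ.
  have /set0Pn[x xB] := partition_neq0 pQ BQ.
  have := subsetP (partitionS pP BP) x xB.
  by rewrite inE (subsetP (partitionS pQ BQ) x xB).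
rewrite -[RHS](@card_in_imset _ _ (fun P => P :|: Q)); last first.
  move=> P P'; rewrite !inE => mP mP' PP'; apply/setP => B.
  have := congr1 (fun A : {set {set T}} => B \in A) PP'; rewrite !inE.
  have [BQ|_] := boolP (B \in Q); last by rewrite !orbF.
  have nB P1 : symmetric_matching (S :\: W) P1 -> (B \in P1) = false.
    by move=> m1; apply/negP => /(disj _ _ m1); rewrite BQ.
  by rewrite !nB.
apply: eq_card => P; rewrite inE; apply/andP/imsetP.
  move=> [/symmetric_matchingP[pP P2 Ps] QP]; exists (P :\: Q); last first.
    apply/setP => B; rewrite !inE; have := subsetP QP B.
    by case: (B \in Q) => //= [->//|_]; rewrite orbF.
  rewrite inE; apply/symmetric_matchingP; split.
  - apply: partitionI.
    + move=> x; rewrite inE => /andP[xW xS].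
      have : x \in cover P by rewrite (cover_partition pP).
      move=> /bigcupP[B BP xB]; exists B => //; rewrite inE BP andbT.
      by apply: contra xW => BQ; exact: subsetP (partitionS pQ BQ) x xB.
    + move=> B x; rewrite !inE => /andP[BQ BP] xB.
      rewrite (subsetP (partitionS pP BP) x xB) andbT.
      apply: contra BQ => xW.
      have : x \in cover Q by rewrite (cover_partition pQ).
      move=> /bigcupP[B' B'Q xB'].
      by rewrite (partition_block pP BP (subsetP QP _ B'Q) xB xB').
    + move=> B B' x; rewrite !inE => /andP[_ BP] /andP[_ B'P].
      exact: partition_block pP BP B'P.
    + by move=> B; rewrite inE => /andP[_ /(partition_neq0 pP)/set0Pn].
  - by move=> B; rewrite inE => /andP[_ /P2].
  - move=> B; rewrite !inE => /andP[BQ BP]; rewrite Ps// andbT.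
    apply: contra BQ => /Qs; rewrite -imset_comp.
    by rewrite (eq_imset _ (_ : tau \o tau =1 id)) ?imset_id.
move=> [P']; rewrite inE => mP' ->; split; last by apply/subsetP => B BQ; rewrite inE BQ orbT.
have /symmetric_matchingP[pP' P2 Ps] := mP'.
apply/symmetric_matchingP; split.
- apply: partitionI.
  + move=> x xS; have [xW|xW] := boolP (x \in W).
      have : x \in cover Q by rewrite (cover_partition pQ).
      by move=> /bigcupP[B BQ xB]; exists B => //; rewrite inE BQ orbT.
    have : x \in cover P' by rewrite (cover_partition pP') inE xW.
    by move=> /bigcupP[B BP xB]; exists B => //; rewrite inE BP.
  + move=> B x; rewrite inE => /orP[BP|BQ] xB.
      by have := subsetP (partitionS pP' BP) x xB; rewrite inE => /andP[].
    exact/(subsetP WS)/(subsetP (partitionS pQ BQ)).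
  + have cross B B' x : B \in P' -> B' \in Q -> x \in B -> x \in B' -> False.
      move=> BP BQ xB xB'; have := subsetP (partitionS pP' BP) x xB.
      by rewrite inE (subsetP (partitionS pQ BQ) x xB').
    move=> B B' x; rewrite !inE => /orP[BP|BQ] /orP[B'P|B'Q] xB xB'.
    * exact: partition_block pP' BP B'P xB xB'.
    * by case: (cross B B' x).
    * by case: (cross B' B x).
    * exact: partition_block pQ BQ B'Q xB xB'.
  + by move=> B; rewrite inE => /orP[/(partition_neq0 pP')|/(partition_neq0 pQ)]/set0Pn.
- by move=> B; rewrite inE => /orP[/P2|/Q2].
- by move=> B; rewrite !inE => /orP[/Ps ->|/Qs ->]; rewrite ?orbT.
Qed.

Lemma stableD S W : stable S -> stable W -> stable (S :\: W).
Proof.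
move=> sS sW x; rewrite !inE => /andP[xW xS]; rewrite sS// andbT.
by apply: contra xW => /sW; rewrite tauK.
Qed.

Lemma imset_pair x y : tau @: [set x; y] = [set tau x; tau y].
Proof. by rewrite imsetU !imset_set1. Qed.

Lemma card_set4 x z : z != x -> z != tau x ->
  #|[set x; z] :|: [set tau x; tau z]| = 4%N.
Proof.
move=> zx ztx; have tinj := can_inj tauK.
rewrite cardsU !cards2 (inj_eq tinj) (eq_sym x) zx.
rewrite (_ : _ :&: _ = set0) ?cards0//; apply/setP => w; rewrite !inE.
apply/negbTE/negP => /andP[/orP[]/eqP-> /orP[]].
- by rewrite eq_sym (negPf (tau_neq x)).
- by rewrite -(inj_eq tinj) tauK eq_sym (negPf ztx).
- by rewrite (negPf ztx).
- by rewrite eq_sym (negPf (tau_neq z)).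
Qed.

(** Matchings are sorted by the partner [z] of a point [x]. The choice [z = tau x] uses two points;
    each of the [#|S| - 2] others forces the mirror pair as well and uses four. *)
Lemma card_symmetric_matchings n S : stable S -> #|S| = (2 * n)%N ->
  #|[set P | symmetric_matching S P]| = brauer_count n.
Proof.
have tinj := can_inj tauK.
have [k nk] := ubnP n; elim: k => // k IH in n nk S *; move=> sS cS.
case: n nk cS => [|n] nk cS.
  have {cS}-> : S = set0 by apply/eqP; rewrite -cards_eq0 cS.
  transitivity #|[set (set0 : {set {set T}})]|; last by rewrite cards1.
  apply: eq_card => P; rewrite !inE; apply/symmetric_matchingP/eqP => [[]|->].
    by rewrite partition_set0 => /eqP.
  by split=> [|B|B]; rewrite ?partition_set0// inE.
have /card_gt0P[x xS] : (0 < #|S|)%N by rewrite cS.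
have txS := sS x xS.
pose A z := [set P | symmetric_matching S P && ([set x; z] \in P)].
have cA : #|[set P | symmetric_matching S P]| = (\sum_(z in S :\ x) #|A z|)%N.
  transitivity (\sum_(P | symmetric_matching S P) \sum_(z in S :\ x) ([set x; z] \in P))%N.
    rewrite -sum1_card; under eq_bigl do rewrite inE.
    apply: eq_bigr => P /symmetric_matchingP[pP P2 _].
    have : x \in cover P by rewrite (cover_partition pP).
    move=> /bigcupP[B BP xB]; have [z zB zx] := pair_other (P2 B BP) xB.
    have BE : B = [set x; z] by apply: pair_block; rewrite ?P2// eq_sym.
    rewrite (bigD1 z)/=; last by rewrite !inE zx (subsetP (partitionS pP BP)).
    rewrite -BE BP big1 ?addn0// => y /andP[yS yz].
    case: (boolP (_ \in P)) => // xyP; case/eqP: yz.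
    have := partition_block pP BP xyP xB (set21 _ _).
    move=> /setP/(_ z); rewrite zB !inE (negPf zx)/= => /esym/eqP ->//.
  rewrite exchange_big/=; apply: eq_bigr => z _.
  rewrite -sum1_card [RHS]big_mkcond/= [LHS]big_mkcond/=; apply: eq_bigr => P _.
  by rewrite inE; case: symmetric_matching => //; case: (_ \in P).
have cT : #|S :\: [set x; tau x]| = (2 * n)%N.
  rewrite cardsD (setIidPr _); last by apply/subsetP => w /set2P[]->.
  by rewrite cS cards2 (eq_sym x) tau_neq; lia.
have A1 : #|A (tau x)| = brauer_count n.
  rewrite -(IH n _ (S :\: [set x; tau x])) //; last first.
    by apply: stableD => // w /set2P[]->; rewrite ?tauK ?set21 ?set22.
  rewrite -(@card_extensions S [set x; tau x] [set [set x; tau x]]).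
  - by apply: eq_card => P; rewrite !inE sub1set.
  - by apply/subsetP => w /set2P[]->.
  apply/symmetric_matchingP; split.
  - apply: partitionI.
    + by move=> w wx; exists [set x; tau x]; rewrite ?set11.
    + by move=> B w /set1P ->.
    + by move=> B B' w /set1P -> /set1P ->.
    + by move=> B /set1P ->; exists x; rewrite set21.
  - by move=> B /set1P ->; rewrite cards2 (eq_sym x) tau_neq.
  - by move=> B /set1P ->; rewrite imset_pair tauK setUC set11.
(* The truncated [n.-1] is harmless: such a [z] exists only if [n] is positive. *)
have A2 z : z \in S :\: [set x; tau x] -> #|A z| = brauer_count n.-1.
  rewrite !inE negb_or => /andP[/andP[zx ztx] zS].
  pose W := [set x; z] :|: [set tau x; tau z].
  have tzS := sS z zS.
  have WS : W \subset S.
    by apply/subsetP => w; rewrite !inE => /orP[]/orP[]/eqP->.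
  have sW : stable W.
    by move=> w; rewrite !inE => /orP[]/orP[]/eqP->; rewrite ?tauK ?eqxx ?orbT.
  have cW : #|S :\: W| = (2 * n.-1)%N.
    have cW4 := card_set4 zx ztx.
    rewrite cardsD (setIidPr WS) cW4.
    have : (4 <= #|S|)%N by rewrite -cW4 subset_leq_card.
    rewrite cS; lia.
  rewrite -(IH n.-1 _ (S :\: W)) //; last 2 first.
  - lia.
  - exact: stableD.
  pose Q := [set [set x; z]; [set tau x; tau z]].
  have mQ : symmetric_matching W Q.
    apply/symmetric_matchingP; split.
    - apply: partitionI.
      + move=> w; rewrite inE => /orP[] h.
          by exists [set x; z]; rewrite ?set21.
        by exists [set tau x; tau z]; rewrite ?set22.
      + by move=> B w /set2P[]-> h; rewrite inE h ?orbT.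
      + have c0 : [set x; z] :&: [set tau x; tau z] = set0.
          apply/eqP; rewrite -cards_eq0 -(eqn_add2l 4) -{1}(card_set4 zx ztx) cardsUI.
          by rewrite !cards2 (inj_eq tinj) (eq_sym x) zx.
        have no w : w \in [set x; z] -> w \in [set tau x; tau z] -> False.
          by move=> h1 h2; have := in_set0 w; rewrite -c0 inE h1 h2.
        by move=> B B' w /set2P[]-> /set2P[]-> // h1 h2; case: (no w).
      + by move=> B /set2P[]->; [exists x|exists (tau x)]; rewrite set21.
    - by move=> B /set2P[]->; rewrite cards2 ?(inj_eq tinj) (eq_sym x) zx.
    - by move=> B /set2P[]->; rewrite imset_pair ?tauK ?set21 ?set22.
  rewrite -(card_extensions WS mQ).
  apply: eq_card => P; rewrite !inE; apply: andb_id2l => /symmetric_matchingP[_ _ Ps].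
  rewrite subUset !sub1set; apply/idP/andP => [h|[]//]; split=> //.
  by rewrite -imset_pair; exact: Ps.
rewrite cA (bigD1 (tau x))/=; last by rewrite !inE tau_neq.
rewrite A1 (eq_bigl (mem (S :\: [set x; tau x]))); last first.
  by move=> z; rewrite !inE negb_or -andbA; case: (z == x) => //=; rewrite andbC.
rewrite (eq_bigr _ A2) sum_nat_const cT.
by case: n {nk cS cT A1 A2} => [|n] //=; rewrite muln0 mul0n addn0.
Qed.

End SymmetricMatchings.

Lemma num_symmetric_diagramsE n : num_symmetric_diagrams n = brauer_count n.
Proof.
rewrite /num_symmetric_diagrams.
have neq z : @swap n n z != z by case: z.
rewrite -(@card_symmetric_matchings _ (@swap n n) (@swapK n n) neq n [set: _]); first last.
- by rewrite cardsT card_sum card_ord; lia.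
- by [].
rewrite -(card_imset (mem [set D : diagram n n | flip D == D]) val_inj).
apply: eq_card => P; rewrite !inE; apply/imsetP/symmetric_matchingP.
  move=> [D]; rewrite inE => /eqP fD ->; have mD := valP D.
  split; first exact: perfect_matching_partition.
    by move=> B BD; exact: perfect_matching_card mD BD.
  by move=> B BD; rewrite -fD /=; exact: imset_f.
move=> [pP P2 Ps].
have mP : perfect_matching P.
  by rewrite /perfect_matching pP; apply/forall_inP => B /P2/eqP.
exists (Sub P mP) => //; rewrite inE; apply/eqP/val_inj => /=.
apply/setP => B; apply/imsetP/idP => [[B' B'P ->]|BP]; first exact: Ps.
exists (@swap n n @: B); first exact: Ps.
by rewrite -imset_comp (eq_imset _ (_ : _ =1 id)) ?imset_id// => z; exact: swapK.
Qed.

(** * Generating function and asymptotics *)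

Local Open Scope classical_set_scope.
Local Open Scope ring_scope.

Section ExponentialGeneratingFunction.
Variable R : realType.

Definition brauer_coeff (n : nat) : R := (brauer_count n)%:R / n`!%:R.

Lemma fact_neq0 n : n`!%:R != 0 :> R.
Proof. by rewrite pnatr_eq0 -lt0n fact_gt0. Qed.

Lemma brauer_coeff_rec n :
  n.+2%:R * brauer_coeff n.+2 = brauer_coeff n.+1 + 2 * brauer_coeff n.
Proof.
rewrite /brauer_coeff brauer_countSS !factS natrD !natrM.
have h0 := fact_neq0 n.
have h1 : n.+1%:R != 0 :> R by rewrite pnatr_eq0.
have h2 : n.+2%:R != 0 :> R by rewrite pnatr_eq0.
move: (n`!%:R) (n.+1%:R) (n.+2%:R) h0 h1 h2 => f u v f0 u0 v0.
by field; rewrite f0 u0 v0.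
Qed.

(** The contribution of [x^(2k) / k!] to the coefficient of [x^n] in the product of the series of
    [exp(x^2)] and [exp(x)]. *)
Definition brauer_term (n k : nat) : R :=
  if (k.*2 <= n)%N then (k`!%:R * (n - k.*2)`!%:R)^-1 else 0.

(** Split [n + 2] as [2 k + (n + 2 - 2 k)]: the first summand cancels into [k!], the second into the
    other factorial. *)
Lemma brauer_term_rec n k :
  n.+2%:R * brauer_term n.+2 k =
  2 * (if k is k1.+1 then brauer_term n k1 else 0) + brauer_term n.+1 k.
Proof.
rewrite /brauer_term; case: k => [|k].
  have n2 : n.+2%:R != 0 :> R by rewrite pnatr_eq0.
  rewrite !double0 !leq0n mulr0 add0r !subn0 fact0 !mul1r (factS n.+1) natrM invfM.
  by rewrite mulrA divff// mul1r.
rewrite doubleS !ltnS; case: (leqP k.*2 n) => [kn|nk]; last first.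
  by rewrite ltnNge (ltnW nk) /= !mulr0 addr0.
have [r ->] : exists r, n = (k.*2 + r)%N by exists (n - k.*2)%N; rewrite subnKC.
have -> : ((k.*2 + r).+2 - k.*2.+2 = r)%N by lia.
have -> : (k.*2 + r - k.*2 = r)%N by lia.
have -> : ((k.*2 + r).+1 - k.*2.+2 = r.-1)%N by lia.
have -> : (k.*2 < k.*2 + r)%N = (0 < r)%N by lia.
have -> : (k.*2 + r).+2%:R = 2 * k.+1%:R + r%:R :> R.
  by rewrite -natrM -natrD; congr _%:R; lia.
rewrite factS natrM.
have h0 := fact_neq0 k; have h1 : k.+1%:R != 0 :> R by rewrite pnatr_eq0.
case: r => [|r] /=.
  rewrite !addr0 fact0 !mulr1.
  move: (k`!%:R) (k.+1%:R) h0 h1 => a b a0 b0.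
  by field; rewrite a0 b0.
rewrite factS natrM; have h2 := fact_neq0 r.
have h3 : r.+1%:R != 0 :> R by rewrite pnatr_eq0.
move: (k`!%:R) (k.+1%:R) (r`!%:R) (r.+1%:R) h0 h1 h2 h3 => a b c d a0 b0 c0 d0.
by field; rewrite a0 b0 c0 d0.
Qed.

Lemma brauer_term_sum_widen n M : (n < M)%N ->
  \sum_(k < M) brauer_term n k = \sum_(k < n.+1) brauer_term n k.
Proof.
move=> nM; have -> : M = (n.+1 + (M - n.+1))%N by rewrite subnKC.
elim: (M - n.+1)%N => [|d IH]; first by rewrite addn0.
rewrite addnS big_ord_recr/= IH /brauer_term ifF ?addr0//; apply/negbTE.
rewrite -ltnNge -addnn; lia.
Qed.

Lemma brauer_coeffE n M : (n < M)%N -> brauer_coeff n = \sum_(k < M) brauer_term n k.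
Proof.
move=> nM; rewrite brauer_term_sum_widen// {nM M}.
suff : brauer_coeff n = \sum_(k < n.+1) brauer_term n k /\
       brauer_coeff n.+1 = \sum_(k < n.+2) brauer_term n.+1 k by case.
elim: n => [|n [IH1 IH2]].
  rewrite /brauer_coeff /brauer_term !big_ord_recl !big_ord0 /=.
  by rewrite !subn0 !fact0 (factS 0) fact0 !mul1r !addr0 mulr1n invr1.
split=> //; have n2 : n.+2%:R != 0 :> R by rewrite pnatr_eq0.
apply: (mulfI n2); rewrite brauer_coeff_rec IH1 IH2 [RHS]mulr_sumr.
under [RHS]eq_bigr do rewrite brauer_term_rec.
rewrite big_split/= -mulr_sumr [RHS]addrC; congr (_ + _ * _).
  by rewrite [RHS]brauer_term_sum_widen.
by rewrite [RHS]big_ord_recl add0r [RHS]brauer_term_sum_widen.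
Qed.

Definition exp_sum (x : R) (N : nat) : R := \sum_(k < N) x ^+ k / k`!%:R.

Lemma cvg_exp_sum x : exp_sum x @ \oo --> expR x.
Proof.
have -> : exp_sum x = series (exp_coeff x).
  by apply/funext => N; rewrite /exp_sum /series/= big_mkord.
exact: is_cvg_series_exp_coeff.
Qed.

Lemma exp_sum_nondecreasing x : 0 <= x -> nondecreasing_seq (exp_sum x).
Proof.
move=> x0; apply/nondecreasing_seqP => N; rewrite /exp_sum big_ord_recr/= lerDl.
by rewrite divr_ge0// exprn_ge0.
Qed.

Lemma exp_sum_le x N : 0 <= x -> exp_sum x N <= expR x.
Proof.
move=> x0; have cvgE := @cvg_exp_sum x; rewrite -(cvg_lim _ cvgE)//.
by apply: nondecreasing_cvgn_le; [exact: exp_sum_nondecreasing|apply/cvg_ex; exists (expR x)].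
Qed.

Lemma sum_shift (g : nat -> R) p N :
  \sum_(n < N) (if (p <= n)%N then g (n - p)%N else 0) =
  \sum_(j < N) (if (p + j < N)%N then g j else 0).
Proof.
elim: p N => [|p IH] N.
  by apply: eq_bigr => j _; rewrite /= subn0 ltn_ord.
case: N => [|N]; first by rewrite !big_ord0.
rewrite big_ord_recl [RHS]big_ord_recr/=.
have -> : (p.+1 + N < N.+1)%N = false by lia.
by rewrite add0r addr0 -IH; apply: eq_bigr => n _; rewrite /bump/= add1n ltnS subSS.
Qed.

Lemma sum_brauer_coeff x N :
  \sum_(n < N) brauer_coeff n * x ^+ n =
  \sum_(k < N) \sum_(j < N)
    if (k.*2 + j < N)%N then (x ^+ 2) ^+ k / k`!%:R * (x ^+ j / j`!%:R) else 0.
Proof.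
under eq_bigr => n _ do rewrite (brauer_coeffE (ltn_ord n)) mulr_suml.
rewrite exchange_big/=; apply: eq_bigr => k _.
rewrite -(sum_shift (fun j => (x ^+ 2) ^+ k / k`!%:R * (x ^+ j / j`!%:R))).
apply: eq_bigr => n _; rewrite /brauer_term; case: ifP => kn; last by rewrite mul0r.
rewrite -{2}(subnKC kn) exprD -muln2 mulnC exprM invfM.
by rewrite mulrACA; congr (_ * _); rewrite mulrC.
Qed.

(** The partial sum runs over the triangle [2 k + j < N], which contains the square of side [M] and
    lies in the square of side [N]. So the difference is at most the sum of absolute values over the
    larger square outside the smaller one. *)
Lemma sum_brauer_coeff_box x N M : (3 * M <= N)%N ->
  `|\sum_(n < N) brauer_coeff n * x ^+ n - exp_sum (x ^+ 2) M * exp_sum x M| <=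
  exp_sum (x ^+ 2) N * exp_sum `|x| N - exp_sum (x ^+ 2) M * exp_sum `|x| M.
Proof.
move=> MN; have lMN : (M <= N)%N by lia.
pose w k := (x ^+ 2) ^+ k / k`!%:R : R.
pose v y j := y ^+ j / j`!%:R : R.
have w0 k : 0 <= w k by rewrite divr_ge0// exprn_ge0// sqr_ge0.
have box y : exp_sum (x ^+ 2) M * exp_sum y M =
    \sum_(k < N) \sum_(j < N) if (k < M)%N && (j < M)%N then w k * v y j else 0.
  rewrite /exp_sum (big_ord_widen N (fun k => (x ^+ 2) ^+ k / k`!%:R) lMN).
  rewrite (big_ord_widen N (fun k => y ^+ k / k`!%:R) lMN) big_distrlr/=.
  rewrite big_mkcond/=; apply: eq_bigr => k _; case: ifP => kM /=; last by rewrite big1.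
  by rewrite big_mkcond.
have full y : exp_sum (x ^+ 2) N * exp_sum y N = \sum_(k < N) \sum_(j < N) w k * v y j.
  by rewrite /exp_sum big_distrlr.
rewrite sum_brauer_coeff !box full -!sumrB.
apply: le_trans (ler_norm_sum _ _ _) _; apply: ler_sum => k _; rewrite -!sumrB.
apply: le_trans (ler_norm_sum _ _ _) _; apply: ler_sum => j _.
have vE : `|w k * v x j| = w k * v `|x| j.
  by rewrite normrM (ger0_norm (w0 k)) /v normrM normfV normrX (@ger0_norm _ j`!%:R).
have p0 : 0 <= w k * v `|x| j by rewrite -vE.
case: (ltnP k M) => kM; case: (ltnP j M) => jM /=; rewrite ?subr0.
- by rewrite ifT ?subrr ?normr0//; lia.
- by case: ifP; rewrite -/(w k) -/(v x j) ?vE// normr0.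
- by case: ifP; rewrite -/(w k) -/(v x j) ?vE// normr0.
- by case: ifP; rewrite -/(w k) -/(v x j) ?vE// normr0.
Qed.

Lemma cvg_divn3 : (fun N => N %/ 3)%N @ \oo --> \oo.
Proof.
apply/cvgnyPge => A; exists (3 * A)%N => // N /=; rewrite leq_divRL// mulnC; lia.
Qed.

Lemma brauer_count_egf (x : R) :
  pseries (fun n : nat => (brauer_count n)%:R / (n`!)%:R) x @ \oo --> expR (x ^+ 2 + x).
Proof.
have -> : pseries (fun n : nat => (brauer_count n)%:R / (n`!)%:R) x =
    (fun N => \sum_(n < N) brauer_coeff n * x ^+ n).
  by apply/funext => N; rewrite /pseries /series/= big_mkord.
have c3 y : (fun N => exp_sum y (N %/ 3)%N) @ \oo --> expR y.
  by apply: (cvg_comp _ _ cvg_divn3); exact: cvg_exp_sum.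
have small : (fun N => exp_sum (x ^+ 2) N * exp_sum `|x| N -
    exp_sum (x ^+ 2) (N %/ 3)%N * exp_sum `|x| (N %/ 3)%N) @ \oo --> (0 : R).
  rewrite -(subrr (expR (x ^+ 2) * expR `|x|)).
  by apply: cvgB; apply: cvgM => //; exact: cvg_exp_sum.
pose S N := \sum_(n < N) brauer_coeff n * x ^+ n.
pose B N := exp_sum (x ^+ 2) (N %/ 3)%N * exp_sum x (N %/ 3)%N.
have SB : (fun N => S N - B N) @ \oo --> (0 : R).
  apply/norm_cvg0P; apply: squeeze_cvgr (cvg_cst 0) small.
  near=> N; rewrite normr_ge0/=; apply: sum_brauer_coeff_box.
  by rewrite mulnC leq_divM.
have -> : (fun N => \sum_(n < N) brauer_coeff n * x ^+ n) = (fun N => (S N - B N) + B N).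
  by apply/funext => N; rewrite subrK.
rewrite -[expR _]add0r expRD; apply: cvgD => //.
by apply: cvgM.
Unshelve. all: by end_near. Qed.

End ExponentialGeneratingFunction.

(** * Falling factorials against powers *)

Section BrauerAsymptotics.
Variable R : realType.

Lemma cvg_even_odd (u : nat -> R) (l : R) :
  u (m.*2) @[m --> \oo] --> l -> u (m.*2.+1) @[m --> \oo] --> l -> u @ \oo --> l.
Proof.
move=> ue uo; apply/cvgrPdist_le => e e0.
have /cvgrPdist_le/(_ e e0)[N1 _ H1] := ue.
have /cvgrPdist_le/(_ e e0)[N2 _ H2] := uo.
exists (maxn N1 N2).*2.+1 => // n /= Nn.
have [h1 h2] : (N1 <= n./2)%N /\ (N2 <= n./2)%N by split; lia.
by rewrite -(odd_double_half n); case: (odd n) => /=; [exact: H2|exact: H1].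
Qed.

Definition falling_ratio (m J : nat) : R := (m ^_ J./2)%:R / m%:R ^+ J./2.

Lemma sum_parity (m : nat) (p : bool) (G : nat -> R) :
  \sum_(J < (m.*2 + p).+1) (odd J == p)%:R * G J = \sum_(j < m.+1) G (j.*2 + p)%N.
Proof.
elim: m => [|m IH].
  by case: p; rewrite !big_ord_recl !big_ord0 /= ?mul0r ?mul1r ?add0r ?addr0.
have -> : (m.+1.*2 + p = (m.*2 + p).+2)%N by rewrite doubleS.
rewrite 2!big_ord_recr [RHS]big_ord_recr/= IH oddD odd_double/= oddb.
rewrite doubleS -!addrA; congr (_ + _); rewrite negbK eqxx mul1r.
by case: p {IH}; rewrite /= mul0r add0r.
Qed.

(** In [brauer_coeffE] put [k = m - j] and [J = 2 j + p]: then [m! / (m - j)!] is a falling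
    factorial, and [l^2 = m] turns [l^J] into [m^j l^p]. The parity indicator and the vanishing of
    [m ^_ j] for [j > m] let [J] run over any long range. *)
Lemma falling_sum (m : nat) (p : bool) (N : nat) : (0 < m)%N -> (m.*2 + p < N)%N ->
  let l := Num.sqrt m%:R : R in
  m`!%:R * l ^+ p * brauer_coeff R (m.*2 + p) =
  \sum_(J < N) (odd J == p)%:R * (falling_ratio m J * (l ^+ J / J`!%:R)).
Proof.
move=> m0 nN l; set n := (m.*2 + p)%N.
have l2 : l ^+ 2 = m%:R by rewrite sqr_sqrtr.
have mr0 : m%:R != 0 :> R by rewrite pnatr_eq0 -lt0n.
transitivity (\sum_(J < n.+1) (odd J == p)%:R * (falling_ratio m J * (l ^+ J / J`!%:R))); last first.
  rewrite -(subnKC nN); elim: (N - n.+1)%N => [|d IH]; first by rewrite addn0.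
  rewrite addnS [RHS]big_ord_recr/= -IH; case: eqP => [pE|_]; last by rewrite mul0r addr0.
  rewrite /falling_ratio ffact_small ?mul0r ?mulr0 ?addr0//.
  by move: pE; rewrite /n; case: p {n nN IH}; lia.
rewrite [RHS](sum_parity m p (fun J => falling_ratio m J * (l ^+ J / J`!%:R))).
rewrite (brauer_coeffE R (ltnSn n)).
have -> : \sum_(k < n.+1) brauer_term R n k = \sum_(k < m.+1) brauer_term R n k.
  have -> : n.+1 = (m.+1 + (m + p))%N by rewrite /n; lia.
  rewrite big_split_ord/= [X in _ + X]big1 ?addr0// => k _.
  by rewrite /brauer_term ifF// /n; apply/negbTE; rewrite -ltnNge; lia.
rewrite (reindex_inj rev_ord_inj)/= mulr_sumr; apply: eq_bigr => j _.
have jm : (j <= m)%N by rewrite -ltnS.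
rewrite subSS /brauer_term ifT; last by rewrite /n; lia.
have -> : (n - (m - j).*2 = j.*2 + p)%N by rewrite /n; lia.
rewrite /falling_ratio.
have -> : (j.*2 + p)./2 = j by case: p {nN n}; lia.
rewrite -(ffact_fact jm) natrM exprD -muln2 mulnC exprM l2.
have h1 := fact_neq0 R (m - j); have h2 := fact_neq0 R (2 * j + p).
have h3 : m%:R ^+ j != 0 :> R by rewrite expf_neq0.
move: (m%:R ^+ j) ((m - j)`!%:R) ((2 * j + p)`!%:R) ((m ^_ j)%:R) (l ^+ p) h1 h2 h3.
by move=> a b c d f b0 c0 a0; field; rewrite a0 b0 c0.
Qed.

Lemma expR_sub_le (a b d : R) : 0 <= a -> 0 <= d -> b <= a + d ->
  expR (- a) - expR (- b) <= d.
Proof.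
move=> a0 d0 bad.
have h1 : expR (- (a + d)) <= expR (- b) by rewrite ler_expR lerN2.
have h2 : 1 - d <= expR (- d) by exact: expR_ge1Dx.
have h3 : expR (- a) <= 1 by rewrite expR_le1 oppr_le0.
have h4 : 0 < expR (- a) by exact: expR_gt0.
rewrite opprD expRD in h1; nra.
Qed.

(** The sum of [i / m] over [i < j]: the first-order term of minus the logarithm of the product of
    the factors [1 - i / m]. *)
Definition half_pairs (m j : nat) : R := j%:R * (j%:R - 1) / (2 * m%:R).

Lemma falling_ratio_upper (m j : nat) : (0 < m)%N ->
  (m ^_ j)%:R / m%:R ^+ j <= expR (- half_pairs m j) :> R.
Proof.
move=> m0; have mr0 : 0 < m%:R :> R by rewrite ltr0n.
elim: j => [|j IH].
  by rewrite ffactn0 expr0 divr1 /half_pairs mul0r mul0r oppr0 expR0.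
have -> : half_pairs m j.+1 = half_pairs m j + j%:R / m%:R.
  by rewrite /half_pairs -natr1; field; rewrite lt0r_neq0.
have [jm|mj] := leqP j m; last first.
  by rewrite ffact_small ?ltnS 1?ltnW// mul0r expR_ge0.
rewrite ffactnSr natrM exprSr invfM mulrACA opprD expRD.
apply: ler_pM => //.
rewrite natrB// mulrBl divff ?lt0r_neq0//; exact: expR_ge1Dx.
Qed.

(** Factor by factor, [1 - y >= exp(- y / (1 - dl))] for [0 <= y <= dl], because
    [(1 - y) (1 + y / (1 - dl)) >= 1]. *)
Lemma falling_ratio_lower (m j : nat) (dl : R) : (0 < m)%N -> dl < 1 -> j%:R / m%:R <= dl ->
  expR (- (half_pairs m j / (1 - dl))) <= (m ^_ j)%:R / m%:R ^+ j.
Proof.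
move=> m0 dl1; have mr0 : 0 < m%:R :> R by rewrite ltr0n.
elim: j => [|j IH] jm.
  by rewrite ffactn0 expr0 divr1 /half_pairs !mul0r oppr0 expR0.
have y_dl : j%:R / m%:R <= dl.
  by apply: le_trans jm; rewrite ler_pM2r ?invr_gt0// ler_nat.
have y0 : 0 <= j%:R / m%:R :> R by rewrite divr_ge0.
have -> : half_pairs m j.+1 = half_pairs m j + j%:R / m%:R.
  by rewrite /half_pairs -natr1; field; rewrite lt0r_neq0.
have jm' : (j <= m)%N.
  by rewrite -(ler_nat R) -(ler_pM2r (_ : 0 < m%:R^-1)) ?invr_gt0// divff ?lt0r_neq0//; lra.
rewrite ffactnSr natrM exprSr invfM mulrACA mulrDl opprD expRD.
apply: ler_pM; rewrite ?expR_ge0//; first exact: IH.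
rewrite natrB// mulrBl divff ?lt0r_neq0//.
move: (j%:R / m%:R) y_dl y0 => y y_dl y0.
have h1 : 1 + y / (1 - dl) <= expR (y / (1 - dl)) by exact: expR_ge1Dx.
rewrite expRN -[leLHS]mul1r ler_pdivrMr ?expR_gt0//.
apply: le_trans (_ : (1 - y) * (1 + y / (1 - dl)) <= _); last by rewrite ler_pM2l//; lra.
have -> : (1 - y) * (1 + y / (1 - dl)) = 1 + y * (dl - y) / (1 - dl).
  by field; apply/eqP; lra.
by rewrite lerDl divr_ge0 ?mulr_ge0//; lra.
Qed.

(** With [u = J / l] the exponent is [u^2 / 8] up to [1 / l], which is near [1 / 8] for [u] near 1.
    The bound is expressed by the deviation from the mean so that it can be summed against Poisson
    weights. *)
Lemma falling_ratio_bound (m J : nat) (l : R) : (4 <= m)%N -> l = Num.sqrt m%:R ->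
  `|falling_ratio m J - expR (- (1 / 8))| <=
  l^-1 + `|J%:R / l - 1| + (J%:R / l - 1) ^+ 2.
Proof.
move=> m4 lE; set u := J%:R / l.
have m0 : (0 < m)%N by lia.
have mr0 : 0 < m%:R :> R by rewrite ltr0n.
have l2 : l ^+ 2 = m%:R by rewrite lE sqr_sqrtr.
have lge2 : 2 <= l.
  rewrite -(ler_pXn2r (_ : 0 < 2)%N) ?nnegrE// ?lE ?sqrtr_ge0// -lE l2 -natrX ler_nat.
  exact: m4.
have l0 : 0 < l by lra.
set i := l^-1.
have i0 : 0 < i by rewrite invr_gt0.
have i2 : i <= 1 / 2 by rewrite -[1 / 2]invrK invf_div divr1 lef_pV2 ?posrE//; lra.
have u0 : 0 <= u by rewrite divr_ge0// ltW.
set c := expR (- (1 / 8)).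
have c0 : 0 < c by exact: expR_gt0.
have c1 : c <= 1 by rewrite expR_le1; lra.
have Q0 : 0 <= falling_ratio m J by rewrite divr_ge0// exprn_ge0// ler0n.
pose j := J./2.
have th0 : 0 <= half_pairs m j.
  rewrite /half_pairs; case: j => [|j]; first by rewrite !mul0r.
  by rewrite divr_ge0 ?mulr_ge0// -natr1 ?addrK// ltW.
have Qup : falling_ratio m J <= expR (- half_pairs m j) by exact: falling_ratio_upper.
have Q1 : falling_ratio m J <= 1.
  by apply: le_trans Qup _; rewrite expR_le1 oppr_le0.
have a0 : 0 <= `|u - 1| by exact: normr_ge0.
(* For [u >= 2] the right-hand side is at least 1, while both numbers lie in [[0, 1]]. *)
have [u2|u2] := lerP 2 u.
  have : `|falling_ratio m J - c| <= 1 by rewrite ler_norml; lra.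
  nra.
(* Writing J = 2 j + o, the exponent is (u - o i) (u - (o + 2) i) / 8. *)
pose o : R := (odd J)%:R.
have JE : J%:R = u * l by rewrite /u divfK// lt0r_neq0.
have jE : j%:R = (u * l - o) / 2.
  have J2 : J%:R = o + j%:R * 2 by rewrite /o /j -natrM -natrD muln2 odd_double_half.
  by rewrite -JE J2; field.
have il : i * l = 1 by rewrite mulVf// lt0r_neq0.
have thE : half_pairs m j = (u - o * i) * (u - (o + 2) * i) / 8.
  by rewrite /half_pairs jE -l2 /i; field; rewrite lt0r_neq0.
have [thl thu] : u ^+ 2 / 8 - i <= half_pairs m j /\ half_pairs m j <= u ^+ 2 / 8.
  rewrite thE /o; case oJ : (odd J); last by rewrite mulr0n; nra.
  have : i <= u.
    by rewrite /u /i -[leLHS]mul1r ler_pM2r ?invr_gt0// ler1n; case: J oJ {Q0 u u0 a0 u2 j th0 Qup Q1 o JE jE thE}.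
  by rewrite mulr1n; nra.
have au : (u - 1) * (u + 1) <= 3 * `|u - 1| /\ - (3 * `|u - 1|) <= (u - 1) * (u + 1).
  by split; have [h|h] := ler0P (u - 1); nra.
have d0 : 0 <= i + 3 / 8 * `|u - 1| by lra.
have up : falling_ratio m J - c <= i + 3 / 8 * `|u - 1|.
  apply: le_trans (_ : expR (- half_pairs m j) - c <= _); first by lra.
  apply: expR_sub_le => //; nra.
have jl : j%:R / m%:R <= i.
  rewrite jE -l2 /o.
  have -> : (u * l - (odd J)%:R) / 2 / l ^+ 2 = (u * l - (odd J)%:R) / 2 * i ^+ 2.
    by rewrite /i; field; rewrite lt0r_neq0.
  have o0 : 0 <= (odd J)%:R :> R by [].
  have -> : (u * l - (odd J)%:R) / 2 * i ^+ 2 = u / 2 * (i * l) * i - (odd J)%:R / 2 * i ^+ 2 by field.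
  rewrite il; nra.
have lo : c - falling_ratio m J <= i + 3 / 8 * `|u - 1|.
  apply: le_trans (_ : c - expR (- (half_pairs m j / (1 - i))) <= _).
    by rewrite lerD2l lerN2; apply: falling_ratio_lower => //; lra.
  apply: expR_sub_le; [by lra|exact: d0|].
  (* For [u < 2] the exponent is at most [1 / 2 <= 1 - i], so dividing by [1 - i] costs at most
     [i]. *)
  have : half_pairs m j / (1 - i) <= half_pairs m j + i by rewrite ler_pdivrMr; nra.
  nra.
rewrite ler_norml; have := sqr_ge0 (u - 1); lra.
Qed.

End BrauerAsymptotics.

(** * Concentration of the Poisson weights *)

Section PoissonSums.
Variable R : realType.

Lemma poisson_variance (l : R) (N : nat) :
  \sum_(J < N) (J%:R - l) ^+ 2 * (l ^+ J / J`!%:R) =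
  l * exp_sum l N + N%:R * (l - N%:R) * (l ^+ N / N`!%:R).
Proof.
elim: N => [|N IH]; first by rewrite big_ord0 /exp_sum big_ord0 mulr0 !mul0r addr0.
rewrite big_ord_recr/= IH /exp_sum big_ord_recr/= factS natrM (exprSr l).
have h := fact_neq0 R N; have h1 : N.+1%:R != 0 :> R by rewrite pnatr_eq0.
rewrite -natr1 in h1 *.
move: (\sum_(k < N) _) (l ^+ N) (N`!%:R) (N%:R) h h1 => E w f n f0 n0.
by field; rewrite f0 n0.
Qed.

Lemma poisson_variance_le (l : R) (N : nat) : 0 <= l -> l <= N%:R ->
  \sum_(J < N) (J%:R - l) ^+ 2 * (l ^+ J / J`!%:R) <= l * expR l.
Proof.
move=> l0 lN; rewrite poisson_variance; have := exp_sum_le N l0.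
have : 0 <= l ^+ N / N`!%:R by rewrite divr_ge0// exprn_ge0.
have : 0 <= N%:R :> R by [].
move: (l ^+ N / _) (exp_sum l N) (expR l) (N%:R) lN => a b e n lN n0 a0 be.
have : n * (l - n) <= 0 by nra.
nra.
Qed.

(** The parity indicator is [(1 + (-1)^(p + J)) / 2]. *)
Lemma parity_exp_sum (l : R) (p : bool) (N : nat) :
  \sum_(J < N) (odd J == p)%:R * (l ^+ J / J`!%:R) =
  (exp_sum l N + (-1) ^+ p * exp_sum (- l) N) / 2.
Proof.
rewrite /exp_sum mulr_sumr -big_split/= mulr_suml; apply: eq_bigr => J _.
rewrite (exprNn l) -(signr_odd R J).
have h := fact_neq0 R J; case: (odd J); case: p; rewrite /= ?expr0 ?expr1; field; exact: h.
Qed.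

(** Chebyshev's method: the linear deviation is traded for a quadratic one with weight [k], to which
    the variance bound applies. The choice [k = sqrt l] balances the resulting terms [1 / (2 k)] and
    [k / (2 l)]. *)
Lemma brauer_sum_finite (m : nat) (p : bool) (N : nat) (l k : R) : (4 <= m)%N ->
  l = Num.sqrt m%:R -> k = Num.sqrt l -> (m.*2 + p < N)%N -> l <= N%:R ->
  `|m`!%:R * l ^+ p * brauer_coeff R (m.*2 + p) -
    expR (- (1 / 8)) * ((exp_sum l N + (-1) ^+ p * exp_sum (- l) N) / 2)|
  <= (2 / l + 1 / k) * expR l.
Proof.
move=> m4 lE kE nN lN; set c := expR _.
have m0 : (0 < m)%N by lia.
have l0 : 0 < l by rewrite lE sqrtr_gt0 ltr0n.
have k0 : 0 < k by rewrite kE sqrtr_gt0.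
have k2 : k ^+ 2 = l by rewrite kE sqr_sqrtr// ltW.
rewrite lE (falling_sum R m0 nN) -lE -parity_exp_sum mulr_sumr -sumrB.
have w0 J : 0 <= l ^+ J / J`!%:R by rewrite divr_ge0// exprn_ge0// ltW.
pose A := l^-1 + (2 * k)^-1; pose B := (k / 2 + 1) / l ^+ 2.
have term (J : 'I_N) :
    `|(odd J == p)%:R * (falling_ratio R m J * (l ^+ J / J`!%:R)) -
      c * ((odd J == p)%:R * (l ^+ J / J`!%:R))| <=
    A * (l ^+ J / J`!%:R) + B * ((J%:R - l) ^+ 2 * (l ^+ J / J`!%:R)).
  have -> : (odd J == p)%:R * (falling_ratio R m J * (l ^+ J / J`!%:R)) -
      c * ((odd J == p)%:R * (l ^+ J / J`!%:R)) =
      ((odd J == p)%:R * (falling_ratio R m J - c)) * (l ^+ J / J`!%:R).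
    by rewrite mulrBr mulrBl !mulrA; congr (_ - _); rewrite [c * _]mulrC.
  rewrite normrM (ger0_norm (w0 J)) [B * _]mulrA -mulrDl; apply: ler_wpM2r => //.
  apply: le_trans (_ : `|falling_ratio R m J - c| <= _).
    by rewrite normrM; case: eqP; rewrite ?normr1 ?mul1r// normr0 mul0r.
  apply: le_trans (falling_ratio_bound J m4 lE) _.
  have -> : B * (J%:R - l) ^+ 2 = (k / 2 + 1) * (J%:R / l - 1) ^+ 2.
    by rewrite /B; field; rewrite lt0r_neq0.
  move: (J%:R / l - 1) => d.
  (* AM-GM: 2 |d| <= 1 / k + k d^2 *)
  have amgm : `|d| <= (2 * k)^-1 + k / 2 * d ^+ 2.
    have : 0 <= (1 - k * `|d|) ^+ 2 by exact: sqr_ge0.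
    rewrite -(real_normK (num_real d)).
    have -> : (2 * k)^-1 + k / 2 * `|d| ^+ 2 = `|d| + (1 - k * `|d|) ^+ 2 / (2 * k).
      by field; rewrite lt0r_neq0.
    by move=> h; rewrite lerDl divr_ge0// mulr_ge0// ltW.
  have -> : (k / 2 + 1) * d ^+ 2 = k / 2 * d ^+ 2 + d ^+ 2 by ring.
  by rewrite /A; lra.
apply: le_trans (ler_norm_sum _ _ _) _.
apply: le_trans (ler_sum _ (fun J _ => term J)) _.
rewrite big_split/= -!mulr_sumr.
have h1 := poisson_variance_le (ltW l0) lN.
have h2 : \sum_(J < N) l ^+ J / J`!%:R <= expR l by exact: exp_sum_le (ltW l0).
have A0 : 0 <= A by rewrite addr_ge0// invr_ge0// ?mulr_ge0// ltW.
have B0 : 0 <= B by rewrite divr_ge0// ?sqr_ge0// addr_ge0// divr_ge0// ltW.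
apply: le_trans (lerD (ler_wpM2l A0 h2) (ler_wpM2l B0 h1)) _.
rewrite mulrA -mulrDl; apply: ler_wpM2r; first exact: expR_ge0.
have -> : A + B * l = 2 / l + 1 / k; last by [].
rewrite /A /B -k2; field.
by rewrite lt0r_neq0.
Qed.

(** Let [N] tend to infinity and multiply by [exp(- l)]: the alternating series leaves an error of
    order [exp(- 2 l)], absorbed by one more [1 / l]. *)
Lemma brauer_sum_bound (m : nat) (p : bool) (l k : R) : (4 <= m)%N ->
  l = Num.sqrt m%:R -> k = Num.sqrt l ->
  `|m`!%:R * l ^+ p * brauer_coeff R (m.*2 + p) * expR (- l) - expR (- (1 / 8)) / 2|
  <= 3 / l + 1 / k.
Proof.
move=> m4 lE kE; set T := _ * brauer_coeff _ _; set c := expR (- (1 / 8)).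
have l0 : 0 < l by rewrite lE sqrtr_gt0 ltr0n; lia.
have c0 : 0 <= c by exact: expR_ge0.
have c1 : c <= 1 by rewrite expR_le1; lra.
have lim : `|T - c * ((expR l + (-1) ^+ p * expR (- l)) / 2)| <= (2 / l + 1 / k) * expR l.
  have cvgT : `|T - c * ((exp_sum l N + (-1) ^+ p * exp_sum (- l) N) / 2)| @[N --> \oo] -->
      `|T - c * ((expR l + (-1) ^+ p * expR (- l)) / 2)|.
    apply: cvg_norm; apply: cvgB; first exact: cvg_cst.
    apply: cvgM; first exact: cvg_cst.
    apply: cvgM; last exact: cvg_cst.
    apply: cvgD; first exact: cvg_exp_sum.
    apply: cvgM; [exact: cvg_cst|exact: cvg_exp_sum].
  apply: cvgr_to_le cvgT _.
  near=> N; apply: brauer_sum_finite => //.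
  by near: N; exact: nbhs_infty_gt.
  by near: N; exact: nbhs_infty_ger.
have e1 : expR l * expR (- l) = 1 by exact: expRxMexpNx_1.
have en : 0 < expR (- l) by exact: expR_gt0.
have e2 : expR (- l) * expR (- l) <= l^-1.
  have h : 1 + 2 * l <= expR (2 * l) by exact: expR_ge1Dx.
  rewrite -expRD -opprD expRN lef_pV2 ?posrE ?expR_gt0//.
  have -> : l + l = 2 * l by ring.
  lra.
have -> : T * expR (- l) - c / 2 =
    (T - c * ((expR l + (-1) ^+ p * expR (- l)) / 2)) * expR (- l) +
    c / 2 * (-1) ^+ p * (expR (- l) * expR (- l)).
  have hc : c / 2 = c / 2 * (expR l * expR (- l)) by rewrite e1 mulr1.
  rewrite [in LHS]hc.
  move: ((-1 : R) ^+ p) (expR l) (expR (- l)) => s X Y.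
  by field.
apply: le_trans (ler_normD _ _) _.
rewrite !normrM normrX normrN1 expr1n mulr1 (ger0_norm (ltW en)) (ger0_norm c0).
have -> : 3 / l + 1 / k = (2 / l + 1 / k) + l^-1 by field; rewrite lt0r_neq0//; rewrite lt0r_neq0// kE sqrtr_gt0.
apply: lerD.
  by apply: le_trans (ler_wpM2r (ltW en) lim) _; rewrite -mulrA e1 mulr1.
rewrite ger0_norm ?invr_ge0//.
have := mulr_ge0 (ltW en) (ltW en); move: (_ * _) e2 => x e2 x0.
nra.
Unshelve. all: by end_near. Qed.

Lemma cvg_sqrtn : (Num.sqrt m%:R : R) @[m --> \oo] --> +oo.
Proof.
apply/cvgryPge => A.
have /cvgryPge/(_ (A ^+ 2))[N _ HN] := @cvgr_idn R.
exists N => // m /= Nm; have [A0|A0] := lerP A 0; first exact: le_trans A0 (sqrtr_ge0 _).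
rewrite -[A]gtr0_norm// -sqrtr_sqr ler_sqrt//; exact: HN.
Qed.

Lemma cvg_brauer_sum (p : bool) :
  m`!%:R * Num.sqrt m%:R ^+ p * brauer_coeff R (m.*2 + p) * expR (- Num.sqrt m%:R)
    @[m --> \oo] --> expR (- (1 / 8)) / 2.
Proof.
pose f m := m`!%:R * Num.sqrt m%:R ^+ p * brauer_coeff R (m.*2 + p) * expR (- Num.sqrt m%:R).
pose bound m : R := 3 / Num.sqrt m%:R + 1 / Num.sqrt (Num.sqrt m%:R).
have cvgB0 : bound @ \oo --> (0 : R).
  have inv (g : nat -> R) : g @ \oo --> +oo -> (g m)^-1 @[m --> \oo] --> (0 : R).
    move=> gy; have pos : \forall m \near \oo, 0 < g m by move/cvgryPgt: (gy); apply.
    by case: (gtr0_cvgV0 pos) => _; apply.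
  have c1 := inv _ cvg_sqrtn.
  have c2 : (Num.sqrt (Num.sqrt m%:R))^-1 @[m --> \oo] --> (0 : R).
    apply: inv; apply/cvgryPge => A.
    have /cvgryPge/(_ (A ^+ 2))[N _ HN] := cvg_sqrtn.
    exists N => // m /= Nm; have [A0|A0] := lerP A 0; first exact: le_trans A0 (sqrtr_ge0 _).
    rewrite -[A]gtr0_norm// -sqrtr_sqr ler_sqrt ?sqrtr_ge0//; exact: HN.
  rewrite -[X in _ --> X](_ : 3 * 0 + 1 * 0 = _); last by rewrite !mulr0 addr0.
  by apply: cvgD; apply: cvgMr.
have fc : (f m - expR (- (1 / 8)) / 2) @[m --> \oo] --> (0 : R).
  apply/norm_cvg0P; apply: squeeze_cvgr (cvg_cst 0) cvgB0.
  near=> m; rewrite normr_ge0 /=; apply: brauer_sum_bound => //.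
  by near: m; exact: nbhs_infty_ge.
have -> : (fun m => m`!%:R * Num.sqrt m%:R ^+ p * brauer_coeff R (m.*2 + p) *
    expR (- Num.sqrt m%:R)) = (fun m => (f m - expR (- (1 / 8)) / 2) + expR (- (1 / 8)) / 2).
  by apply/funext => m; rewrite subrK.
rewrite -[X in _ --> X]add0r; apply: cvgD fc _; exact: cvg_cst.
Unshelve. all: by end_near. Qed.

End PoissonSums.

(** * Stirling's formula up to a constant *)

Section StirlingLimit.
Variable R : realType.

Lemma ge_of_derive_ge0 (f f' : R -> R) : (forall x : R, is_derive x 1 f (f' x)) ->
  (forall x, 0 < x -> 0 <= f' x) -> forall z, 0 <= z -> f 0 <= f z.
Proof.
move=> df f'0 z z0; apply: (@ger0_derive1_ndecry _ f 0) => //.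
- by move=> x; rewrite in_itv/= andbT => x0; rewrite derive1E derive_val; exact: f'0.
- apply: continuous_subspaceT => x; apply: differentiable_continuous.
  by apply/derivable1_diffP.
Qed.

Lemma tanh_le (z : R) : 0 <= z -> 2 * (expR z - 1) <= z * (expR z + 1).
Proof.
move=> z0; rewrite -subr_ge0.
pose f x : R := x * (expR x + 1) - 2 * (expR x - 1).
have f0 : f 0 = 0 by rewrite /f expR0 mul0r subrr mulr0 subrr.
have df (x : R) : is_derive x 1 f (1 - (1 - x) * expR x).
  rewrite /f; apply: is_derive_eq.
  by rewrite /GRing.scale/=; ring.
have := ge_of_derive_ge0 df _ z0; rewrite f0; apply => x x0.
have : 1 - x <= expR (- x) by exact: expR_ge1Dx.
have := expR_gt0 x; have := @expRxMexpNx_1 R x; nra.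
Qed.

Lemma sinh_ge (z : R) : 0 <= z -> 2 * z <= expR z - expR (- z).
Proof.
move=> z0; rewrite -subr_ge0.
pose f x : R := expR x - expR (- x) - 2 * x.
have f0 : f 0 = 0 by rewrite /f oppr0 expR0 mulr0 subrr subr0.
have df (x : R) : is_derive x 1 f (expR x + expR (- x) - 2).
  rewrite /f; apply: is_derive_eq.
  by rewrite /GRing.scale/=; ring.
have := ge_of_derive_ge0 df _ z0; rewrite f0; apply => x x0.
have := expR_gt0 x; have := expR_gt0 (- x); have := @expRxMexpNx_1 R x.
move: (expR x) (expR (- x)) => a b ab b0 a0.
have : 0 <= (a - b) ^+ 2 by exact: sqr_ge0.
nra.
Qed.

(** The two preceding inequalities, [tanh(z / 2) <= z / 2] and [z <= sinh z], at
    [z = ln((N + 1) / N)]. They control the steps of [stirling_log]. *)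
Lemma ln_succ_bounds (N : nat) : (0 < N)%N ->
  1 <= (N%:R + 1 / 2) * (ln N.+1%:R - ln N%:R : R) <=
    1 + 1 / 4 * (N%:R^-1 - N.+1%:R^-1).
Proof.
move=> N0; have n0 : 0 < N%:R :> R by rewrite ltr0n.
set z := ln _ - ln _.
have n10 : 0 < N.+1%:R :> R by rewrite ltr0n.
have ez : expR z = N.+1%:R / N%:R by rewrite expRB !lnK ?posrE.
have z0 : 0 <= z by rewrite subr_ge0 ler_ln ?posrE// ler_nat.
have h1 := tanh_le z0; have h2 := sinh_ge z0.
rewrite expRN ez in h2; rewrite ez in h1.
have e1 : N.+1%:R = N%:R + 1 :> R by rewrite natr1.
rewrite e1 in h1 h2 n10 *.
move: (N%:R) n0 n10 h1 h2 => n n0 n10 h1 h2; apply/andP; split.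
  have E : z * ((n + 1) / n + 1) - 2 * ((n + 1) / n - 1) = ((n + 1 / 2) * z - 1) * (2 / n).
    by field; rewrite lt0r_neq0.
  have : 0 <= ((n + 1 / 2) * z - 1) * (2 / n) by rewrite -E subr_ge0.
  by rewrite pmulr_lge0 ?divr_gt0// subr_ge0.
have E : ((n + 1) / n - ((n + 1) / n)^-1) * ((n + 1 / 2) / 2) = 1 + 1 / 4 * (n^-1 - (n + 1)^-1).
  by field; rewrite !lt0r_neq0.
have p0 : 0 <= (n + 1 / 2) / 2 by rewrite divr_ge0// addr_ge0// ltW.
by rewrite -E; have := ler_wpM2r p0 h2; lra.
Qed.

(** The logarithm of [N! e^N / N^(N + 1/2)] at [N = n + 1]; the shift avoids the logarithm of 0. *)
Definition stirling_log (n : nat) : R :=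
  ln n.+1`!%:R + n.+1%:R - (n.+1%:R + 1 / 2) * ln n.+1%:R.

(** The sequence decreases, and its steps are dominated by a telescoping sum, which bounds it
    below. *)
Lemma stirling_log_cvg : exists d : R, stirling_log @ \oo --> d.
Proof.
have step n : 0 <= stirling_log n - stirling_log n.+1 <= 1 / 4 * (n.+1%:R^-1 - n.+2%:R^-1).
  have -> : stirling_log n - stirling_log n.+1 =
      (n.+1%:R + 1 / 2) * (ln n.+2%:R - ln n.+1%:R) - 1.
    rewrite /stirling_log (factS n.+1) natrM lnM ?posrE ?ltr0n ?fact_gt0//.
    have -> : n.+2%:R = n.+1%:R + 1 :> R by rewrite natr1.
    move: (n.+1%:R) (ln n.+1%:R) (ln (n.+1%:R + 1)) (ln n.+1`!%:R) => e c b a.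
    by field.
  by have /andP[h1 h2] := ln_succ_bounds (ltn0Sn n); rewrite subr_ge0 h1 lerBlDl.
have low n : stirling_log 0 - 1 / 4 * (1 - n.+1%:R^-1) <= stirling_log n.
  elim: n => [|n IH]; first by rewrite invr1 subrr mulr0 subr0.
  have /andP[_] := step n; move: IH.
  move: (n.+1%:R^-1) (n.+2%:R^-1) (stirling_log 0) (stirling_log n) (stirling_log n.+1).
  by move=> a b x y w; lra.
apply/cvg_ex; apply: nonincreasing_is_cvgn.
  by apply/nonincreasing_seqP => n; have /andP[h _] := step n; rewrite -subr_ge0.
exists (stirling_log 0 - 1 / 4) => _ [n _ <-].
apply: le_trans (low n); have : 0 <= n.+1%:R^-1 :> R by [].
by move: (n.+1%:R^-1) (stirling_log 0) => a b; lra.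
Qed.

Lemma factE_stirling n : n.+1`!%:R =
  expR (stirling_log n - n.+1%:R + (n.+1%:R + 1 / 2) * ln n.+1%:R).
Proof.
have -> : stirling_log n - n.+1%:R + (n.+1%:R + 1 / 2) * ln n.+1%:R = ln n.+1`!%:R.
  by rewrite /stirling_log; ring.
by rewrite lnK// posrE ltr0n fact_gt0.
Qed.

End StirlingLimit.

Section BrauerCountAsymptotics.
Variable R : realType.

Lemma powR_expR (a x : R) : 0 < a -> a `^ x = expR (x * ln a).
Proof. by move=> a0; rewrite /powR gt_eqF. Qed.

Lemma sqrt_expR (a : R) : 0 < a -> Num.sqrt a = expR (ln a / 2).
Proof. by move=> a0; rewrite -powR12_sqrt ?ltW// powR_expR// mulrC. Qed.

Definition brauer_asymptote (n : nat) : R :=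
  2 `^ (n%:R / 2 - 1 / 2) * expR (Num.sqrt (n%:R / 2) - n%:R / 2 - 1 / 8) *
  n%:R `^ (n%:R / 2).

Definition normalized_sum (p : bool) (m : nat) : R :=
  m`!%:R * Num.sqrt m%:R ^+ p * brauer_coeff R (m.*2 + p) * expR (- Num.sqrt m%:R).

(** [X] gathers the logarithmic errors, so that each parity reduces to an identity between
    exponents. *)
Lemma ratio_eq (p : bool) (m n : nat) (X : R) : n = (m.+1.*2 + p)%N ->
  n`!%:R = m.+1`!%:R * Num.sqrt m.+1%:R ^+ p * expR (- Num.sqrt m.+1%:R) * expR X *
           brauer_asymptote n ->
  (brauer_count n)%:R / brauer_asymptote n = normalized_sum p m.+1 * expR X.
Proof.
move=> nE factE.
have n0 : (0 < n)%N by rewrite nE; lia.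
have g0 : brauer_asymptote n != 0.
  by rewrite lt0r_neq0// !mulr_gt0 ?expR_gt0 ?powR_gt0 ?ltr0n.
have -> : (brauer_count n)%:R = n`!%:R * brauer_coeff R n.
  by rewrite /brauer_coeff mulrC divfK// fact_neq0.
apply: (mulIf g0); rewrite divfK// /normalized_sum -nE factE.
by move: (m.+1`!%:R) (_ ^+ p) (expR _) (expR _) => a b c d; ring.
Qed.

(** The constant [ln 2 + 1 / 8] compensates the limit [exp(- 1 / 8) / 2] of the normalized sum. *)
Lemma ratio_even (m : nat) :
  (brauer_count m.+1.*2)%:R / brauer_asymptote m.+1.*2 =
  normalized_sum false m.+1 *
  expR (stirling_log R m.*2.+1 - stirling_log R m + (ln 2 + 1 / 8)).
Proof.
apply: ratio_eq; first by rewrite addn0.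
rewrite doubleS !factE_stirling expr0 mulr1 /brauer_asymptote.
have m0 : 0 < m.+1%:R :> R by rewrite ltr0n.
have nE : m.*2.+2%:R = 2 * m.+1%:R :> R by rewrite -natrM; congr _%:R; lia.
rewrite nE !powR_expR ?mulr_gt0// lnM ?posrE//.
have -> : 2 * m.+1%:R / 2 = m.+1%:R :> R by field.
by rewrite -!expRD; congr expR; field.
Qed.

(** With [M = m.+1] and [n = 2 M + 1], two corrections join the even case: one from [ln n] against
    [ln (2 M)], one from [sqrt M] against [sqrt (n / 2)]. *)
Lemma ratio_odd (m : nat) :
  (brauer_count m.+1.*2.+1)%:R / brauer_asymptote m.+1.*2.+1 =
  normalized_sum true m.+1 *
  expR (stirling_log R m.+1.*2 - stirling_log R m + (ln 2 + 1 / 8)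
    + ((m.+1%:R + 1) * ln (1 + (2 * m.+1%:R)^-1) - 1 / 2)
    + (Num.sqrt m.+1%:R - Num.sqrt (m.+1%:R + 1 / 2))).
Proof.
apply: ratio_eq; first by rewrite addn1.
rewrite !factE_stirling expr1 /brauer_asymptote.
have m0 : 0 < m.+1%:R :> R by rewrite ltr0n.
have nE : m.+1.*2.+1%:R = 2 * m.+1%:R + 1 :> R by rewrite -natrM natr1; congr _%:R; lia.
have -> : (m.+1.*2.+1%:R : R) / 2 = m.+1%:R + 1 / 2 by rewrite nE; field.
have n0 : 0 < m.+1.*2.+1%:R :> R by rewrite ltr0n.
rewrite {1}(sqrt_expR m0) !powR_expR//.
have lnE : ln m.+1.*2.+1%:R = ln 2 + ln m.+1%:R + ln (1 + (2 * m.+1%:R)^-1) :> R.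
  have q0 : 0 < 1 + (2 * m.+1%:R)^-1 :> R by rewrite addr_gt0// invr_gt0 mulr_gt0.
  rewrite -!lnM ?posrE ?mulr_gt0//; congr ln; rewrite nE; field.
  by rewrite lt0r_neq0.
by rewrite lnE nE -!expRD; congr expR; field.
Qed.

(** Based on [1 / (2 y + 1) <= ln(1 + 1 / (2 y)) <= 1 / (2 y)]; the lower bound is [ln x <= x - 1]
    applied to the reciprocal. *)
Lemma cvg_ln_term : ((m.+1%:R + 1) * ln (1 + (2 * m.+1%:R)^-1) - 1 / 2 : R) @[m --> \oo] --> (0 : R).
Proof.
apply: (squeeze_cvgr (f := fun=> 0) (h := fun m => (m.+1%:R : R)^-1)); last 2 first.
- exact: cvg_cst.
- exact: cvg_harmonic.
near=> m; have m0 : 0 < m.+1%:R :> R by rewrite ltr0n.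
move: (m.+1%:R) m0 => y y0.
have q0 : 0 < (2 * y)^-1 by rewrite invr_gt0 mulr_gt0.
have up : ln (1 + (2 * y)^-1) <= (2 * y)^-1 by apply: le_ln1Dx; lra.
have y1 : 0 < 2 * y + 1 by lra.
have lo : (2 * y + 1)^-1 <= ln (1 + (2 * y)^-1).
  rewrite -[leRHS]opprK -lnV ?posrE; last by lra.
  have -> : (1 + (2 * y)^-1)^-1 = 1 + (- (2 * y + 1)^-1).
    by field; rewrite !lt0r_neq0//; lra.
  rewrite lerNr; apply: le_ln1Dx; rewrite ltrN2 invf_lt1//; lra.
apply/andP; split.
  have h := ler_wpM2l (_ : 0 <= y + 1) lo.
  have E : (y + 1) * (2 * y + 1)^-1 = 1 / 2 + (2 * (2 * y + 1))^-1.
    by field; rewrite lt0r_neq0.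
  have : 0 <= (2 * (2 * y + 1))^-1 by rewrite invr_ge0; lra.
  have {}h := h (ltW (addr_gt0 y0 ltr01)); rewrite E in h; lra.
have h := ler_wpM2l (ltW (addr_gt0 y0 ltr01)) up.
have E : (y + 1) * (2 * y)^-1 = 1 / 2 + (1 / 2) * y^-1 by field; rewrite lt0r_neq0.
rewrite E in h; have : 0 < y^-1 by rewrite invr_gt0.
lra.
Unshelve. all: by end_near. Qed.

(** The two roots differ by at most [1 / s] with [s = sqrt y], since [(s + 1 / s)^2 >= s^2 + 2]. *)
Lemma cvg_sqrt_term :
  (Num.sqrt m.+1%:R - Num.sqrt (m.+1%:R + 1 / 2) : R) @[m --> \oo] --> (0 : R).
Proof.
have inv : - (Num.sqrt m.+1%:R : R)^-1 @[m --> \oo] --> (0 : R).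
  rewrite -oppr0; apply: cvgN.
  have h : (Num.sqrt m%:R : R)^-1 @[m --> \oo] --> (0 : R).
    have gy := @cvg_sqrtn R.
    have pos : \forall m \near \oo, 0 < Num.sqrt m%:R :> R by move/cvgryPgt: (gy); apply.
    by case: (gtr0_cvgV0 pos) => _; apply.
  by rewrite -(cvg_shiftS (fun m => (Num.sqrt m%:R : R)^-1)) in h.
apply: (squeeze_cvgr _ inv (cvg_cst 0)).
near=> m; have m0 : 0 < m.+1%:R :> R by rewrite ltr0n.
move: (m.+1%:R) m0 => y y0.
have s0 : 0 < Num.sqrt y by rewrite sqrtr_gt0.
have s2 : Num.sqrt y ^+ 2 = y by rewrite sqr_sqrtr// ltW.
apply/andP; split; last by rewrite subr_le0 ler_sqrt//; lra.
suff h : Num.sqrt (y + 1 / 2) <= Num.sqrt y + (Num.sqrt y)^-1 by lra.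
rewrite -[leRHS]ger0_norm; last by rewrite addr_ge0// ?invr_ge0 ltW.
rewrite -sqrtr_sqr ler_sqrt ?sqr_ge0//.
have -> : (Num.sqrt y + (Num.sqrt y)^-1) ^+ 2 = y + 2 + (Num.sqrt y)^-1 ^+ 2.
  by rewrite -{3}s2; field; rewrite lt0r_neq0.
have := sqr_ge0 (Num.sqrt y)^-1; lra.
Unshelve. all: by end_near. Qed.

Lemma brauer_count_asymptotics :
  asymp_equiv (fun n => (brauer_count n)%:R : R) brauer_asymptote.
Proof.
have [d Sd] := stirling_log_cvg R.
have sub (f : nat -> nat) : (forall m, (m <= f m)%N) ->
    stirling_log R (f m) @[m --> \oo] --> d.
  move=> fm; apply: (cvg_comp _ _ _ Sd).
  by apply/cvgnyPge => A; exists A => // m /= Am; exact: leq_trans (fm m).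
have val : expR (- (1 / 8)) / 2 * expR (d - d + (ln 2 + 1 / 8)) = 1 :> R.
  rewrite subrr add0r expRD lnK ?posrE//.
  have := @expRxMexpNx_1 R (1 / 8); move: (expR _) (expR _) => a b ab.
  by rewrite -[RHS]ab; field.
have nsum p : normalized_sum p m.+1 @[m --> \oo] --> expR (- (1 / 8)) / 2.
  by rewrite (cvg_shiftS (normalized_sum p)); exact: cvg_brauer_sum.
have expC (f : nat -> R) l : f @ \oo --> l -> expR (f m) @[m --> \oo] --> expR l.
  by move=> fl; apply: (cvg_comp _ _ fl); exact: continuous_expR.
pose u n : R := (brauer_count n)%:R / brauer_asymptote n.
apply: (@cvg_even_odd R u).
- rewrite -(cvg_shiftS (fun m => u m.*2)) -val.
  rewrite (_ : (fun m => u m.+1.*2) = fun m => normalized_sum false m.+1 *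
      expR (stirling_log R m.*2.+1 - stirling_log R m + (ln 2 + 1 / 8))); last first.
    by apply/funext => m; exact: ratio_even.
  apply: cvgM; first exact: nsum.
  apply: expC; apply: cvgD; last exact: cvg_cst.
  by apply: cvgB; [apply: (sub (fun m => m.*2.+1)) => m; lia|exact: Sd].
- rewrite -(cvg_shiftS (fun m => u m.*2.+1)) -val.
  rewrite (_ : (fun m => u m.+1.*2.+1) = fun m => normalized_sum true m.+1 *
      expR (stirling_log R m.+1.*2 - stirling_log R m + (ln 2 + 1 / 8)
    + ((m.+1%:R + 1) * ln (1 + (2 * m.+1%:R)^-1) - 1 / 2)
    + (Num.sqrt m.+1%:R - Num.sqrt (m.+1%:R + 1 / 2)))); last first.
    by apply/funext => m; exact: ratio_odd.
  apply: cvgM; first exact: nsum.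
  apply: expC; rewrite -[X in _ --> X]addr0 -[X in _ --> X + _]addr0.
  apply: cvgD; last exact: cvg_sqrt_term.
  apply: cvgD; last exact: cvg_ln_term.
  apply: cvgD; last exact: cvg_cst.
  by apply: cvgB; [apply: (sub (fun m => m.+1.*2)) => m; lia|exact: Sd].
Qed.

End BrauerCountAsymptotics.

Theorem mainTheorem6 (R : realType) (t : R[i]) (ht : generic t) :
  exists b : nat -> nat,
    [/\ forall n k : nat, has_num_summands t n k <-> k = b n,
        forall x : R,
          pseries (fun n : nat => (b n)%:R / (n`!)%:R) x @ \oo
            --> expR (x ^+ 2 + x)
      & asymp_equiv
          (fun n : nat => (b n)%:R : R)
          (fun n : nat =>
             2 `^ (n%:R / 2 - 1 / 2)
             * expR (Num.sqrt (n%:R / 2) - n%:R / 2 - 1 / 8)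
             * n%:R `^ (n%:R / 2))].
Proof.
exists brauer_count; split.
- by move=> n k; rewrite -num_symmetric_diagramsE; exact: generic_num_summands.
- exact: brauer_count_egf.
- exact: brauer_count_asymptotics.
Qed.
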